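(* (Two-round point-to-point.) The set of triples $(R_0,R_X,R_Y)$ in the rate region of the function computation problem with $R_X>H(X)$ equals the set of triples with $R_X> H(X)$ and \begin{align*} R_0\ge I(X;U|Y),\qquad R_Y\ge I(Y;W|X,U), \end{align*} for some random variables $U,W$ with finite alphabets $\mathcal U,\mathcal W$ jointly distributed with $(X,Y)$ such that $U-X-Y$ and $X-(U,Y)-W$ are Markov chains and $(U,Y)\in W\in\mathrm M(\Gamma(G_{U,Y|X,U}))$; moreover one may restrict to $|\mathcal U|\le|\mathcal X|+2$ and $|\mathcal W|\le(|\mathcal X|+2)|\mathcal Y|+1$.
   Context: Setup: $\mathcal X,\mathcal Y,\mathcal F$ finite, $(X_i,Y_i)_{i\ge1}$ i.i.d. copies of $(X,Y)\sim p(x,y)$, $f:\mathcal X\times\mathcal Y\to\mathcal F$ applied componentwise to sequences. An $(n,R_0,R_X,R_Y)$ code consists of encoders $\varphi_0:\mathcal X^n\to\{1,\dots,2^{nR_0}\}$, $\varphi_X:\mathcal X^n\to\{1,\dots,2^{nR_X}\}$, $\varphi_Y:\mathcal Y^n\times\{1,\dots,2^{nR_0}\}\to\{1,\dots,2^{nR_Y}\}$ and a decoder $\psi:\{1,\dots,2^{nR_X}\}\times\{1,\dots,2^{nR_Y}\}\to\mathcal F^n$, with error probability $P(\psi(\varphi_X(\mathbf X),\varphi_Y(\varphi_0(\mathbf X),\mathbf Y))\ne f(\mathbf X,\mathbf Y))$. A triple is achievable if for every $\varepsilon>0$ and all large $n$ a code with error probability $\le\varepsilon$ exists; the rate region is the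 closure of the achievable set. Generalized conditional characteristic graph: for jointly distributed $(L,K,S)\sim p(l,k,s)$ and a function $f$ of $S$ with $H(f(S)|L,K)=0$, $G_{L|K}$ has vertex set $\mathcal L$ and $l_1,l_2$ adjacent iff there exist $s_1,s_2,k$ with $p(l_1,k,s_1)p(l_2,k,s_2)>0$ and $f(s_1)\ne f(s_2)$. Here $G_{U,Y|X,U}$ uses $L=(U,Y)$, $K=(X,U)$, $S=(X,Y)$ with function $f(X,Y)$. $\Gamma(G)$ is the set of independent sets of $G$; $Z\in W\in\mathrm M(\Gamma(G))$ means $W$ is a random variable each of whose values is an independent set of $G$ (distinct values may be the same set) and $P(Z\in W)=1$. *)

(* Defs.v *)
From mathcomp Require Import all_boot.
From Stdlib Require Import Reals.

Set Implicit Arguments.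
Unset Strict Implicit.
Unset Printing Implicit Defensive.

Local Open Scope R_scope.

Definition rsum (T : finType) (g : T -> R) : R := \big[Rplus/0]_(t : T) g t.
Definition rprod (n : nat) (g : 'I_n -> R) : R := \big[Rmult/1]_(i < n) g i.

Definition is_pmf (T : finType) (P : T -> R) : Prop :=
  (forall t, 0 <= P t) /\ rsum P = 1.

Definition marg (T : finType) (Z : eqType) (P : T -> R) (g : T -> Z) (z : Z) : R :=
  rsum (fun t => if g t == z then P t else 0).

Definition log2 (x : R) : R := ln x / ln 2.

(* Shannon entropy H(g) (bits); terms with P t = 0 vanish. *)
Definition entropy (T : finType) (Z : eqType) (P : T -> R) (g : T -> Z) : R :=
  - rsum (fun t => P t * log2 (marg P g (g t))).

Definition condMI (T : finType) (A B C : eqType) (P : T -> R)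
  (a : T -> A) (b : T -> B) (c : T -> C) : R :=
  rsum (fun t => P t * log2
     ((marg P (fun s => (a s, b s, c s)) (a t, b t, c t) * marg P c (c t)) /
      (marg P (fun s => (a s, c s)) (a t, c t) * marg P (fun s => (b s, c s)) (b t, c t)))).

Definition markov (T : finType) (A B C : eqType) (P : T -> R)
  (a : T -> A) (b : T -> B) (c : T -> C) : Prop :=
  forall x y z,
    marg P (fun s => (a s, b s, c s)) (x, y, z) * marg P b y =
    marg P (fun s => (a s, b s)) (x, y) * marg P (fun s => (b s, c s)) (y, z).

Definition char_adj (T : finType) (L K S F : eqType) (P : T -> R)
  (lv : T -> L) (kv : T -> K) (sv : T -> S) (g : S -> F) (l1 l2 : L) : Prop :=
  exists (s1 s2 : S) (k : K),
    0 < marg P (fun t => (lv t, kv t, sv t)) (l1, k, s1) *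
        marg P (fun t => (lv t, kv t, sv t)) (l2, k, s2) /\ g s1 <> g s2.

Definition indep_set (V : finType) (adj : V -> V -> Prop) (A : {set V}) : Prop :=
  forall a b, a \in A -> b \in A -> ~ adj a b.

Definition msize (n : nat) (r : R) : nat :=
  Z.to_nat (Int_part (Rpower 2 (INR n * r))).

Record code (X Y F : finType) (n m0 mX mY : nat) := Code {
  enc0 : {ffun 'I_n -> X} -> 'I_m0;
  encX : {ffun 'I_n -> X} -> 'I_mX;
  encY : {ffun 'I_n -> Y} -> 'I_m0 -> 'I_mY;
  dec  : 'I_mX -> 'I_mY -> {ffun 'I_n -> F}
}.

Definition err_prob (X Y F : finType) (p : X * Y -> R) (f : X -> Y -> F)
  (n m0 mX mY : nat) (c : code X Y F n m0 mX mY) : R :=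
  rsum (fun xy : {ffun 'I_n -> X} * {ffun 'I_n -> Y} =>
    rprod (fun i => p (xy.1 i, xy.2 i)) *
    (if dec c (encX c xy.1) (encY c xy.2 (enc0 c xy.1)) == [ffun i => f (xy.1 i) (xy.2 i)]
     then 0 else 1)).

Definition achievable (X Y F : finType) (p : X * Y -> R) (f : X -> Y -> F)
  (R0 RX RY : R) : Prop :=
  forall eps, 0 < eps -> exists N : nat, forall n : nat, (N <= n)%nat ->
    exists c : code X Y F n (msize n R0) (msize n RX) (msize n RY),
      err_prob p f c <= eps.

Definition rate_region (X Y F : finType) (p : X * Y -> R) (f : X -> Y -> F)
  (R0 RX RY : R) : Prop :=
  forall d, 0 < d -> exists a0 aX aY, achievable p f a0 aX aY /\
    Rabs (a0 - R0) < d /\ Rabs (aX - RX) < d /\ Rabs (aY - RY) < d.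

Section Coords.
Variables (X Y U W : finType).
Definition cX (t : X * Y * U * W) : X := t.1.1.1.
Definition cY (t : X * Y * U * W) : Y := t.1.1.2.
Definition cU (t : X * Y * U * W) : U := t.1.2.
Definition cW (t : X * Y * U * W) : W := t.2.
End Coords.

(* The single-letter characterization: Q is a joint pmf of (X,Y,U,W) with
   (X,Y)-marginal p, W is a random variable with values independent sets of
   G_{U,Y|X,U} (labelled by lab), U - X - Y and X - (U,Y) - W Markov,
   P((U,Y) in W) = 1, and the rate inequalities hold. *)
Definition single_letter (X Y F U W : finType) (p : X * Y -> R) (f : X -> Y -> F)
  (Q : X * Y * U * W -> R) (lab : W -> {set U * Y}) (R0 RY : R) : Prop :=
  is_pmf Q /\
  (forall xy, marg Q (fun t => (cX t, cY t)) xy = p xy) /\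
  markov Q (@cU X Y U W) (@cX X Y U W) (@cY X Y U W) /\
  markov Q (@cX X Y U W) (fun t => (cU t, cY t)) (@cW X Y U W) /\
  (forall w, indep_set
     (char_adj Q (fun t => (cU t, cY t)) (fun t => (cX t, cU t)) (fun t => (cX t, cY t))
        (fun s : X * Y => f s.1 s.2)) (lab w)) /\
  rsum (fun t => if (cU t, cY t) \in lab (cW t) then Q t else 0) = 1 /\
  condMI Q (@cX X Y U W) (@cU X Y U W) (@cY X Y U W) <= R0 /\
  condMI Q (@cY X Y U W) (@cW X Y U W) (fun t => (cX t, cU t)) <= RY.

(* Main.v *)
(* Achievability is by random binning.  A variable [a] correlated with [b] is hashed; with fewer
   than [H(a|b)] bits of hash the hash value is nearly independent of [b], so that it can be fixed
   in advance and [a] regenerated from [b] by a deterministic choice, while [H(a|d)] bits of hash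
   suffice to recover [a] from side information [d].  The difference [H(a|d) - H(a|b)] is the rate
   that has to be sent.  This is used for [X] itself, for [U] (sent to the owner of [Y]) and for
   [W] (sent to the decoder, which knows [X] and hence [U]).  Since everything is compared in total
   variation with the i.i.d. law, [f] is recovered exactly and no typicality is needed.

   For the converse, [U = (I, M0, X^(I-1), Y_(I+1)^n)] with a uniform time [I], and [W] is the
   answer of the second encoder; both mutual informations telescope exactly.  The alphabets are
   reduced to fixed sizes at the level of approximate solutions, and a limit of approximate
   solutions with vanishing error is an exact one. *)
From HB Require Import structures.
Require Import Defs.
From mathcomp Require Import all_boot.
From Stdlib Require Import ZArith Reals Lra.
From Stdlib Require Import Classical IndefiniteDescription FunctionalExtensionality.

Set Implicit Arguments.
Unset Strict Implicit.
Unset Printing Implicit Defensive.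

Local Open Scope R_scope.

(** * Finite sums, marginals and entropy *)

(** The graph condition is all-or-nothing, whereas a code only gives an estimate of [f] that errs
    with small probability. Approximate solutions therefore carry an estimator of [f(X,Y)] from
    [(X,U,W)] in place of labels. The estimators need not converge along a sequence of solutions;
    what passes to the limit is that two values of [y] in conflict at the same [(x,u,w)] cannot both
    keep positive mass. The labels are then read off the limit law as the supports of [(U,Y)] given
    [W]. The constants count linear constraints: for [U], the [#|X|] values of the marginal of [X]
    and the two mutual informations; for [W], the [#|U| * #|Y|] values of the marginal of [(U,Y)]
    and one mutual information. The total mass is a sum of marginal values and costs nothing; the
    error costs nothing because it is the objective that is minimised. In the direct part each
    binning stage accepts an arbitrary error event. The failure of the stage for [W], run on
    regenerated data, is the error event of the stage for [U], so the stages compose without any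
    estimate on the joint law of their outputs. *)

Lemma RplusA : associative Rplus. Proof. by move=> x y z; ring. Qed.
Lemma RplusC : commutative Rplus. Proof. by move=> x y; ring. Qed.
Lemma RmultA : associative Rmult. Proof. by move=> x y z; ring. Qed.
Lemma RmultC : commutative Rmult. Proof. by move=> x y; ring. Qed.
Lemma RmultDl : left_distributive Rmult Rplus. Proof. by move=> x y z; ring. Qed.
Lemma RmultDr : right_distributive Rmult Rplus. Proof. by move=> x y z; ring. Qed.

HB.instance Definition _ := Monoid.isComLaw.Build R 0 Rplus RplusA RplusC Rplus_0_l.
HB.instance Definition _ := Monoid.isComLaw.Build R 1 Rmult RmultA RmultC Rmult_1_l.
HB.instance Definition _ := Monoid.isMulLaw.Build R 0 Rmult Rmult_0_l Rmult_0_r.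
HB.instance Definition _ := Monoid.isAddLaw.Build R Rmult Rplus RmultDl RmultDr.

Notation "\sum_ ( i : t ) F" := (\big[Rplus/0]_(i : t) F%R) : R_scope.
Notation "\sum_ i F" := (\big[Rplus/0]_i F%R) : R_scope.
Notation "\sum_ ( i | P ) F" := (\big[Rplus/0]_(i | P%B) F%R) : R_scope.
Notation "\sum_ ( i < n ) F" := (\big[Rplus/0]_(i < n) F%R) : R_scope.
Notation "\prod_ i F" := (\big[Rmult/1]_i F%R) : R_scope.
Notation "\prod_ ( i | P ) F" := (\big[Rmult/1]_(i | P%B) F%R) : R_scope.

Definition ind (b : bool) : R := if b then 1 else 0.

Lemma ind_ge0 b : 0 <= ind b. Proof. by case: b; rewrite /ind; lra. Qed.
Lemma ind_le1 b : ind b <= 1. Proof. by case: b; rewrite /ind; lra. Qed.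
Lemma ind_and b c : ind (b && c) = ind b * ind c.
Proof. by case: b; case: c; rewrite /ind /=; lra. Qed.
Lemma ind_or b c : ind (b || c) <= ind b + ind c.
Proof. by case: b; case: c; rewrite /ind /=; lra. Qed.
Lemma ind_le (b c : bool) : (b -> c) -> ind b <= ind c.
Proof. by case: b; case: c => // h; rewrite /ind; try lra; have := h isT. Qed.
Lemma if_ind b x : (if b then x else 0) = ind b * x.
Proof. by case: b; rewrite /ind; lra. Qed.

Lemma eq_div_of_mul x y z : y <> 0 -> x * y = z -> x = z / y.
Proof. by move=> y0 <-; field. Qed.

Lemma sum_le (I : finType) (P : pred I) (f g : I -> R) :
  (forall i, P i -> f i <= g i) -> \sum_(i | P i) f i <= \sum_(i | P i) g i.
Proof.
by move=> h; elim/big_ind2: _ => //; [lra|move=> *; lra].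
Qed.

Lemma sum_ge0 (I : finType) (P : pred I) (f : I -> R) :
  (forall i, P i -> 0 <= f i) -> 0 <= \sum_(i | P i) f i.
Proof. by move=> h; elim/big_ind: _ => //; [lra|move=> *; lra]. Qed.

Lemma sum_mull (I : finType) (P : pred I) (c : R) (f : I -> R) :
  \sum_(i | P i) (c * f i) = c * \sum_(i | P i) f i.
Proof. by rewrite big_distrr. Qed.

Lemma sum_mulr (I : finType) (P : pred I) (c : R) (f : I -> R) :
  \sum_(i | P i) (f i * c) = (\sum_(i | P i) f i) * c.
Proof. by rewrite big_distrl. Qed.

Lemma sum_add (I : finType) (P : pred I) (f g : I -> R) :
  \sum_(i | P i) (f i + g i) = \sum_(i | P i) f i + \sum_(i | P i) g i.
Proof. by rewrite big_split. Qed.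

Lemma sum_opp (I : finType) (P : pred I) (f : I -> R) :
  \sum_(i | P i) (- f i) = - \sum_(i | P i) f i.
Proof.
rewrite -[RHS]Rmult_1_l -Ropp_mult_distr_r Ropp_mult_distr_l -sum_mull.
by apply: eq_bigr => i _; lra.
Qed.

Lemma sum_sub (I : finType) (P : pred I) (f g : I -> R) :
  \sum_(i | P i) (f i - g i) = \sum_(i | P i) f i - \sum_(i | P i) g i.
Proof. by rewrite /Rminus -sum_opp -sum_add. Qed.

Lemma sum0 (I : finType) (P : pred I) (f : I -> R) :
  (forall i, P i -> f i = 0) -> \sum_(i | P i) f i = 0.
Proof. exact: big1. Qed.

Lemma sum_abs (I : finType) (P : pred I) (f : I -> R) :
  Rabs (\sum_(i | P i) f i) <= \sum_(i | P i) Rabs (f i).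
Proof.
apply: (big_ind2 (fun x y => Rabs x <= y)) => [|x1 x2 y1 y2 h1 h2|i _].
- by rewrite Rabs_R0; lra.
- by have := Rabs_triang x1 y1; lra.
- by lra.
Qed.

Lemma sum_const (I : finType) (P : pred I) (c : R) :
  \sum_(i | P i) c = INR #|P| * c.
Proof.
rewrite big_const; elim: #|_| => [|n ih]; first by rewrite /=; lra.
by rewrite iterS ih S_INR; lra.
Qed.

Lemma sum_constT (I : finType) (c : R) : \sum_(i : I) c = INR #|I| * c.
Proof. by rewrite sum_const; congr (INR _ * _); apply: eq_card. Qed.

Lemma sum_delta (I : finType) (j : I) (f : I -> R) :
  \sum_i (ind (i == j) * f i) = f j.
Proof.
rewrite (bigD1 j) //= eqxx big1 ?/ind; first by lra.
by move=> i /negbTE ->; lra.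
Qed.

Lemma sum_delta' (I : finType) (j : I) (f : I -> R) :
  \sum_i (ind (j == i) * f i) = f j.
Proof. by rewrite -[RHS]sum_delta; apply: eq_bigr => i _; rewrite eq_sym. Qed.

Lemma sum_term_le (I : finType) (j : I) (f : I -> R) :
  (forall i, 0 <= f i) -> f j <= \sum_i f i.
Proof.
move=> h; rewrite (bigD1 j) //=.
have := @sum_ge0 I (fun i => i != j) f (fun i _ => h i); lra.
Qed.

Lemma sum_eq0 (I : finType) (f : I -> R) :
  (forall i, 0 <= f i) -> \sum_i f i = 0 -> forall i, f i = 0.
Proof. by move=> h s i; have := @sum_term_le I i f h; have := h i; lra. Qed.

(** The principle by which a good hash function and a good key are later extracted from a random
    choice. *)
Lemma exists_le_avg (I : finType) (m f : I -> R) (B : R) :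
  is_pmf m -> \sum_i (m i * f i) <= B -> exists i, f i <= B.
Proof.
move=> [m0 m1] h; apply: NNPP => hn.
have hlt i : B < f i by apply: Rnot_le_lt => hi; apply: hn; exists i.
have h2 : \sum_i (m i * (f i - B)) <= 0.
  have -> : \sum_i (m i * (f i - B)) = \sum_i (m i * f i) - B * rsum m.
    rewrite /rsum -sum_mull -sum_sub; apply: eq_bigr => i _; lra.
  rewrite m1; lra.
have h3 : forall i, m i * (f i - B) = 0.
  apply: sum_eq0 => [i|]; first by apply: Rmult_le_pos => //; have := hlt i; lra.
  apply: Rle_antisym => //; apply: sum_ge0 => i _.
  by apply: Rmult_le_pos => //; have := hlt i; lra.
have : rsum m = 0; last by rewrite m1; lra.
apply: sum0 => i _; have := h3 i; have := hlt i => h4 h5.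
by case: (Rmult_integral _ _ h5) => //; lra.
Qed.

Lemma exists_min (I : finType) (i0 : I) (P : pred I) (f : I -> R) :
  P i0 -> exists2 i, P i & forall j, P j -> f i <= f j.
Proof.
move=> Pi0.
suff: forall s : seq I, exists2 i, P i & forall j, j \in s -> P j -> f i <= f j.
  by case/(_ (enum I)) => i Pi h; exists i => // j; apply: h; rewrite mem_enum.
elim=> [|k s [i Pi ih]]; first by exists i0.
case Pk: (P k); last first.
  by exists i => // j; rewrite inE => /orP [/eqP -> | /ih //]; rewrite Pk.
case: (Rle_lt_dec (f i) (f k)) => h.
  by exists i => // j; rewrite inE => /orP [/eqP -> // | /ih].
exists k => // j; rewrite inE => /orP [/eqP -> // _| js Pj]; first by lra.
by have := ih j js Pj; lra.
Qed.

Lemma pmf_inhab (T : finType) (P : T -> R) : is_pmf P -> exists t, 0 < P t.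
Proof.
move=> [P0 P1]; apply: NNPP => hn.
have : rsum P = 0; last by rewrite P1; lra.
apply: sum0 => t _; apply: Rle_antisym => //.
by apply: Rnot_lt_le => h; apply: hn; exists t.
Qed.

Lemma margE (T : finType) (Z : eqType) (P : T -> R) (g : T -> Z) z :
  marg P g z = \sum_t (ind (g t == z) * P t).
Proof. by apply: eq_bigr => t _; rewrite if_ind. Qed.

Lemma marg_ge0 (T : finType) (Z : eqType) (P : T -> R) (g : T -> Z) z :
  (forall t, 0 <= P t) -> 0 <= marg P g z.
Proof.
move=> h; rewrite margE; apply: sum_ge0 => t _.
by apply: Rmult_le_pos => //; exact: ind_ge0.
Qed.

Lemma le_marg (T : finType) (Z : eqType) (P : T -> R) (g : T -> Z) t :
  (forall t, 0 <= P t) -> P t <= marg P g (g t).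
Proof.
move=> h; rewrite margE.
have := @sum_term_le T t (fun s => ind (g s == g t) * P s).
rewrite eqxx {2}/ind Rmult_1_l; apply => s.
by apply: Rmult_le_pos => //; exact: ind_ge0.
Qed.

Lemma marg_gt0P (T : finType) (Z : eqType) (P : T -> R) (g : T -> Z) z :
  0 < marg P g z -> (forall t, 0 <= P t) -> exists2 t, g t = z & 0 < P t.
Proof.
move=> h P0; apply: NNPP => hn.
have : marg P g z = 0; last by lra.
rewrite margE; apply: sum0 => t _; rewrite /ind; case: eqP => [e|]; last by lra.
rewrite Rmult_1_l; apply: Rle_antisym => //.
by apply: Rnot_lt_le => h'; apply: hn; exists t.
Qed.

(** The two events have to agree only where [P] does not vanish; the disjunction says [P t <> 0], so
    that no sign of [P] is assumed. *)
Lemma eq_marg (T : finType) (Z Z' : eqType) (P : T -> R) (g : T -> Z) (g' : T -> Z') z z' :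
  (forall t, 0 < P t \/ P t < 0 -> (g t == z) = (g' t == z')) -> marg P g z = marg P g' z'.
Proof.
move=> h; rewrite !margE; apply: eq_bigr => t _.
case: (Rtotal_order (P t) 0) => [lt|[->|gt]]; last 1 first.
- by rewrite h //; left.
- by rewrite h //; right.
- by lra.
Qed.

Lemma exp_marg (T Z : finType) (P : T -> R) (g : T -> Z) (h : Z -> R) :
  \sum_z (marg P g z * h z) = \sum_t (P t * h (g t)).
Proof.
transitivity (\sum_z \sum_t (ind (g t == z) * (P t * h z))).
  apply: eq_bigr => z _; rewrite margE -sum_mulr.
  by apply: eq_bigr => t _; lra.
rewrite exchange_big /=; apply: eq_bigr => t _.
exact: (sum_delta' (g t) (fun z => P t * h z)).
Qed.

Lemma sum_marg (T Z : finType) (P : T -> R) (g : T -> Z) : \sum_z marg P g z = \sum_t P t.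
Proof. by have := exp_marg P g (fun => 1); rewrite !sum_mulr !Rmult_1_r. Qed.

Lemma marg_pmf (T Z : finType) (P : T -> R) (g : T -> Z) : is_pmf P -> is_pmf (marg P g).
Proof.
move=> [P0 P1]; split=> [z|]; first exact: marg_ge0.
by rewrite -P1; exact: sum_marg.
Qed.

Lemma marg_marg (T Z : finType) (Z' : eqType) (P : T -> R) (g : T -> Z) (h : Z -> Z') w :
  marg (marg P g) h w = marg P (fun t => h (g t)) w.
Proof.
rewrite !margE -[RHS](_ : \sum_t (P t * ind (h (g t) == w)) = _).
  by rewrite -(exp_marg P g (fun z => ind (h z == w))); apply: eq_bigr => z _; lra.
by apply: eq_bigr => t _; lra.
Qed.

Lemma marg_fst_sum (T A : finType) (B : eqType) (P : T -> R) (a : T -> A) (b : T -> B) z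
  (chi : A -> R) :
  \sum_x (chi x * marg P (fun t => (a t, b t)) (x, z)) =
  \sum_t (ind (b t == z) * (chi (a t) * P t)).
Proof.
transitivity (\sum_x \sum_t (ind (a t == x) * (chi x * ind (b t == z) * P t))).
  apply: eq_bigr => x _; rewrite margE -sum_mull; apply: eq_bigr => t _.
  by rewrite xpair_eqE ind_and; lra.
rewrite exchange_big; apply: eq_bigr => t _.
by rewrite (sum_delta' (a t) (fun x => chi x * ind (b t == z) * P t)); lra.
Qed.

Lemma marg_sum_fst (T A : finType) (B : eqType) (P : T -> R) (a : T -> A) (b : T -> B) z :
  \sum_x marg P (fun t => (a t, b t)) (x, z) = marg P b z.
Proof.
rewrite margE; have := marg_fst_sum P a b z (fun => 1).
rewrite (eq_bigr (fun x => marg P (fun t => (a t, b t)) (x, z))); last by move=> x _ /=; lra.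
by move=> ->; apply: eq_bigr => t _; lra.
Qed.

Lemma marg_sum_snd (T B : finType) (A : eqType) (P : T -> R) (a : T -> A) (b : T -> B) z :
  \sum_x marg P (fun t => (a t, b t)) (z, x) = marg P a z.
Proof.
rewrite -(marg_sum_fst P b a); apply: eq_bigr => x _; apply: eq_marg => t _.
by rewrite !xpair_eqE andbC.
Qed.

(** * Logarithms, entropy and conditional mutual information *)

Lemma log2_mult x y : 0 < x -> 0 < y -> log2 (x * y) = log2 x + log2 y.
Proof. by move=> hx hy; rewrite /log2 ln_mult //; lra. Qed.

Lemma log2_inv x : 0 < x -> log2 (/ x) = - log2 x.
Proof. by move=> hx; rewrite /log2 ln_Rinv //; lra. Qed.

Lemma log2_div x y : 0 < x -> 0 < y -> log2 (x / y) = log2 x - log2 y.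
Proof.
by move=> hx hy; rewrite /Rdiv log2_mult ?log2_inv //; apply: Rinv_0_lt_compat.
Qed.

Lemma ln2_gt0 : 0 < ln 2. Proof. by have := ln_lt_2; lra. Qed.

Lemma ln_le_sub1 x : 0 < x -> ln x <= x - 1.
Proof. by move=> hx; have := exp_ineq1_le (ln x); rewrite exp_ln //; lra. Qed.

Lemma log2_le x y : 0 < x -> x <= y -> log2 x <= log2 y.
Proof.
move=> hx [hlt|->]; last by lra.
rewrite /log2; apply: Rmult_le_compat_r; last by left; apply: ln_increasing.
by left; apply: Rinv_0_lt_compat; exact: ln2_gt0.
Qed.

(** Follows from [ln x <= x - 1]. Here [r] is a likelihood ratio, and asking only that its mean be
    at most 1 allows a reference measure that charges points outside the support of [P]. *)
Lemma gibbs (T : finType) (P r : T -> R) :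
  is_pmf P -> (forall t, 0 < P t -> 0 < r t) -> \sum_t (P t * r t) <= 1 ->
  \sum_t (P t * log2 (r t)) <= 0.
Proof.
move=> [P0 P1] r0 h.
apply: (@Rle_trans _ (\sum_t (/ ln 2 * (P t * r t - P t)))).
  apply: sum_le => t _; case: (Rle_lt_or_eq_dec _ _ (P0 t)) => [Pt|<-]; last by lra.
  rewrite /log2 /Rdiv.
  have := ln_le_sub1 (r0 t Pt).
  have := Rinv_0_lt_compat _ ln2_gt0 => h1 h2.
  have : 0 <= P t * / ln 2 * (r t - 1 - ln (r t)); last by lra.
  by apply: Rmult_le_pos; [apply: Rmult_le_pos => //; lra|lra].
rewrite sum_mull sum_sub; move: P1; rewrite /rsum => ->.
have := Rinv_0_lt_compat _ ln2_gt0 => h1.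
have : 0 <= / ln 2 * (1 - \sum_t (P t * r t)); last by lra.
by apply: Rmult_le_pos; lra.
Qed.

(** Entropy depends only on the partition of the support induced by the variable. This replaces
    every permutation of tuples and every removal of a determined component. *)
Lemma entropy_ker (T : finType) (Z Z' : eqType) (P : T -> R) (g : T -> Z) (g' : T -> Z') :
  (forall t, 0 <= P t) ->
  (forall t s, 0 < P t -> 0 < P s -> g t = g s <-> g' t = g' s) -> entropy P g = entropy P g'.
Proof.
move=> P0 h; rewrite /entropy; congr (- _); apply: eq_bigr => t _.
case: (Rle_lt_or_eq_dec _ _ (P0 t)) => [Pt|<-]; last by lra.
congr (_ * log2 _); apply: eq_marg => s [Ps|]; last by have := P0 s; lra.
by apply/eqP/eqP => /(h s t Ps Pt).
Qed.

Lemma entropy_marg (T Z : finType) (Z' : eqType) (P : T -> R) (g : T -> Z) (h : Z -> Z') :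
  entropy (marg P g) h = entropy P (fun t => h (g t)).
Proof.
rewrite /entropy; congr (- _).
rewrite /rsum (exp_marg P g (fun z => log2 (marg (marg P g) h (h z)))).
by apply: eq_bigr => t _; rewrite marg_marg.
Qed.

Lemma condMIE (T : finType) (A B C : eqType) (P : T -> R) (a : T -> A) (b : T -> B) (c : T -> C) :
  (forall t, 0 <= P t) ->
  condMI P a b c = entropy P (fun t => (a t, c t)) + entropy P (fun t => (b t, c t))
    - entropy P (fun t => (a t, b t, c t)) - entropy P c.
Proof.
move=> P0; rewrite /condMI /entropy /rsum /Rminus !Ropp_involutive.
rewrite -!sum_opp -!sum_add; apply: eq_bigr => t _.
case: (Rle_lt_or_eq_dec _ _ (P0 t)) => [Pt|<-]; last by lra.
have pos (Z : eqType) (g : T -> Z) : 0 < marg P g (g t) by have := @le_marg T Z P g t P0; lra.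
have h1 := pos _ (fun s => (a s, b s, c s)); have h2 := pos _ c.
have h3 := pos _ (fun s => (a s, c s)); have h4 := pos _ (fun s => (b s, c s)).
rewrite log2_div; [|exact: Rmult_lt_0_compat..].
by rewrite !log2_mult //; lra.
Qed.

Lemma entropy_markov (T : finType) (A B C : eqType) (P : T -> R)
    (a : T -> A) (b : T -> B) (c : T -> C) :
  (forall t, 0 <= P t) -> markov P a b c ->
  entropy P (fun t => (a t, b t, c t)) =
  entropy P (fun t => (a t, b t)) + entropy P (fun t => (b t, c t)) - entropy P b.
Proof.
move=> P0 m; rewrite /entropy /rsum /Rminus !Ropp_involutive.
rewrite -!sum_opp -!sum_add; apply: eq_bigr => t _.
case: (Rle_lt_or_eq_dec _ _ (P0 t)) => [Pt|<-]; last by lra.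
have pos (Z : eqType) (g : T -> Z) : 0 < marg P g (g t) by have := @le_marg T Z P g t P0; lra.
have h1 := pos _ (fun s => (a s, b s, c s)); have h2 := pos _ b.
have h3 := pos _ (fun s => (a s, b s)); have h4 := pos _ (fun s => (b s, c s)).
have := congr1 log2 (m (a t) (b t) (c t)).
rewrite !log2_mult // => e.
have -> : log2 (marg P (fun s => (a s, b s, c s)) (a t, b t, c t)) =
  log2 (marg P (fun s => (a s, b s)) (a t, b t)) + log2 (marg P (fun s => (b s, c s)) (b t, c t))
  - log2 (marg P b (b t)) by lra.
by ring.
Qed.

Lemma condMI_ge0 (T A B C : finType) (P : T -> R) (a : T -> A) (b : T -> B) (c : T -> C) :
  is_pmf P -> 0 <= condMI P a b c.
Proof.
move=> HP; have [P0 P1] := HP.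
pose abc t := (a t, b t, c t).
pose r (z : A * B * C) := (marg P (fun s => (a s, c s)) (z.1.1, z.2) *
   marg P (fun s => (b s, c s)) (z.1.2, z.2)) / (marg P abc z * marg P c z.2).
have pos t (Z : eqType) (g : T -> Z) : 0 < P t -> 0 < marg P g (g t).
  by have := @le_marg T Z P g t P0; lra.
suff : \sum_t (P t * log2 (r (abc t))) <= 0.
  suff -> : \sum_t (P t * log2 (r (abc t))) = - condMI P a b c by lra.
  rewrite /condMI /rsum -sum_opp; apply: eq_bigr => t _.
  case: (Rle_lt_or_eq_dec _ _ (P0 t)) => [Pt|<-]; last by lra.
  have h1 := pos t _ abc Pt; have h2 := pos t _ c Pt.
  have h3 := pos t _ (fun s => (a s, c s)) Pt; have h4 := pos t _ (fun s => (b s, c s)) Pt.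
  rewrite /r /= /abc in h1 *.
  rewrite !log2_div; [|exact: Rmult_lt_0_compat..].
  by lra.
apply: gibbs => // [t Pt|].
  apply: Rdiv_lt_0_compat; apply: Rmult_lt_0_compat.
  - exact: (pos t _ (fun s => (a s, c s)) Pt).
  - exact: (pos t _ (fun s => (b s, c s)) Pt).
  - exact: (pos t _ abc Pt).
  - exact: (pos t _ c Pt).
pose mabc := marg P abc.
rewrite -(exp_marg P abc r : \sum_z (mabc z * r z) = _).
pose q (z : A * B * C) := marg P (fun s => (a s, c s)) (z.1.1, z.2) *
   marg P (fun s => (b s, c s)) (z.1.2, z.2) / marg P c z.2.
have nn (Z : eqType) (g : T -> Z) z : 0 <= marg P g z by exact: marg_ge0.
(* [q] is the law under which [a] and [b] are conditionally independent given [c]. On the support of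
   [abc] the product of mass and ratio equals [q]; elsewhere it is 0, so the full sum of [q] only
   increases. *)
apply: (@Rle_trans _ (\sum_z q z)).
  apply: sum_le => z _.
  have q0 : 0 <= q z.
    rewrite /q; case: (Rle_lt_or_eq_dec _ _ (nn _ c z.2)) => [h|<-].
      by apply: Rmult_le_pos; [exact: Rmult_le_pos|left; exact: Rinv_0_lt_compat].
    by rewrite /Rdiv Rinv_0; lra.
  case: (Rle_lt_or_eq_dec _ _ (nn _ abc z : 0 <= mabc z)) => [h|e]; last by rewrite -{1}e; lra.
  have e : mabc z * / mabc z = 1 by apply: Rinv_r; lra.
  right; transitivity (mabc z * / mabc z * q z); last by rewrite e Rmult_1_l.
  by rewrite /r /q /Rdiv Rinv_mult /= -/(mabc z); ring.
rewrite -(pair_bigA _ (fun ab c => q (ab, c))) /= exchange_big /=.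
apply: (@Rle_trans _ (\sum_z marg P c z)); last by have [_] := marg_pmf c HP; rewrite /rsum => ->; lra.
apply: sum_le => z _.
rewrite -(pair_bigA _ (fun x y => q (x, y, z))) /= /q /=.
have -> : \sum_i \sum_j (marg P (fun s => (a s, c s)) (i, z) * marg P (fun s => (b s, c s)) (j, z)
    / marg P c z) = marg P c z * marg P c z / marg P c z.
  rewrite /Rdiv; set k := / _.
  rewrite -{1}(marg_sum_fst P a c z) -(marg_sum_fst P b c z) -!sum_mulr.
  by apply: eq_bigr => x _; rewrite -sum_mull -sum_mulr.
case: (Rle_lt_or_eq_dec _ _ (nn _ c z)) => [h|<-]; last by lra.
by right; field; lra.
Qed.

(** Gibbs' inequality against the law in which [a] is uniform and independent of [b]. *)
Lemma cond_entropy_le_card (T A B : finType) (P : T -> R) (a : T -> A) (b : T -> B) :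
  is_pmf P -> entropy P (fun t => (a t, b t)) - entropy P b <= log2 (INR #|A|).
Proof.
move=> HP; have [P0 P1] := HP.
have [t0 _] := pmf_inhab HP.
have A0 : 0 < INR #|A| by apply: lt_0_INR; apply/ltP; apply/card_gt0P; exists (a t0).
pose ab t := (a t, b t).
have pos t (Z : eqType) (g : T -> Z) : 0 < P t -> 0 < marg P g (g t).
  by have := @le_marg T Z P g t P0; lra.
pose r (z : A * B) := marg P b z.2 / (marg P ab z * INR #|A|).
suff : \sum_t (P t * log2 (r (ab t))) <= 0.
  suff -> : \sum_t (P t * log2 (r (ab t))) =
    entropy P ab - entropy P b - log2 (INR #|A|) by rewrite /ab; lra.
  rewrite /entropy -[X in _ = _ - X]Rmult_1_l -P1 /rsum /Rminus Ropp_involutive.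
  rewrite -sum_mulr -!sum_opp -!sum_add.
  apply: eq_bigr => t _.
  case: (Rle_lt_or_eq_dec _ _ (P0 t)) => [Pt|<-]; last by lra.
  have h1 := pos t _ ab Pt; have h2 := pos t _ b Pt.
  rewrite /r /= log2_div //; last exact: Rmult_lt_0_compat.
  by rewrite log2_mult //; lra.
apply: gibbs => // [t Pt|].
  apply: Rdiv_lt_0_compat; first exact: (pos t _ b Pt).
  by apply: Rmult_lt_0_compat => //; exact: (pos t _ ab Pt).
pose mab := marg P ab.
rewrite -(exp_marg P ab r : \sum_z (mab z * r z) = _).
apply: (@Rle_trans _ (\sum_(z : A * B) (marg P b z.2 / INR #|A|))).
  apply: sum_le => z _.
  have h0 := @marg_ge0 T _ P b z.2 P0.
  case: (Rle_lt_or_eq_dec _ _ (@marg_ge0 T _ P ab z P0 : 0 <= mab z)) => [h|e].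
    by right; rewrite /r -/(mab z); field; lra.
  rewrite -{1}e Rmult_0_l; apply: Rmult_le_pos => //.
  by left; apply: Rinv_0_lt_compat.
rewrite -(pair_bigA _ (fun (x : A) y => marg P b y / INR #|A|)) /= sum_constT.
have [_] := marg_pmf b HP; rewrite /rsum sum_mulr => ->.
by rewrite Rmult_1_l Rinv_r; lra.
Qed.

(** * Conditional independence *)

Lemma markov_sym (T : finType) (A B C : eqType) (P : T -> R)
    (a : T -> A) (b : T -> B) (c : T -> C) : markov P a b c -> markov P c b a.
Proof.
move=> h x y z; have := h z y x.
have -> : marg P (fun s => (a s, b s, c s)) (z, y, x) = marg P (fun s => (c s, b s, a s)) (x, y, z).
  by apply: eq_marg => t _; rewrite !xpair_eqE; case: (a t == z); case: (b t == y); case: (c t == x).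
have -> : marg P (fun s => (a s, b s)) (z, y) = marg P (fun s => (b s, a s)) (y, z).
  by apply: eq_marg => t _; rewrite !xpair_eqE andbC.
have -> : marg P (fun s => (b s, c s)) (y, x) = marg P (fun s => (c s, b s)) (x, y).
  by apply: eq_marg => t _; rewrite !xpair_eqE andbC.
by lra.
Qed.

(* A map exchanging parts of two independent copies and preserving their
   joint mass exhibits conditional independence. *)
Lemma markov_swap (T : finType) (A B C : eqType) (P : T -> R)
    (a : T -> A) (b : T -> B) (c : T -> C) (s : T -> T -> T) :
  (forall t u, b t = b u ->
     [/\ P t * P u = P (s t u) * P (s u t), b (s t u) = b t, a (s t u) = a t,
         c (s t u) = c u & s (s t u) (s u t) = t]) ->
  markov P a b c.
Proof.
move=> h x y z; rewrite !margE.
pose F1 (w : T * T) := ind ((a w.1, b w.1, c w.1) == (x, y, z)) * P w.1 * (ind (b w.2 == y) * P w.2).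
pose F2 (w : T * T) := ind ((a w.1, b w.1) == (x, y)) * P w.1 * (ind ((b w.2, c w.2) == (y, z)) * P w.2).
suff e : \sum_w F1 w = \sum_w F2 w.
  transitivity (\sum_w F1 w).
    rewrite -(pair_bigA _ (fun i j => F1 (i, j))) /= -sum_mulr.
    by apply: eq_bigr => i _; rewrite -sum_mull.
  rewrite e -(pair_bigA _ (fun i j => F2 (i, j))) /= -sum_mulr.
  by apply: eq_bigr => i _; rewrite -sum_mull.
rewrite (bigID (fun w => b w.1 == b w.2)) [RHS](bigID (fun w => b w.1 == b w.2)) /=.
(* Pairs with different [b] contribute 0 to both sides, since each side forces both values of [b] to
   be [y]. *)
congr (_ + _); last first.
  rewrite !sum0 // => -[t u] /=; rewrite /F1 /F2 /= !xpair_eqE !ind_and /ind => hn;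
  case: (b t =P y) hn => [->|_]; case: (b u =P y) => [->|_]; rewrite ?eqxx //; intros; lra.
(* On pairs with equal [b] this is an involution, and it carries the summand of one side to that of
   the other. *)
pose S (w : T * T) := (s w.1 w.2, s w.2 w.1).
rewrite (reindex_onto S S) /=; last first.
  move=> [t u] /= /eqP e; rewrite /S /=.
  have [_ _ _ _ ->] := h t u e; have [_ _ _ _ ->] := h u t (esym e); done.
apply: eq_big => [[t u]|[t u]] /=.
  apply/idP/idP => [/andP [/eqP e1 /eqP e2]|/eqP e].
    move: e2; rewrite /S /= => -[e2 e3].
    have [_ e4 _ _ _] := h _ _ e1; have [_ e5 _ _ _] := h _ _ (esym e1).
    by move: e4 e5; rewrite e2 e3 => -> ->; rewrite e1.
  have [_ e1 _ _ e2] := h t u e; have [_ e3 _ _ e4] := h u t (esym e).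
  by rewrite e1 e3 e eqxx /S /= e2 e4 eqxx.
rewrite /S /= => /andP [/eqP e1 /eqP [e2 e3]].
have [q1 q2 _ _ _] := h _ _ e1; have [_ q3 _ _ _] := h _ _ (esym e1).
have e : b t = b u by move: q2 q3; rewrite e2 e3 => -> ->; rewrite e1.
have [p1 p2 p3 p4 p5] := h t u e; have [p1' p2' p3' p4' p5'] := h u t (esym e).
rewrite /F1 /F2 /= p2 p3 p4 p2' -e !xpair_eqE !ind_and.
transitivity (ind (a t == x) * ind (b t == y) * ind (b t == y) * ind (c u == z) * (P (s t u) * P (s u t))); first by ring.
by rewrite -p1; ring.
Qed.

(* [al y] minimises the conditional loss given [b = y]; the minimum is at most the
   average under [chi * P], up to the mismatch of the [b]-marginals. *)
Lemma derandomize (T A B C : finType) (P : T -> R) (a : T -> A) (b : T -> B) (c : T -> C)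
    (e : A -> B -> C -> bool) (chi : A -> R) (kappa : R) :
  is_pmf P -> markov P a b c -> (forall x, 0 <= chi x) -> 0 <= kappa ->
  exists al : B -> A,
    kappa * \sum_t (P t * ind (e (al (b t)) (b t) (c t))) <=
    \sum_t (chi (a t) * P t * ind (e (a t) (b t) (c t))) +
    \sum_y Rabs (kappa * marg P b y - \sum_x (chi x * marg P (fun t => (a t, b t)) (x, y))).
Proof.
move=> HP m chi0 k0; have [P0 P1] := HP; have [t0 _] := pmf_inhab HP.
pose mbc y z := marg P (fun t => (b t, c t)) (y, z).
pose mab x y := marg P (fun t => (a t, b t)) (x, y).
pose L x y := \sum_z (mbc y z * ind (e x y z)).
have mbc0 y z : 0 <= mbc y z by exact: marg_ge0.
have mab0 y z : 0 <= mab y z by exact: marg_ge0.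
have /functional_choice [al hal] : forall y, exists x, forall x', L x y <= L x' y.
  by move=> y; have [x _ hx] := @exists_min A (a t0) predT (fun x => L x y) isT; exists x => x'; exact: hx.
exists al.
have -> : \sum_t (P t * ind (e (al (b t)) (b t) (c t))) = \sum_y L (al y) y.
  rewrite -(exp_marg P (fun t => (b t, c t)) (fun w => ind (e (al w.1) w.1 w.2))).
  by rewrite -(pair_bigA _ (fun y z => marg P (fun t => (b t, c t)) (y, z) * ind (e (al y) y z))).
have -> : \sum_t (chi (a t) * P t * ind (e (a t) (b t) (c t))) =
   \sum_y \sum_x (chi x * \sum_z (marg P (fun t => (a t, b t, c t)) (x, y, z) * ind (e x y z))).
  transitivity (\sum_t (P t * (chi (a t) * ind (e (a t) (b t) (c t))))).
    by apply: eq_bigr => t _; lra.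
  rewrite -(exp_marg P (fun t => (a t, b t, c t)) (fun w => chi w.1.1 * ind (e w.1.1 w.1.2 w.2))).
  rewrite -(pair_bigA _ (fun xy z => marg P (fun t => (a t, b t, c t)) (xy, z) * (chi xy.1 * ind (e xy.1 xy.2 z)))) /=.
  rewrite -(pair_bigA _ (fun x y => \sum_z (marg P (fun t => (a t, b t, c t)) (x, y, z) * (chi x * ind (e x y z))))) /=.
  rewrite exchange_big; apply: eq_bigr => y _; apply: eq_bigr => x _.
  by rewrite -sum_mull; apply: eq_bigr => z _; lra.
rewrite -sum_mull -sum_add; apply: sum_le => y _.
have my0 : 0 <= marg P b y by exact: marg_ge0.
have Lle x : L x y <= marg P b y.
  rewrite -(marg_sum_snd P b c); apply: sum_le => z _; rewrite -/(mbc y z).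
  by have := ind_le1 (e x y z); have := mbc0 y z; nra.
have L0 x : 0 <= L x y.
  by apply: sum_ge0 => z _; apply: Rmult_le_pos => //; exact: ind_ge0.
case: (Rle_lt_or_eq_dec _ _ my0) => [my|ey]; last first.
  have -> : L (al y) y = 0 by have := L0 (al y); have := Lle (al y); lra.
  rewrite Rmult_0_r; apply: Rplus_le_le_0_compat; last exact: Rabs_pos.
  apply: sum_ge0 => x _; apply: Rmult_le_pos => //; apply: sum_ge0 => z _.
  by apply: Rmult_le_pos; [exact: marg_ge0|exact: ind_ge0].
(* By the Markov chain the law of [c] given [b = y] does not change when [a = x] is also given, so
   the loss of an answer [x] is [L x y / marg P b y] whether or not [x] is the true value. *)
have -> : \sum_x (chi x * \sum_z (marg P (fun t => (a t, b t, c t)) (x, y, z) * ind (e x y z))) =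
  \sum_x (chi x * mab x y * (L x y / marg P b y)).
  apply: eq_bigr => x _; rewrite Rmult_assoc; congr (_ * _).
  rewrite /L /Rdiv -sum_mulr -sum_mull; apply: eq_bigr => z _.
  have -> : marg P (fun t => (a t, b t, c t)) (x, y, z) = mab x y * mbc y z / marg P b y.
    by apply: eq_div_of_mul; [lra|exact: m].
  by field; lra.
(* The conditional loss of the best answer lies in [[0,1]], hence a discrepancy of total masses
   costs at most its absolute value. *)
pose l := L (al y) y / marg P b y.
have l0 : 0 <= l by apply: Rmult_le_pos => //; left; exact: Rinv_0_lt_compat.
have l1 : l <= 1.
  apply: (Rmult_le_reg_r (marg P b y)) => //.
  by rewrite /l /Rdiv Rmult_assoc Rinv_l; [have := Lle (al y); lra|lra].
set s := \sum_x _.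
have hs : (\sum_x (chi x * mab x y)) * l <= s.
  rewrite -sum_mulr; apply: sum_le => x _; apply: Rmult_le_compat_l.
    exact: Rmult_le_pos.
  by apply: Rmult_le_compat_r; [left; exact: Rinv_0_lt_compat|exact: hal].
have eL : L (al y) y = marg P b y * l by rewrite /l; field; lra.
rewrite eL; pose S := \sum_x (chi x * mab x y).
suff key : kappa * (marg P b y * l) <= s + Rabs (kappa * marg P b y - S) by exact: key.
have ab := Rle_abs (kappa * marg P b y - S).
have ab0 := Rabs_pos (kappa * marg P b y - S).
rewrite -/S in hs; move: ab ab0; set D := Rabs _ => ab ab0.
have : (kappa * marg P b y - S) * l <= D * 1; last by lra.
by apply: (@Rle_trans _ (D * l)); [exact: Rmult_le_compat_r|exact: Rmult_le_compat_l].
Qed.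

(** * Independent copies *)

Definition leb (x y : R) : bool := if Rle_dec x y then true else false.

Lemma lebP x y : reflect (x <= y) (leb x y).
Proof. by rewrite /leb; case: Rle_dec => h; constructor. Qed.

(** The index type is arbitrary because this is both the law of a block ([I = 'I_n]) and the law of
    a random hash function ([I = A]), whose values at distinct points are independent. *)
Definition iid (I T : finType) (P : T -> R) (t : {ffun I -> T}) : R := \prod_i P (t i).

Definition fmap (I : finType) (A B : Type) (g : A -> B) (t : {ffun I -> A}) : {ffun I -> B} :=
  [ffun i => g (t i)].

Lemma prod_ge0 (I : finType) (P : pred I) (f : I -> R) :
  (forall i, 0 <= f i) -> 0 <= \prod_(i | P i) f i.
Proof. by move=> h; elim/big_ind: _ => //; [lra|exact: Rmult_le_pos]. Qed.

Lemma prod_gt0 (I : finType) (P : pred I) (f : I -> R) :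
  (forall i, 0 < f i) -> 0 < \prod_(i | P i) f i.
Proof. by move=> h; elim/big_ind: _ => //; [lra|exact: Rmult_lt_0_compat]. Qed.

Lemma prod_neq0 (I : finType) (f : I -> R) i : \prod_i f i <> 0 -> f i <> 0.
Proof. by rewrite (bigD1 i) //= => h e; apply: h; rewrite e; lra. Qed.

Lemma prod_delta (I : finType) (i : I) (h : I -> R) :
  \prod_k (if k == i then h k else 1) = h i.
Proof.
rewrite (bigD1 i) //= eqxx big1; first by lra.
by move=> k /negbTE ->.
Qed.

Lemma log2_prod (I : finType) (f : I -> R) :
  (forall i, 0 < f i) -> log2 (\prod_i f i) = \sum_i log2 (f i).
Proof.
move=> h.
suff [_ ->] : 0 < \prod_i f i /\ log2 (\prod_i f i) = \sum_i log2 (f i) by [].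
apply: (big_ind2 (fun x y => 0 < x /\ log2 x = y)) => //.
- by split; [lra|rewrite /log2 ln_1; lra].
- by move=> x1 x2 y1 y2 [h1 <-] [h2 <-]; split; [exact: Rmult_lt_0_compat|exact: log2_mult].
Qed.

Lemma ind_forall (I : finType) (b : pred I) : ind [forall i, b i] = \prod_i ind (b i).
Proof.
case: (boolP [forall i, b i]) => [/forallP h|].
  by rewrite big1 // => i _; rewrite h.
rewrite negb_forall => /existsP [i /negbTE hi].
by rewrite (bigD1 i) //= hi /ind; lra.
Qed.

Lemma sum_prod (I T : finType) (F : I -> T -> R) :
  \sum_(t : {ffun I -> T}) (\big[Rmult/1]_i F i (t i)) = \prod_i \sum_x F i x.
Proof. by rewrite bigA_distr_bigA. Qed.

Lemma iid_pmf (I T : finType) (P : T -> R) : is_pmf P -> is_pmf (@iid I T P).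
Proof.
move=> [P0 P1]; split=> [t|]; first exact: prod_ge0.
by rewrite /rsum /iid (sum_prod (fun i x => P x)) big1.
Qed.

Lemma iid_gt0 (I T : finType) (P : T -> R) (t : {ffun I -> T}) i :
  is_pmf P -> 0 < iid P t -> 0 < P (t i).
Proof.
move=> [P0 _] h; have hn : P (t i) <> 0.
  by apply: (@prod_neq0 I (fun i => P (t i)) i) => e; move: h; rewrite /iid e; lra.
by have := P0 (t i); lra.
Qed.

Lemma iid_exp1 (I T : finType) (P : T -> R) (i : I) (f : T -> R) :
  is_pmf P -> \sum_(t : {ffun I -> T}) (iid P t * f (t i)) = \sum_x (P x * f x).
Proof.
move=> [P0 P1].
rewrite (eq_bigr (fun t : {ffun I -> T} =>
    \big[Rmult/1]_k (P (t k) * (if k == i then f (t k) else 1)))); last first.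
  by move=> t _; rewrite big_split /= (prod_delta i (fun k => f (t k))).
rewrite (sum_prod (fun k x => P x * (if k == i then f x else 1))) (bigD1 i) //= eqxx.
rewrite [X in _ * X]big1; first by lra.
move=> k /negbTE ->; by apply: etrans P1; apply: eq_bigr => x _; lra.
Qed.

Lemma iid_exp2 (I T : finType) (P : T -> R) (i j : I) (f g : T -> R) :
  is_pmf P -> i != j ->
  \sum_(t : {ffun I -> T}) (iid P t * (f (t i) * g (t j))) =
  (\sum_x (P x * f x)) * (\sum_x (P x * g x)).
Proof.
move=> [P0 P1] ij.
rewrite (eq_bigr (fun t : {ffun I -> T} =>
    \big[Rmult/1]_k (P (t k) * ((if k == i then f (t k) else 1) * (if k == j then g (t k) else 1))))); last first.
  by move=> t _; rewrite !big_split /= (prod_delta i (fun k => f (t k))) (prod_delta j (fun k => g (t k))).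
rewrite (sum_prod (fun k x => P x * ((if k == i then f x else 1) * (if k == j then g x else 1)))).
rewrite (bigD1 i) //= eqxx (negbTE ij) (bigD1 j) /=; last by rewrite eq_sym.
rewrite eqxx (eq_sym j) (negbTE ij) [X in _ * (_ * X)]big1; last first.
  move=> k /andP [/negbTE -> /negbTE ->]; by apply: etrans P1; apply: eq_bigr => x _; lra.
have -> : \sum_x (P x * (f x * 1)) = \sum_x (P x * f x) by apply: eq_bigr => x _; lra.
have -> : \sum_x (P x * (1 * g x)) = \sum_x (P x * g x) by apply: eq_bigr => x _; lra.
by rewrite Rmult_1_r.
Qed.

(** The cross terms vanish because [z] is centred. The weights [v] are constant for the law of large
    numbers and are the masses of the hashed points for privacy amplification. *)
Lemma iid_variance (I T : finType) (P z : T -> R) (v : I -> R) :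
  is_pmf P -> \sum_x (P x * z x) = 0 ->
  \sum_(t : {ffun I -> T}) (iid P t * (\sum_i (v i * z (t i)))^2) =
  (\sum_i (v i)^2) * (\sum_x (P x * (z x)^2)).
Proof.
move=> HP hz.
transitivity (\sum_i \sum_j (v i * v j * \sum_(t : {ffun I -> T}) (iid P t * (z (t i) * z (t j))))).
  transitivity (\sum_(t : {ffun I -> T}) \sum_i \sum_j (v i * v j * (iid P t * (z (t i) * z (t j))))).
    apply: eq_bigr => t _.
    rewrite /= Rmult_1_r big_distrlr /= -sum_mull.
    by apply: eq_bigr => i _; rewrite -sum_mull; apply: eq_bigr => j _; ring.
  rewrite exchange_big /=; apply: eq_bigr => i _.
  by rewrite exchange_big /=; apply: eq_bigr => j _; rewrite -sum_mull.
rewrite -sum_mulr; apply: eq_bigr => i _.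
transitivity (\sum_j (ind (i == j) * (v i * v j * \sum_x (P x * (z x)^2)))).
  apply: eq_bigr => j _; case: (eqVneq i j) => [<-|ij].
    rewrite /ind Rmult_1_l; congr (_ * _).
    rewrite (iid_exp1 i (fun x => z x * z x) HP); apply: eq_bigr => x _; ring.
  by rewrite iid_exp2 // hz /ind; ring.
by rewrite sum_delta'; ring.
Qed.

Lemma exists_INR_ge r : exists N : nat, forall n : nat, (N <= n)%nat -> r <= INR n.
Proof.
have [N hN] := INR_unbounded r; exists N => n /leP /le_INR; lra.
Qed.

Lemma chebyshev (n : nat) (T : finType) (P z : T -> R) (d : R) :
  is_pmf P -> 0 < d -> (0 < n)%nat ->
  let mu := \sum_x (P x * z x) in
  \sum_(t : {ffun 'I_n -> T})
     (iid P t * ind (~~ leb (Rabs (\sum_i z (t i) - INR n * mu)) (INR n * d))) <=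
  (\sum_x (P x * (z x - mu)^2)) / (INR n * d^2).
Proof.
move=> HP d0 n0 mu.
have N0 : 0 < INR n by apply: lt_0_INR; apply/ltP.
have HPn := @iid_pmf 'I_n T P HP.
have [P0 P1] := HP; have [Pn0 _] := HPn.
have hz : \sum_x (P x * (z x - mu)) = 0.
  transitivity (\sum_x (P x * z x) - rsum P * mu); last by rewrite P1 -/mu; lra.
  by rewrite /rsum -sum_mulr -sum_sub; apply: eq_bigr => x _; lra.
have V := @iid_variance 'I_n T P (fun x => z x - mu) (fun => 1) HP hz.
have nd : 0 < INR n * d by exact: Rmult_lt_0_compat.
apply: (@Rle_trans _ (\sum_(t : {ffun 'I_n -> T})
     (iid P t * (\sum_i (1 * (z (t i) - mu)))^2 * / (INR n * d)^2))).
  apply: sum_le => t _; rewrite Rmult_assoc; apply: Rmult_le_compat_l => //.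
  have -> : \sum_i (1 * (z (t i) - mu)) = \sum_i z (t i) - INR n * mu.
    have -> : INR n * mu = \sum_(i < n) mu by rewrite sum_constT card_ord.
    by rewrite -sum_sub; apply: eq_bigr => i _; lra.
  set s := _ - _; case: lebP => [_|/Rnot_le_lt h].
    rewrite (_ : ind (~~ true) = 0) //; apply: Rmult_le_pos; first by nra.
    by left; apply: Rinv_0_lt_compat; nra.
  rewrite (_ : ind (~~ false) = 1) //; have {1}-> : 1 = (INR n * d)^2 * / (INR n * d)^2 by rewrite Rinv_r //; nra.
  apply: Rmult_le_compat_r; first by left; apply: Rinv_0_lt_compat; nra.
  rewrite -(pow2_abs s); nra.
rewrite sum_mulr V; right.
rewrite (eq_bigr (fun i : 'I_n => 1)) => [|i _]; last by ring.
by rewrite sum_constT card_ord; field; lra.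
Qed.

Lemma wlln (T : finType) (P z : T -> R) (d eps : R) :
  is_pmf P -> 0 < d -> 0 < eps -> exists N : nat, forall n : nat, (N <= n)%nat ->
  \sum_(t : {ffun 'I_n -> T})
     (iid P t * ind (~~ leb (Rabs (\sum_i z (t i) - INR n * \sum_x (P x * z x))) (INR n * d))) <= eps.
Proof.
move=> HP d0 e0.
set s := \sum_x (P x * (z x - \sum_x (P x * z x))^2).
have [N hN] := exists_INR_ge (s / (d^2 * eps)).
exists N.+1 => n hn; have n0 : (0 < n)%nat by apply: leq_trans hn.
apply: Rle_trans (chebyshev z HP d0 n0) _; rewrite -/s.
have N0 : 0 < INR n by apply: lt_0_INR; apply/ltP.
have d2 : 0 < d^2 by nra.
have := hN n (ltnW hn) => h.
apply: (Rmult_le_reg_r (INR n * d^2)); first by nra.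
rewrite /Rdiv Rmult_assoc Rinv_l; last by nra.
have -> : s * 1 = s / (d^2 * eps) * (d^2 * eps) by field; nra.
by have : 0 < d^2 * eps; nra.
Qed.

Lemma iid_marg (I T Z : finType) (P : T -> R) (g : T -> Z) (z : {ffun I -> Z}) :
  marg (iid P) (fmap g) z = iid (marg P g) z.
Proof.
rewrite margE /iid (eq_bigr (fun i => \sum_x (ind (g x == z i) * P x))); last by move=> i _; rewrite margE.
rewrite -(sum_prod (fun i x => ind (g x == z i) * P x)).
apply: eq_bigr => t _; rewrite big_split /= -ind_forall; congr (ind _ * _).
apply/eqP/forallP => [<- i|h]; first by rewrite ffunE.
by apply/ffunP => i; rewrite ffunE; apply/eqP.
Qed.

Definition fzip (I : finType) (A B : Type) (x : {ffun I -> A}) (y : {ffun I -> B}) : {ffun I -> A * B} :=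
  [ffun i => (x i, y i)].

Lemma fzip_eq (I T : finType) (A B : eqType) (a : T -> A) (b : T -> B) (t : {ffun I -> T}) x y :
  ((fmap a t, fmap b t) == (x, y)) = (fmap (fun s => (a s, b s)) t == fzip x y).
Proof.
rewrite xpair_eqE; apply/andP/eqP => [[/eqP <- /eqP <-]|/ffunP h].
  by apply/ffunP => i; rewrite !ffunE.
split; apply/eqP/ffunP => i; have := h i; rewrite !ffunE => e; by case: e.
Qed.

Lemma iid_marg2 (I T A B : finType) (P : T -> R) (a : T -> A) (b : T -> B) (x : {ffun I -> A}) y :
  marg (iid P) (fun t => (fmap a t, fmap b t)) (x, y) = iid (marg P (fun t => (a t, b t))) (fzip x y).
Proof. by rewrite -iid_marg; apply: eq_marg => t _; rewrite fzip_eq. Qed.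

Lemma iid_marg3 (I T A B C : finType) (P : T -> R) (a : T -> A) (b : T -> B) (c : T -> C)
    (x : {ffun I -> A}) y z :
  marg (iid P) (fun t => (fmap a t, fmap b t, fmap c t)) (x, y, z) =
  iid (marg P (fun t => (a t, b t, c t))) (fzip (fzip x y) z).
Proof.
rewrite -iid_marg; apply: eq_marg => t _.
rewrite xpair_eqE fzip_eq; have := fzip_eq (fun s => (a s, b s)) c t (fzip x y) z.
by rewrite xpair_eqE => ->.
Qed.

Lemma markov_iid (I T A B C : finType) (P : T -> R) (a : T -> A) (b : T -> B) (c : T -> C) :
  markov P a b c -> markov (@iid I T P) (fmap a) (fmap b) (fmap c).
Proof.
move=> m x y z.
have e1 := iid_marg3 P a b c x y z; have e2 := iid_marg P b y.
have e3 := iid_marg2 P a b x y; have e4 := iid_marg2 P b c y z.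
transitivity (iid (marg P (fun t => (a t, b t, c t))) (fzip (fzip x y) z) * iid (marg P b) y).
  by congr (_ * _).
transitivity (iid (marg P (fun t => (a t, b t))) (fzip x y) * iid (marg P (fun t => (b t, c t))) (fzip y z)).
  by rewrite /iid -!big_split; apply: eq_bigr => i _; rewrite !ffunE; exact: m.
by congr (_ * _).
Qed.

Lemma log2_iid_marg (I T Z : finType) (P : T -> R) (g : T -> Z) (t : {ffun I -> T}) :
  is_pmf P -> 0 < iid P t ->
  0 < iid (marg P g) (fmap g t) /\
  log2 (iid (marg P g) (fmap g t)) = \sum_i log2 (marg P g (g (t i))).
Proof.
move=> HP ht; have [P0 _] := HP.
have h i : 0 < marg P g (fmap g t i).
  by rewrite ffunE; have := @le_marg _ _ P g (t i) P0; have := iid_gt0 i HP ht; lra.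
split; first exact: prod_gt0.
by rewrite /iid log2_prod //; apply: eq_bigr => i _; rewrite ffunE.
Qed.

(** * Random binning *)

Definition unif (S : finType) (_ : S) : R := / INR #|S|.

Lemma unif_pmf (S : finType) (s : S) : is_pmf (@unif S).
Proof.
have S0 : 0 < INR #|S| by apply: lt_0_INR; apply/ltP; apply/card_gt0P; exists s.
split=> [t|]; first by left; exact: Rinv_0_lt_compat.
by rewrite /rsum /unif sum_constT Rinv_r //; lra.
Qed.

(* Privacy amplification: second-moment bound on the masses below the threshold. *)
Lemma hash_mass (A S : finType) (w chi : S -> R) (m : A -> R) (thr tau : R) :
  is_pmf w -> (forall s, chi s = 0 \/ chi s = 1) -> (forall x, 0 <= m x) -> 0 < thr -> 0 < tau ->
  let kappa := \sum_s (w s * chi s) in let tot := \sum_x m x in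
  0 < kappa ->
  \sum_(h : {ffun A -> S}) (iid w h * Rabs (kappa * tot - \sum_x (chi (h x) * m x))) <=
  2 * kappa * \sum_x (m x * ind (~~ leb (m x * thr) tot)) +
  tot * (kappa * tau + (1 - kappa) / (thr * tau)) / 2.
Proof.
move=> Hw chi01 m0 thr0 tau0 kappa tot k0; have [w0 w1] := Hw.
have [iw0 iw1] := @iid_pmf A S w Hw.
have tot0 : 0 <= tot by exact: sum_ge0.
have k1 : kappa <= 1.
  rewrite -w1; apply: sum_le => s _; have := w0 s; case: (chi01 s) => ->; lra.
have itt : 0 < / (thr * tau) by apply: Rinv_0_lt_compat; exact: Rmult_lt_0_compat.
have E0 : 0 <= kappa * tau + (1 - kappa) / (thr * tau).
  by apply: Rplus_le_le_0_compat; apply: Rmult_le_pos; lra.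
case: (Rle_lt_or_eq_dec _ _ tot0) => [tp|te]; last first.
  have mz x : m x = 0 by apply: (@sum_eq0 A m m0).
  rewrite [X in X <= _]sum0 => [|h _]; last first.
    rewrite -te sum0 => [|x _]; last by rewrite mz; lra.
    by rewrite Rmult_0_r Rminus_0_r Rabs_R0; lra.
  rewrite -te sum0 => [|x _]; last by rewrite mz; lra.
  by lra.
(* [v] keeps the light points, which obey a second-moment bound; [u] keeps the heavy ones, whose
   contribution is bounded trivially by twice their expected mass. *)
pose v x := m x * ind (leb (m x * thr) tot).
pose u x := m x * ind (~~ leb (m x * thr) tot).
have mvu x : m x = v x + u x by rewrite /v /u /ind; case: leb => /=; lra.
have v0 x : 0 <= v x by apply: Rmult_le_pos => //; exact: ind_ge0.
have u0 x : 0 <= u x by apply: Rmult_le_pos => //; exact: ind_ge0.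
pose z s := chi s - kappa.
have z_mean : \sum_s (w s * z s) = 0.
  transitivity (kappa - rsum w * kappa); last by rewrite w1; lra.
  by rewrite {1}/kappa /rsum -sum_mulr -sum_sub; apply: eq_bigr => s _; rewrite /z; lra.
have z_var : \sum_s (w s * (z s)^2) = kappa * (1 - kappa).
  transitivity (\sum_s ((1 - 2 * kappa) * (w s * chi s) + kappa^2 * w s)).
    by apply: eq_bigr => s _; rewrite /z; case: (chi01 s) => ->; ring.
  by rewrite sum_add !sum_mull -/kappa; move: w1; rewrite /rsum => ->; ring.
have z_abs : \sum_s (w s * Rabs (z s)) <= 2 * kappa.
  apply: (@Rle_trans _ (kappa + kappa * rsum w)); last by rewrite w1; lra.
  rewrite {1}/kappa /rsum -sum_mull -sum_add; apply: sum_le => s _; rewrite /z.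
  have : Rabs (chi s - kappa) <= chi s + kappa.
    by case: (chi01 s) => ->; apply: Rabs_le; lra.
  by have := w0 s; nra.
(* Scale of the inequality [|q| <= (c + q^2 / c) / 2], which replaces the square root of the
   variance. Being proportional to the expected mass [kappa * tot], it amounts to a relative error
   [tau] once all bins are added up. *)
pose c := tot * kappa * tau.
have c0 : 0 < c by do 2!apply: Rmult_lt_0_compat => //.
have split h : Rabs (kappa * tot - \sum_x (chi (h x) * m x)) <=
    (c + (\sum_x (v x * z (h x)))^2 * / c) / 2 + \sum_x (u x * Rabs (z (h x))).
  have -> : kappa * tot - \sum_x (chi (h x) * m x) =
     - (\sum_x (v x * z (h x)) + \sum_x (u x * z (h x))).
    rewrite -sum_add /tot -sum_mull -sum_sub -sum_opp.
    by apply: eq_bigr => x _; rewrite mvu /z; ring.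
  rewrite Rabs_Ropp; apply: Rle_trans (Rabs_triang _ _) _; apply: Rplus_le_compat.
    set q := \sum_x _.
    have e : q^2 = Rabs q ^2 by rewrite pow2_abs.
    rewrite e; have := Rabs_pos q; set r := Rabs q => r0.
    have : 0 <= (c - r)^2 * / c by apply: Rmult_le_pos; [exact: pow2_ge_0|left; exact: Rinv_0_lt_compat].
    have -> : (c - r)^2 * / c = c - 2 * r + r^2 * / c by field; lra.
    lra.
  apply: Rle_trans (sum_abs _ _) _; apply: sum_le => x _.
  by rewrite Rabs_mult (Rabs_right (u x)); [lra|apply: Rle_ge].
apply: (@Rle_trans _ (\sum_(h : {ffun A -> S}) (c / 2 * iid w h +
   / (2 * c) * (iid w h * (\sum_x (v x * z (h x)))^2) + \sum_x (u x * (iid w h * Rabs (z (h x))))))).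
  apply: sum_le => h _; apply: (@Rle_trans _ (iid w h * ((c + (\sum_x (v x * z (h x)))^2 * / c) / 2 +
    \sum_x (u x * Rabs (z (h x)))))); first exact: Rmult_le_compat_l.
  rewrite Rmult_plus_distr_l -sum_mull; right; congr (_ + _); first by field; lra.
  by apply: eq_bigr => x _; ring.
rewrite !sum_add !sum_mull; move: iw1; rewrite /rsum => ->.
rewrite iid_variance // z_var exchange_big.
have hv : \sum_x (v x)^2 <= tot^2 / thr.
  apply: (@Rle_trans _ (\sum_x (m x * (tot / thr)))); last first.
    by rewrite sum_mulr -/tot; right; field; lra.
  apply: sum_le => x _; rewrite /v; case: lebP => h; rewrite /ind; last first.
    rewrite Rmult_0_r; apply: (@Rle_trans _ 0); first by lra.
    apply: Rmult_le_pos => //; apply: Rmult_le_pos => //; by left; exact: Rinv_0_lt_compat.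
  have : m x <= tot / thr.
    apply: (Rmult_le_reg_r thr) => //; rewrite /Rdiv Rmult_assoc Rinv_l; lra.
  by have := m0 x; nra.
have hu : \sum_x \sum_(h : {ffun A -> S}) (u x * (iid w h * Rabs (z (h x)))) <= 2 * kappa * \sum_x (m x * ind (~~ leb (m x * thr) tot)).
  rewrite -sum_mull; apply: sum_le => x _.
  rewrite sum_mull (iid_exp1 x (fun s => Rabs (z s)) Hw).
  by rewrite -/(u x); have := u0 x; nra.
have hq : / (2 * c) * ((\sum_x (v x)^2) * (kappa * (1 - kappa))) <= tot * ((1 - kappa) / (thr * tau)) / 2.
  apply: (@Rle_trans _ (/ (2 * c) * ((tot^2 / thr) * (kappa * (1 - kappa))))).
    apply: Rmult_le_compat_l; first by left; apply: Rinv_0_lt_compat; lra.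
    by apply: Rmult_le_compat_r => //; apply: Rmult_le_pos; lra.
  by right; rewrite /c; field; repeat split; lra.
apply: Rle_trans (Rplus_le_compat _ _ _ _ (Rplus_le_compat _ _ _ _ (Rle_refl _) hq) hu) _.
by rewrite /c; lra.
Qed.

(** A hash value is a pair: the first component is a key that will be fixed in advance, the second
    is the message that will be sent. This is the L1 distance between the joint law of key and [b]
    and the product of the uniform law with the law of [b]. *)
Definition tv_bins (T A B : finType) (P : T -> R) (a : T -> A) (b : T -> B) (K M : nat)
    (h : {ffun A -> 'I_K * 'I_M}) : R :=
  \sum_(k < K) \sum_y Rabs (/ INR K * marg P b y -
     \sum_x (ind ((h x).1 == k) * marg P (fun t => (a t, b t)) (x, y))).

Lemma tv_bins_avg (T A B : finType) (P : T -> R) (a : T -> A) (b : T -> B) (K M : nat) (thr tau : R) :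
  is_pmf P -> (0 < K)%nat -> (0 < M)%nat -> 0 < thr -> 0 < tau ->
  \sum_(h : {ffun A -> 'I_K * 'I_M}) (iid (@unif _) h * tv_bins P a b h) <=
  2 * \sum_t (P t * ind (~~ leb (marg P (fun t => (a t, b t)) (a t, b t) * thr) (marg P b (b t)))) +
  (tau + (INR K - 1) / (thr * tau)) / 2.
Proof.
move=> HP K0 M0 thr0 tau0; have [P0 P1] := HP.
have rK : 0 < INR K by apply: lt_0_INR; apply/ltP.
have rM : 0 < INR M by apply: lt_0_INR; apply/ltP.
have Hw := @unif_pmf ('I_K * 'I_M)%type (Ordinal K0, Ordinal M0).
pose mab x y := marg P (fun t => (a t, b t)) (x, y).
pose bad x y := ind (~~ leb (mab x y * thr) (marg P b y)).
(* Only the key matters here: the message component is summed out, and each key has probability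
   [1/K]. *)
have kap (k : 'I_K) : \sum_(s : 'I_K * 'I_M) (unif s * ind (s.1 == k)) = / INR K.
  rewrite -(pair_bigA _ (fun i j => unif (i, j) * ind (i == k))) /=.
  rewrite (eq_bigr (fun i : 'I_K => ind (i == k) * (INR M * unif (k, Ordinal M0)))) => [|i _].
    rewrite sum_delta /unif card_prod !card_ord mult_INR; field; lra.
  by rewrite /unif sum_constT card_ord -Rmult_assoc Rmult_comm.
have step (k : 'I_K) y : \sum_(h : {ffun A -> 'I_K * 'I_M}) (iid (@unif _) h *
     Rabs (/ INR K * marg P b y - \sum_x (ind ((h x).1 == k) * mab x y))) <=
   2 * / INR K * \sum_x (mab x y * bad x y) +
   marg P b y * (/ INR K * tau + (1 - / INR K) / (thr * tau)) / 2.
  have tot : \sum_x mab x y = marg P b y by exact: marg_sum_fst.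
  have := @hash_mass A ('I_K * 'I_M)%type (@unif _) (fun s => ind (s.1 == k)) (fun x => mab x y) thr tau Hw.
  rewrite kap tot; apply => //.
  - by move=> s; rewrite /ind; case: eqP; [right|left].
  - by move=> x; exact: marg_ge0.
  - exact: Rinv_0_lt_compat.
apply: (@Rle_trans _ (\sum_(k < K) \sum_y (2 * / INR K * \sum_x (mab x y * bad x y) +
   marg P b y * ((/ INR K * tau + (1 - / INR K) / (thr * tau)) / 2)))).
  rewrite /tv_bins.
  rewrite (eq_bigr (fun h : {ffun A -> 'I_K * 'I_M} => \sum_(k < K) \sum_y (iid (@unif _) h *
     Rabs (/ INR K * marg P b y - \sum_x (ind ((h x).1 == k) * mab x y))))) => [|h _]; last first.
    by rewrite -sum_mull; apply: eq_bigr => k _; rewrite -sum_mull.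
  rewrite exchange_big /=; apply: sum_le => k _.
  rewrite exchange_big /=; apply: sum_le => y _.
  by apply: Rle_trans (step k y) _; lra.
rewrite sum_constT card_ord sum_add sum_mulr sum_mull exchange_big /=.
have [_ mb1] := marg_pmf b HP; move: mb1; rewrite /rsum => ->.
have <- : \sum_x \sum_y (mab x y * bad x y) =
    \sum_t (P t * ind (~~ leb (marg P (fun t => (a t, b t)) (a t, b t) * thr) (marg P b (b t)))).
  rewrite (pair_bigA _ (fun x y => mab x y * bad x y)) /=.
  exact: (exp_marg P (fun t => (a t, b t)) (fun w => bad w.1 w.2)).
by right; field; lra.
Qed.

(** Any likely element of the bin is returned, without a uniqueness test; [a0] is returned when
    there is none. *)
Definition sw_dec (A D S : finType) (a0 : A) (likely : A -> D -> bool) (h : {ffun A -> S}) (s : S) (y : D) : A :=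
  odflt a0 [pick x | (h x == s) && likely x y].

Lemma collision_prob (A S : finType) (s0 : S) (x x' : A) : x != x' ->
  \sum_(h : {ffun A -> S}) (iid (@unif _) h * ind (h x == h x')) = / INR #|S|.
Proof.
move=> xx'; have S0 : 0 < INR #|S| by apply: lt_0_INR; apply/ltP; apply/card_gt0P; exists s0.
have Hw := unif_pmf s0.
transitivity (\sum_(s : S) \sum_(h : {ffun A -> S}) (iid (@unif _) h * (ind (h x == s) * ind (h x' == s)))).
  rewrite exchange_big /=; apply: eq_bigr => h _; rewrite sum_mull; congr (_ * _).
  by rewrite (sum_delta' (h x) (fun s => ind (h x' == s))) eq_sym.
rewrite (eq_bigr (fun => unif s0 * unif s0)) => [|s _].
  by rewrite sum_constT /unif; field; lra.
rewrite (iid_exp2 (fun y => ind (y == s)) (fun y => ind (y == s)) Hw xx').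
have -> : \sum_x0 (unif x0 * ind (x0 == s)) = unif s0; last by [].
by rewrite -(sum_delta s (fun => unif s0)); apply: eq_bigr => y _; rewrite /unif; ring.
Qed.

(* Slepian-Wolf decoding: given [d], at most [thr] candidates are likely, and each
   collides with probability [1 / #|S|]. *)
Lemma sw_dec_avg (T A D S : finType) (P : T -> R) (a : T -> A) (d : T -> D) (a0 : A) (s0 : S) (thr : R) :
  is_pmf P -> 0 < thr ->
  let likely x y := leb (marg P d y) (marg P (fun t => (a t, d t)) (x, y) * thr) in
  \sum_(h : {ffun A -> S}) (iid (@unif _) h *
     \sum_t (P t * ind (sw_dec a0 likely h (h (a t)) (d t) != a t))) <=
  \sum_t (P t * ind (~~ likely (a t) (d t))) + thr / INR #|S|.
Proof.
move=> HP thr0 likely; have [P0 P1] := HP.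
have S0 : 0 < INR #|S| by apply: lt_0_INR; apply/ltP; apply/card_gt0P; exists s0.
have [iw0 iw1] := @iid_pmf A S _ (unif_pmf s0).
have -> : thr / INR #|S| = \sum_t (P t * (thr / INR #|S|)).
  by rewrite sum_mulr; move: P1; rewrite /rsum => ->; lra.
rewrite -sum_add (eq_bigr (fun h : {ffun A -> S} =>
  \sum_t (P t * (iid (@unif _) h * ind (sw_dec a0 likely h (h (a t)) (d t) != a t))))); last first.
  by move=> h _; rewrite -sum_mull; apply: eq_bigr => t _; lra.
rewrite exchange_big /=; apply: sum_le => t _; rewrite sum_mull -Rmult_plus_distr_l.
case: (Rle_lt_or_eq_dec _ _ (P0 t)) => [Pt|<-]; last by lra.
apply: Rmult_le_compat_l => //.
pose y := d t; pose x0 := a t.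
have my : 0 < marg P d y by have := @le_marg _ _ P d t P0; rewrite /y; lra.
(* Union bound: decoding fails only if the true value is not likely or some other likely value falls
   into its bin. *)
apply: (@Rle_trans _ (\sum_(h : {ffun A -> S}) (ind (~~ likely x0 y) * iid (@unif _) h +
   \sum_x (ind (x != x0) * ind (likely x y) * (iid (@unif _) h * ind (h x == h x0)))))).
  apply: sum_le => h _.
  have terms0 : 0 <= \sum_x (ind (x != x0) * ind (likely x y) * (iid (@unif _) h * ind (h x == h x0))).
    apply: sum_ge0 => x _; do !apply: Rmult_le_pos; try exact: ind_ge0; exact: iw0.
  case: (boolP (likely x0 y)) => lk; last first.
    by rewrite {2}/ind /=; have := ind_le1 (sw_dec a0 likely h (h (a t)) (d t) != a t); have := iw0 h; nra.
  rewrite -/x0 -/y /sw_dec; case: pickP => [x /andP [/eqP hx lx]|/(_ x0)]; last by rewrite eqxx lk.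
  rewrite /=; case: (eqVneq x x0) => [e|ne]; first by rewrite (_ : ind false = 0) //; lra.
  apply: Rle_trans (_ : _ <= \sum_x (ind (x != x0) * ind (likely x y) * (iid (@unif _) h * ind (h x == h x0)))) _; last by rewrite /ind; lra.
  have := @sum_term_le A x (fun x => ind (x != x0) * ind (likely x y) * (iid (@unif _) h * ind (h x == h x0))).
  rewrite /= ne lx hx eqxx {1 2 3 4}/ind => hs; apply: Rle_trans (hs _); first by rewrite /ind /=; lra.
  by move=> i; do !apply: Rmult_le_pos; try exact: ind_ge0; exact: iw0.
rewrite sum_add sum_mull exchange_big /=; move: iw1; rewrite /rsum => ->.
rewrite Rmult_1_r; apply: Rplus_le_compat_l.
(* Markov's inequality for the number of likely [x]: the indicator of [likely x y] is at most [thr]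
   times the conditional probability of [x], and these probabilities add up to 1. *)
apply: (@Rle_trans _ (\sum_x (marg P (fun t => (a t, d t)) (x, y) * (thr / marg P d y * / INR #|S|)))); last first.
  rewrite sum_mulr marg_sum_fst /Rdiv (Rmult_comm thr (/ marg P d y)) Rmult_assoc -Rmult_assoc Rinv_r; last by lra.
  by rewrite Rmult_1_l; right.
have inv0 : 0 < / INR #|S| by exact: Rinv_0_lt_compat.
apply: sum_le => x _; rewrite sum_mull.
have m0 : 0 <= marg P (fun t => (a t, d t)) (x, y) by exact: marg_ge0.
have r0 : 0 <= marg P (fun t => (a t, d t)) (x, y) * (thr / marg P d y).
  by apply: Rmult_le_pos => //; left; exact: Rdiv_lt_0_compat.
case: (eqVneq x x0) => [e|ne]; first by rewrite (_ : ind (~~ true) = 0) // !Rmult_0_l -Rmult_assoc; apply: Rmult_le_pos; [exact: r0|lra].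
rewrite (collision_prob s0 ne) -Rmult_assoc; apply: Rmult_le_compat_r; first by lra.
rewrite /likely; case: lebP => h; rewrite /ind /=; last by lra.
rewrite !Rmult_1_r; apply: (Rmult_le_reg_r (marg P d y)) => //.
rewrite Rmult_1_l; apply: Rle_trans h _; by rewrite /Rdiv !Rmult_assoc Rinv_l ?Rmult_1_r; [right|lra].
Qed.

(** One hash function is good on average both for the uniformity of the key given [b] and for
    decoding from [d], so a single [h] serves both purposes. Under the true law the key is random;
    replacing it by a uniform key costs [tv_bins], after which some fixed key does as well as the
    average. Encoder and decoder both know that key, so only the [M]-part of the hash is sent. The
    event [e] is arbitrary so that it can contain the failure of another stage. *)
Lemma wyner_ziv_oneshot (T A B C D : finType) (P : T -> R) (a : T -> A) (b : T -> B) (c : T -> C)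
    (dl : B -> C -> D) (e : A -> B -> C -> bool) (K M : nat) (thr tau thr' : R) :
  is_pmf P -> markov P a b c -> (0 < K)%nat -> (0 < M)%nat -> 0 < thr -> 0 < tau -> 0 < thr' ->
  let d t := dl (b t) (c t) in
  exists (al : B -> A) (m : A -> 'I_M) (dec : 'I_M -> D -> A),
  \sum_t (P t * ind (e (al (b t)) (b t) (c t) || (dec (m (al (b t))) (d t) != al (b t)))) <=
  \sum_t (P t * ind (e (a t) (b t) (c t))) +
  (2 * \sum_t (P t * ind (~~ leb (marg P (fun t => (a t, b t)) (a t, b t) * thr) (marg P b (b t)))) +
   (tau + (INR K - 1) / (thr * tau)) / 2) +
  (\sum_t (P t * ind (~~ leb (marg P d (d t)) (marg P (fun t => (a t, d t)) (a t, d t) * thr'))) +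
   thr' / (INR K * INR M)).
Proof.
move=> HP mk K0 M0 thr0 tau0 thr'0 d; have [P0 P1] := HP; have [t0 _] := pmf_inhab HP.
have rK : 0 < INR K by apply: lt_0_INR; apply/ltP.
pose s0 : 'I_K * 'I_M := (Ordinal K0, Ordinal M0).
have Hw := unif_pmf s0.
pose likely x y := leb (marg P d y) (marg P (fun t => (a t, d t)) (x, y) * thr').
have h1 := @tv_bins_avg T A B P a b K M thr tau HP K0 M0 thr0 tau0.
have h2 := @sw_dec_avg T A D ('I_K * 'I_M)%type P a d (a t0) s0 thr' HP thr'0.
rewrite /= -/likely card_prod !card_ord mult_INR in h2.
set E1 := (X in _ <= X) in h1; set E2 := (X in _ <= X) in h2.
have [h hh] : exists h : {ffun A -> 'I_K * 'I_M}, tv_bins P a b h +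
     \sum_t (P t * ind (sw_dec (a t0) likely h (h (a t)) (d t) != a t)) <= E1 + E2.
  apply: (exists_le_avg (iid_pmf A Hw)).
  rewrite (eq_bigr (fun h => iid (@unif _) h * tv_bins P a b h + iid (@unif _) h *
     \sum_t (P t * ind (sw_dec (a t0) likely h (h (a t)) (d t) != a t)))); last by move=> h _; rewrite Rmult_plus_distr_l.
  by rewrite sum_add; apply: Rplus_le_compat; [exact: h1|exact: h2].
(* The decoder takes [k] for the key. When [k] is the true key of [x] this is ordinary decoding of
   [h x], and it is the only [k] that survives in the sum over keys below. *)
pose e' k x y z := e x y z || (sw_dec (a t0) likely h (k, (h x).2) (dl y z) != x).
have /functional_choice [al hal] : forall k : 'I_K, exists al : B -> A,
    / INR K * \sum_t (P t * ind (e' k (al (b t)) (b t) (c t))) <=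
    \sum_t (ind ((h (a t)).1 == k) * P t * ind (e' k (a t) (b t) (c t))) +
    \sum_y Rabs (/ INR K * marg P b y - \sum_x (ind ((h x).1 == k) * marg P (fun t => (a t, b t)) (x, y))).
  move=> k; apply: (@derandomize T A B C P a b c (e' k) (fun x => ind ((h x).1 == k)) (/ INR K)) => //.
  - by move=> x; exact: ind_ge0.
  - by left; exact: Rinv_0_lt_compat.
have [k hk] : exists k : 'I_K, \sum_t (P t * ind (e' k (al k (b t)) (b t) (c t))) <=
    \sum_t (P t * ind (e (a t) (b t) (c t))) + (E1 + E2).
  apply: (exists_le_avg (unif_pmf (Ordinal K0))).
  apply: (@Rle_trans _ (\sum_(k < K) (\sum_t (ind ((h (a t)).1 == k) * P t * ind (e' k (a t) (b t) (c t))) +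
    \sum_y Rabs (/ INR K * marg P b y - \sum_x (ind ((h x).1 == k) * marg P (fun t => (a t, b t)) (x, y)))))).
    by apply: sum_le => k _; rewrite /unif card_ord; exact: hal.
  rewrite sum_add -/(tv_bins P a b h) exchange_big /=.
  apply: Rle_trans (_ : _ <= \sum_t (P t * ind (e (a t) (b t) (c t))) +
    \sum_t (P t * ind (sw_dec (a t0) likely h (h (a t)) (d t) != a t)) + tv_bins P a b h) _; last by lra.
  apply: Rplus_le_compat_r; rewrite -sum_add; apply: sum_le => t _.
  rewrite (eq_bigr (fun k : 'I_K => ind ((h (a t)).1 == k) * (P t * ind (e' k (a t) (b t) (c t))))); last by move=> *; ring.
  rewrite (sum_delta' (h (a t)).1 (fun k => P t * ind (e' k (a t) (b t) (c t)))) -Rmult_plus_distr_l.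
  apply: Rmult_le_compat_l => //; rewrite /e' -surjective_pairing; exact: ind_or.
exists (al k), (fun x => (h x).2), (fun j y => sw_dec (a t0) likely h (k, j) y).
by apply: Rle_trans hk _; rewrite /E1 /E2; lra.
Qed.

(** * Exponential rates and the asymptotic form of binning *)

Notation pow2 := (Rpower 2).

Lemma pow2_gt0 x : 0 < pow2 x. Proof. exact: exp_pos. Qed.

Lemma pow2_log2 x : 0 < x -> pow2 (log2 x) = x.
Proof.
move=> hx; rewrite /Rpower /log2.
have -> : ln x / ln 2 * ln 2 = ln x by field; have := ln2_gt0; lra.
exact: exp_ln.
Qed.

Lemma log2_pow2 x : log2 (pow2 x) = x.
Proof. by rewrite /Rpower /log2 ln_exp; field; have := ln2_gt0; lra. Qed.

Lemma pow2_le x y : x <= y -> pow2 x <= pow2 y.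
Proof. by move=> h; apply: Rle_Rpower => //; lra. Qed.

Lemma pow2_small d eps : 0 < d -> 0 < eps ->
  exists N : nat, forall n : nat, (N <= n)%nat -> pow2 (- (INR n * d)) <= eps.
Proof.
move=> d0 e0; have [N hN] := exists_INR_ge (/ (eps * d * ln 2)).
exists N => n /hN h; rewrite Rpower_Ropp.
have l0 := ln2_gt0.
have := exp_ineq1_le (INR n * d * ln 2); rewrite -/(pow2 (INR n * d)) => h1.
have p0 := pow2_gt0 (INR n * d).
have edl : 0 < eps * d * ln 2 by do 2!apply: Rmult_lt_0_compat => //.
have h2 : 1 <= INR n * (eps * d * ln 2).
  by rewrite -(Rinv_l (eps * d * ln 2)); [apply: Rmult_le_compat_r|]; lra.
apply: (Rmult_le_reg_r (pow2 (INR n * d))) => //; rewrite Rinv_l; last by lra.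
by nra.
Qed.

Lemma floor_nat z : 0 < z ->
  INR (Z.to_nat (Int_part z)) <= z /\ z < INR (Z.to_nat (Int_part z)) + 1.
Proof.
move=> z0; have [h1 h2] := base_Int_part z.
have k0 : (0 <= Int_part z)%Z.
  by apply/(proj1 (Z.lt_succ_r _ _)); apply: lt_IZR; rewrite succ_IZR; lra.
by rewrite INR_IZR_INZ Z2Nat.id //; lra.
Qed.

Lemma msize_le n r : INR (msize n r) <= pow2 (INR n * r).
Proof. by have [] := floor_nat (pow2_gt0 (INR n * r)). Qed.

Lemma msize_ge n r : 0 <= r -> (0 < msize n r)%nat /\ pow2 (INR n * r) / 2 <= INR (msize n r).
Proof.
move=> r0; have [_] := floor_nat (pow2_gt0 (INR n * r)); rewrite -/(msize n r).
have h : 1 <= pow2 (INR n * r).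
  rewrite -(Rpower_O 2); last by lra.
  by apply: pow2_le; apply: Rmult_le_pos => //; exact: pos_INR.
case: (msize n r) => [|k]; first by rewrite /=; lra.
by have := pos_INR k; rewrite S_INR; split=> //; lra.
Qed.

(** The law of large numbers for the conditional log-likelihood of [a] given [b], whose mean is
    minus [H(a|b)]. The upper bound on the conditional mass feeds privacy amplification, the lower
    bound feeds decoding. *)
Lemma cond_aep (T A B : finType) (P : T -> R) (a : T -> A) (b : T -> B) (d eps : R) :
  is_pmf P -> 0 < d -> 0 < eps ->
  let H := entropy P (fun t => (a t, b t)) - entropy P b in
  exists N : nat, forall n : nat, (N <= n)%nat ->
  let mab (t : {ffun 'I_n -> T}) := marg (iid P) (fun t => (fmap a t, fmap b t)) (fmap a t, fmap b t) in
  let mb (t : {ffun 'I_n -> T}) := marg (iid P) (fmap b) (fmap b t) in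
  \sum_t (iid P t * ind (~~ leb (mab t * pow2 (INR n * (H - d))) (mb t))) <= eps /\
  \sum_t (iid P t * ind (~~ leb (mb t) (mab t * pow2 (INR n * (H + d))))) <= eps.
Proof.
move=> HP d0 e0 H; have [P0 P1] := HP.
pose ab t := (a t, b t).
pose z t := log2 (marg P ab (ab t)) - log2 (marg P b (b t)).
have [N hN] := wlln z HP d0 e0.
have mu : \sum_x (P x * z x) = - H.
  rewrite /H /entropy /rsum /Rminus Ropp_plus_distr !Ropp_involutive -sum_opp -sum_add.
  by apply: eq_bigr => x _; rewrite /z /ab Rmult_minus_distr_l.
exists N => n hn mab mb; have := hN n hn; rewrite mu => h.
have main t : 0 < iid P t -> leb (Rabs (\sum_i z (t i) - INR n * - H)) (INR n * d) ->
    mab t * pow2 (INR n * (H - d)) <= mb t /\ mb t <= mab t * pow2 (INR n * (H + d)).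
  move=> ht /lebP hc.
  have [m1 e1] := log2_iid_marg ab HP ht; have [m2 e2] := log2_iid_marg b HP ht.
  have eab : mab t = iid (marg P ab) (fmap ab t).
    rewrite /mab (iid_marg2 P a b); congr iid.
    by apply/ffunP => i; rewrite !ffunE.
  have eb : mb t = iid (marg P b) (fmap b t) by rewrite /mb iid_marg.
  rewrite -eab in m1 e1; rewrite -eb in m2 e2.
  have es : \sum_i z (t i) = log2 (mab t) - log2 (mb t) by rewrite e1 e2 -sum_sub.
  rewrite es in hc.
  have [h1 h2] : log2 (mab t) - log2 (mb t) + INR n * H <= INR n * d /\
                 - (INR n * d) <= log2 (mab t) - log2 (mb t) + INR n * H.
    by move: hc; rewrite /Rabs; case: Rcase_abs; lra.
  have l1 : pow2 (log2 (mab t)) = mab t := pow2_log2 m1.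
  have l2 : pow2 (log2 (mb t)) = mb t := pow2_log2 m2.
  split.
    by rewrite -{1}l1 -{1}l2 -Rpower_plus; apply: pow2_le; lra.
  by rewrite -{1}l2 -{1}l1 -Rpower_plus; apply: pow2_le; lra.
have [Pn0 _] := @iid_pmf 'I_n T P HP.
split; apply: Rle_trans h; apply: sum_le => t _;
  (case: (Rle_lt_or_eq_dec _ _ (Pn0 t)) => [ht|<-]; last by lra);
  apply: Rmult_le_compat_l => //; apply: ind_le; apply: contraNN => /(main t ht) [h1 h2]; exact/lebP.
Qed.

(* The binning rate is the gap between [H(a|d)], needed to decode, and [H(a|b)],
   the amount of randomness that the encoder can absorb. *)
Lemma wyner_ziv (T A B C D : finType) (P : T -> R) (a : T -> A) (b : T -> B) (c : T -> C)
    (dl : B -> C -> D) (r eps : R) :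
  is_pmf P -> markov P a b c ->
  (entropy P (fun t => (a t, dl (b t) (c t))) - entropy P (fun t => dl (b t) (c t)))
   - (entropy P (fun t => (a t, b t)) - entropy P b) < r ->
  0 < eps -> exists N : nat, forall n : nat, (N <= n)%nat ->
  forall e : {ffun 'I_n -> A} -> {ffun 'I_n -> B} -> {ffun 'I_n -> C} -> bool,
  exists (al : {ffun 'I_n -> B} -> {ffun 'I_n -> A}) (m : {ffun 'I_n -> A} -> 'I_(msize n r))
     (dec : 'I_(msize n r) -> {ffun 'I_n -> D} -> {ffun 'I_n -> A}),
  \sum_(t : {ffun 'I_n -> T}) (iid P t * ind (e (al (fmap b t)) (fmap b t) (fmap c t) ||
      (dec (m (al (fmap b t))) (fmap (fun t => dl (b t) (c t)) t) != al (fmap b t)))) <=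
  \sum_(t : {ffun 'I_n -> T}) (iid P t * ind (e (fmap a t) (fmap b t) (fmap c t))) + eps.
Proof.
move=> HP mk; have [P0 P1] := HP.
pose d t := dl (b t) (c t).
pose Hd := entropy P (fun t => (a t, d t)) - entropy P d.
pose Hb := entropy P (fun t => (a t, b t)) - entropy P b.
move=> hr0 e0; have hr : Hd - Hb < r by exact: hr0.
(* [H(a|d) >= H(a|b,c) = H(a|b)], as [d] is a function of [(b,c)] and the chain is Markov. A
   nonnegative rate guarantees a nonempty message set of at least half the nominal size. *)
have r0 : 0 <= r.
  suff : 0 <= Hd - Hb by lra.
  have := condMI_ge0 a (fun t => (b t, c t)) d HP; rewrite condMIE // => h0.
  have h : 0 <= entropy P (fun t => (a t, d t)) + entropy P (fun t => (b t, c t, d t))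
    - entropy P (fun t => (a t, (b t, c t), d t)) - entropy P d by exact: h0.
  have e1 : entropy P (fun t => (b t, c t, d t)) = entropy P (fun t => (b t, c t)).
    by apply: entropy_ker => // t s _ _; split=> [[-> ->] //|[h1 h2]]; rewrite /d h1 h2.
  have e2 : entropy P (fun t => (a t, (b t, c t), d t)) = entropy P (fun t => (a t, b t, c t)).
    by apply: entropy_ker => // t s _ _; split=> [[-> -> ->] //|[h1 h2 h3]]; rewrite /d h1 h2 h3.
  have e3 : entropy P (fun t => (a t, b t, c t)) = entropy P (fun t => (a t, b t)) +
    entropy P (fun t => (b t, c t)) - entropy P b by exact: entropy_markov.
  by move: h; rewrite /Hd /Hb e1 e2 e3; lra.
(* With thresholds at the exponents [Hb - dd] and [Hd + dd] and the key rate at [Hb - 2 * dd], the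
   total hash rate is [Hd + 2 * dd]. Both comparisons then leave the margin [eta = 2^(-n * dd)]:
   [4 * eta / eps] for uniformity, [2 * eta] for decoding, whence the two bounds required of
   [eta]. *)
pose dd := (r - (Hd - Hb)) / 4.
have dd0 : 0 < dd by rewrite /dd; lra.
have e8 : 0 < eps / 8 by lra.
have [N1 hN1] := cond_aep a b HP dd0 e8.
have [N2 hN2] := cond_aep a d HP dd0 e8.
have [N3 hN3] := @pow2_small dd (Rmin (eps^2 / 16) (eps / 16)) dd0 (ltac:(apply: Rmin_pos; nra)).
exists (maxn N1 (maxn N2 N3)) => n; rewrite !geq_max => /andP [/hN1 [h1 _] /andP [/hN2 [_ h2] /hN3 h3]] e.
have [M0 M1] := @msize_ge n r r0.
set thr := pow2 _ in h1; set thr' := pow2 _ in h2; set eta := pow2 _ in h3.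
(* The exponent may be negative, so the floor may be 0; the successor keeps a key available, and
   [K - 1] and [K] enclose the power. *)
pose K := (Z.to_nat (Int_part (pow2 (INR n * (Hb - 2 * dd))))).+1.
have [K1 K2] := floor_nat (pow2_gt0 (INR n * (Hb - 2 * dd))).
have [al [m [dec hd]]] := @wyner_ziv_oneshot _ _ _ _ _ (iid P) (fmap a) (fmap b) (fmap c)
  (fun y z => [ffun i => dl (y i) (z i)]) e K (msize n r) thr (eps / 4) thr'
  (iid_pmf 'I_n HP) (markov_iid mk) isT M0 (pow2_gt0 _) (ltac:(lra)) (pow2_gt0 _).
exists al, m, dec.
have dE : (fun t : {ffun 'I_n -> T} => [ffun i => dl (fmap b t i) (fmap c t i)]) = fmap d.
  by apply: functional_extensionality => t; apply/ffunP => i; rewrite !ffunE.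
have dE2 : (fun t : {ffun 'I_n -> T} => (fmap a t, [ffun i => dl (fmap b t i) (fmap c t i)])) =
    (fun t => (fmap a t, fmap d t)).
  by apply: functional_extensionality => t; congr (_, _); apply/ffunP => i; rewrite !ffunE.
have dE1 t : [ffun i => dl (fmap b t i) (fmap c t i)] = fmap d t.
  by apply/ffunP => i; rewrite !ffunE.
rewrite (eq_bigr (fun t : {ffun 'I_n -> T} => iid P t * ind (e (al (fmap b t)) (fmap b t) (fmap c t) ||
   (dec (m (al (fmap b t))) [ffun i => dl (fmap b t i) (fmap c t i)] != al (fmap b t))))); last first.
  by move=> t _; rewrite dE1.
apply: Rle_trans hd _.
have h2' : \sum_(t : {ffun 'I_n -> T}) (iid P t * ind (~~ leb
    (marg (iid P) (fun t : {ffun 'I_n -> T} => [ffun i => dl (fmap b t i) (fmap c t i)])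
        [ffun i => dl (fmap b t i) (fmap c t i)])
    (marg (iid P) (fun t : {ffun 'I_n -> T} => (fmap a t, [ffun i => dl (fmap b t i) (fmap c t i)]))
        (fmap a t, [ffun i => dl (fmap b t i) (fmap c t i)]) * thr'))) <= eps / 8.
  by rewrite dE dE2; apply: Rle_trans h2; apply: sum_le => t _; rewrite dE1; exact: Rle_refl.
have thr0 : 0 < thr by exact: pow2_gt0.
have eta0 : 0 < eta by exact: pow2_gt0.
have [eta1 eta2] : eta <= eps^2/16 /\ eta <= eps/16.
  by have := Rmin_l (eps^2 / 16) (eps / 16); have := Rmin_r (eps^2 / 16) (eps / 16); lra.
have q1 : (INR K - 1) / (thr * (eps / 4)) <= eps / 4.
  have -> : INR K - 1 = INR (Z.to_nat (Int_part (pow2 (INR n * (Hb - 2 * dd))))) by rewrite S_INR; lra.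
  apply: (@Rle_trans _ (pow2 (INR n * (Hb - 2 * dd)) / (thr * (eps / 4)))).
    by apply: Rmult_le_compat_r => //; left; apply: Rinv_0_lt_compat; nra.
  have -> : pow2 (INR n * (Hb - 2 * dd)) = thr * eta.
    by rewrite /thr /eta -Rpower_plus; congr (pow2 _); rewrite -/Hb; ring.
  have -> : thr * eta / (thr * (eps / 4)) = 4 * eta / eps by field; lra.
  apply: (Rmult_le_reg_r eps) => //; rewrite /Rdiv Rmult_assoc Rinv_l; lra.
have q2 : thr' / (INR K * INR (msize n r)) <= eps / 8.
  have K3 : pow2 (INR n * (Hb - 2 * dd)) <= INR K by rewrite S_INR; lra.
  have p1 := pow2_gt0 (INR n * (Hb - 2 * dd)); have p2 := pow2_gt0 (INR n * r).
  apply: (@Rle_trans _ (thr' / (pow2 (INR n * (Hb - 2 * dd)) * (pow2 (INR n * r) / 2)))).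
    apply: Rmult_le_compat_l; first by left; exact: pow2_gt0.
    by apply: Rinv_le_contravar; [nra|apply: Rmult_le_compat; lra].
  have -> : thr' = eta * (pow2 (INR n * (Hb - 2 * dd)) * pow2 (INR n * r)).
    by rewrite /thr' /eta -!Rpower_plus; congr (pow2 _); rewrite /dd -/Hd; field.
  have -> : eta * (pow2 (INR n * (Hb - 2 * dd)) * pow2 (INR n * r)) /
     (pow2 (INR n * (Hb - 2 * dd)) * (pow2 (INR n * r) / 2)) = 2 * eta by field; lra.
  lra.
apply: Rle_trans (_ : _ <= \sum_(t : {ffun 'I_n -> T}) (iid P t * ind (e (fmap a t) (fmap b t) (fmap c t))) +
  (2 * (eps / 8) + (eps / 4 + eps / 4) / 2) + (eps / 8 + eps / 8)) _; last by lra.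
apply: Rplus_le_compat; last by apply: Rplus_le_compat.
apply: Rplus_le_compat_l; apply: Rplus_le_compat; last by lra.
by apply: Rmult_le_compat_l; [lra|exact: h1].
Qed.

(** * Achievability *)

(** If [y] and [y'] are both compatible with [(x,u,w)], then [(u,y)] and [(u,y')] lie in the
    independent set of [w]. Both occur together with the side information [(x,u)], so distinct
    values of [f] would make them adjacent. *)
Lemma decoder_of_labels (X Y F U W : finType) (f : X -> Y -> F) (Q : X * Y * U * W -> R)
    (lab : W -> {set U * Y}) :
  is_pmf Q ->
  (forall w, indep_set
     (char_adj Q (fun t => (cU t, cY t)) (fun t => (cX t, cU t)) (fun t => (cX t, cY t))
        (fun s : X * Y => f s.1 s.2)) (lab w)) ->
  rsum (fun t => if (cU t, cY t) \in lab (cW t) then Q t else 0) = 1 ->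
  exists G : X -> U -> W -> F, forall x y u w, 0 < Q (x, y, u, w) -> G x u w = f x y.
Proof.
move=> HQ hind h1; have [Q0 Q1] := HQ; have [[[[x0 y0] u0] w0] _] := pmf_inhab HQ.
have inlab x y u w : 0 < Q (x, y, u, w) -> (u, y) \in lab w.
  move=> hq; apply: contraT => hn.
  have : Q (x, y, u, w) <= 0; last by lra.
  have -> : 0 = \sum_t (Q t - (if (cU t, cY t) \in lab (cW t) then Q t else 0)).
    by rewrite sum_sub; move: h1 Q1; rewrite /rsum => -> ->; lra.
  have := @sum_term_le _ (x, y, u, w) (fun t => Q t - (if (cU t, cY t) \in lab (cW t) then Q t else 0)).
  rewrite /cU /cY /cW /= (negbTE hn) Rminus_0_r; apply => t.
  by have := Q0 t; case: ifP; lra.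
have /functional_choice [G hG] : forall s : X * U * W, exists v : F,
    forall y, 0 < Q (s.1.1, y, s.1.2, s.2) -> v = f s.1.1 y.
  move=> [[x u] w] /=.
  case: (classic (exists y, 0 < Q (x, y, u, w))) => [[y hy]|hn]; last first.
    by exists (f x0 y0) => y hy; case: hn; exists y.
  exists (f x y) => y' hy'; apply: NNPP => hne.
  apply: (hind w (u, y) (u, y') (inlab _ _ _ _ hy) (inlab _ _ _ _ hy')).
  exists (x, y), (x, y'), (x, u); split => //.
  apply: Rmult_lt_0_compat.
    exact: Rlt_le_trans hy (@le_marg _ _ Q (fun t => (cU t, cY t, (cX t, cU t), (cX t, cY t))) (x, y, u, w) Q0).
  exact: Rlt_le_trans hy' (@le_marg _ _ Q (fun t => (cU t, cY t, (cX t, cU t), (cX t, cY t))) (x, y', u, w) Q0).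
by exists (fun x u w => G (x, u, w)) => x y u w; exact: (hG (x, u, w) y).
Qed.

Lemma entropy_unit (T : finType) (P : T -> R) : is_pmf P -> entropy P (fun _ => tt) = 0.
Proof.
move=> [P0 P1]; rewrite /entropy /rsum sum0; first by lra.
move=> t _; have -> : marg P (fun _ => tt) tt = 1.
  by rewrite -P1; apply: eq_bigr => s _; rewrite eqxx.
by rewrite /log2 ln_1; lra.
Qed.

(** Lets the error of a code be computed on blocks that also carry the auxiliary variables, which
    the code itself does not see. *)
Lemma err_prob_lift (T X Y F : finType) (p : X * Y -> R) (f : X -> Y -> F) (Q : T -> R)
    (cx : T -> X) (cy : T -> Y) (n m0 mX mY : nat) (c : code X Y F n m0 mX mY) :
  (forall xy, marg Q (fun t => (cx t, cy t)) xy = p xy) ->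
  err_prob p f c = \sum_(t : {ffun 'I_n -> T}) (iid Q t *
    ind (dec c (encX c (fmap cx t)) (encY c (fmap cy t) (enc0 c (fmap cx t))) !=
         [ffun i => f (cx (t i)) (cy (t i))])).
Proof.
move=> hp; rewrite /err_prob /rsum.
pose h (xy : {ffun 'I_n -> X} * {ffun 'I_n -> Y}) :=
  ind (dec c (encX c xy.1) (encY c xy.2 (enc0 c xy.1)) != [ffun i => f (xy.1 i) (xy.2 i)]).
transitivity (\sum_xy (marg (iid Q) (fun t => (fmap cx t, fmap cy t)) xy * h xy)).
  apply: eq_bigr => -[x y] _; rewrite (iid_marg2 Q cx cy) /iid /rprod /h /ind; congr (_ * _).
    by apply: eq_bigr => i _; rewrite ffunE hp.
  by case: eqP.
rewrite (exp_marg (iid Q) (fun t => (fmap cx t, fmap cy t)) h); apply: eq_bigr => t _.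
rewrite /h; congr (_ * ind (_ != _)).
by apply/ffunP => i; rewrite !ffunE.
Qed.

Lemma achievable_of_single_letter (X Y F U W : finType) (p : X * Y -> R) (f : X -> Y -> F)
    (Q : X * Y * U * W -> R) (lab : W -> {set U * Y}) (R0 RX RY d : R) :
  entropy p (fun s : X * Y => s.1) < RX -> single_letter p f Q lab R0 RY -> 0 < d ->
  achievable p f (R0 + d) RX (RY + d).
Proof.
move=> hRX [HQ [hp [mk1 [mk2 [hind [hlab [hR0 hRY]]]]]]] d0 eps e0.
have [G hG] := decoder_of_labels HQ hind hlab.
have [Q0 Q1] := HQ; have e3 : 0 < eps / 3 by lra.
pose tX : X * Y * U * W -> X := fun t => cX t.
pose tY : X * Y * U * W -> Y := fun t => cY t.
pose tU : X * Y * U * W -> U := fun t => cU t.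
pose tW : X * Y * U * W -> W := fun t => cW t.
pose H (Z : eqType) (g : X * Y * U * W -> Z) := entropy Q g.
have m1 : H _ (fun t => (tU t, tX t, tY t)) = H _ (fun t => (tU t, tX t)) + H _ (fun t => (tX t, tY t)) - H _ tX.
  exact: (entropy_markov Q0 mk1).
have m2 : H _ (fun t => (tX t, (tU t, tY t), tW t)) = H _ (fun t => (tX t, (tU t, tY t))) +
    H _ (fun t => (tU t, tY t, tW t)) - H _ (fun t => (tU t, tY t)).
  exact: (entropy_markov Q0 mk2).
have i1 : H _ (fun t => (tX t, tY t)) + H _ (fun t => (tU t, tY t)) - H _ (fun t => (tX t, tU t, tY t)) - H _ tY <= R0.
  by apply: Rle_trans hR0; rewrite condMIE //; exact: Rle_refl.
have i2 : H _ (fun t => (tY t, (tX t, tU t))) + H _ (fun t => (tW t, (tX t, tU t))) -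
    H _ (fun t => (tY t, tW t, (tX t, tU t))) - H _ (fun t => (tX t, tU t)) <= RY.
  by apply: Rle_trans hRY; rewrite condMIE //; exact: Rle_refl.
have k1 : H _ (fun t => (tX t, tU t, tY t)) = H _ (fun t => (tU t, tX t, tY t)).
  by apply: entropy_ker => // t s _ _; split=> -[-> -> ->].
have k2 : H _ (fun t => (tY t, (tX t, tU t))) = H _ (fun t => (tX t, (tU t, tY t))).
  by apply: entropy_ker => // t s _ _; split=> -[-> -> ->].
have k3 : H _ (fun t => (tY t, tW t, (tX t, tU t))) = H _ (fun t => (tX t, (tU t, tY t), tW t)).
  by apply: entropy_ker => // t s _ _; split=> -[-> -> -> ->].
have k4 : H _ (fun t => (tW t, (tU t, tY t))) = H _ (fun t => (tU t, tY t, tW t)).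
  by apply: entropy_ker => // t s _ _; split=> -[-> -> ->].
(* The binning gaps are the single-letter rates: [H(U|Y) - H(U|X) = I(X;U|Y)] by the first Markov
   chain, and [H(W|X,U) - H(W|U,Y) = I(Y;W|X,U)] by the second. For [X] itself, taken as both source
   and target and with trivial side information, the gap is [H(X)]. *)
have rateU : (H _ (fun t => (tU t, tY t)) - H _ tY) - (H _ (fun t => (tU t, tX t)) - H _ tX) < R0 + d.
  by lra.
have rateW : (H _ (fun t => (tW t, (tX t, tU t))) - H _ (fun t => (tX t, tU t))) -
   (H _ (fun t => (tW t, (tU t, tY t))) - H _ (fun t => (tU t, tY t))) < RY + d.
  by lra.
have rateX : (H _ (fun t => (tX t, tt)) - H _ (fun => tt)) - (H _ (fun t => (tX t, tX t)) - H _ tX) < RX.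
  have -> : H _ (fun t => (tX t, tt)) = H _ tX.
    by apply: entropy_ker => // t s _ _; split=> [[->]|->].
  have -> : H _ (fun t => (tX t, tX t)) = H _ tX.
    by apply: entropy_ker => // t s _ _; split=> [[->]|->].
  have -> : H _ (fun => tt) = 0 by exact: entropy_unit.
  have -> : H _ tX = entropy p (fun s => s.1).
    have -> : p = marg Q (fun t => (cX t, cY t)) by apply: functional_extensionality => xy; rewrite hp.
    by rewrite (entropy_marg Q (fun t => (cX t, cY t)) (fun s : X * Y => s.1)).
  by rewrite /Rminus Rplus_opp_r Ropp_0 !Rplus_0_r; exact: hRX.
have mkX : markov Q tX tX (fun => tt).
  apply: (@markov_swap _ _ _ _ Q tX tX (fun => tt) (fun t _ => t)) => t u _; split => //; ring.
have mkW : markov Q tW (fun t => (tU t, tY t)) tX by exact: markov_sym.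
have [N1 hN1] := @wyner_ziv _ _ _ _ _ Q tX tX (fun => tt) (fun _ _ => tt) RX (eps / 3) HQ mkX rateX e3.
have [N2 hN2] := @wyner_ziv _ _ _ _ _ Q tW (fun t => (tU t, tY t)) tX (fun uy x => (x, uy.1))
    (RY + d) (eps / 3) HQ mkW rateW e3.
have [N3 hN3] := @wyner_ziv _ _ _ _ _ Q tU tX tY (fun _ y => y) (R0 + d) (eps / 3) HQ mk1 rateU e3.
exists (maxn N1 (maxn N2 N3)) => n; rewrite !geq_max => /andP [/hN1 h1 /andP [/hN2 h2 /hN3 h3]].
pose eW (w : {ffun 'I_n -> W}) (uy : {ffun 'I_n -> U * Y}) (x : {ffun 'I_n -> X}) :=
  ~~ [forall i, G (x i) (uy i).1 (w i) == f (x i) (uy i).2].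
have {h1} [alX [mX [decX hX]]] := h1 (fun x' x _ => x' != x).
have {h2} [alW [mW [decW hW]]] := h2 eW.
(* Failure of the whole stage for [W] when run on [(u,y)]. With the true [u] its probability is the
   bound already obtained for that stage, and binning [U] against this event transfers the bound to
   the regenerated [u]. *)
pose eU (u : {ffun 'I_n -> U}) (x : {ffun 'I_n -> X}) (y : {ffun 'I_n -> Y}) :=
  let w := alW (fzip u y) in eW w (fzip u y) x || (decW (mW w) (fzip x u) != w).
have {h3} [alU [mU [decU hU]]] := h3 eU.
have Qn := @iid_pmf 'I_n _ Q HQ; have [Qn0 _] := Qn.
have zX : \sum_(t : {ffun 'I_n -> X * Y * U * W}) (iid Q t * ind (fmap tX t != fmap tX t)) = 0.
  by apply: sum0 => t _; rewrite eqxx /ind /=; lra.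
have zW : \sum_(t : {ffun 'I_n -> X * Y * U * W}) (iid Q t *
    ind (eW (fmap tW t) (fmap (fun t => (tU t, tY t)) t) (fmap tX t))) = 0.
  apply: sum0 => t _; case: (Rle_lt_or_eq_dec _ _ (Qn0 t)) => [ht|<-]; last by lra.
  suff -> : eW (fmap tW t) (fmap (fun t => (tU t, tY t)) t) (fmap tX t) = false by rewrite /ind; lra.
  apply/negbF/forallP => i; rewrite !ffunE; apply/eqP; have := iid_gt0 i HQ ht.
  by case: (t i) => [[[x y] u] w] /=; exact: hG.
have sU : \sum_(t : {ffun 'I_n -> X * Y * U * W}) (iid Q t *
    ind (eU (fmap tU t) (fmap tX t) (fmap tY t))) <= eps / 3.
  rewrite zW Rplus_0_l in hW; apply: Rle_trans hW; right; apply: eq_bigr => t _; congr (_ * ind _).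
  have -> : fmap (fun t => (tU t, tY t)) t = fzip (fmap tU t) (fmap tY t).
    by apply/ffunP => i; rewrite !ffunE.
  rewrite /eU; congr (_ || (decW _ _ != _)).
  by apply/ffunP => i; rewrite !ffunE.
(* [alU] is a deterministic function, so the decoder recomputes [u] from the recovered [x] and has
   the side information [(x,u)] for decoding [w]. *)
pose cd : code X Y F n (msize n (R0 + d)) (msize n RX) (msize n (RY + d)) :=
  Code (fun x => mU (alU x)) (fun x => mX (alX x))
    (fun y j => mW (alW (fzip (decU j y) y)))
    (fun j k => let x := decX j [ffun => tt] in
       let w := decW k (fzip x (alU x)) in [ffun i => G (x i) (alU x i) (w i)]).
exists cd; rewrite (err_prob_lift f cd hp).
apply: Rle_trans (_ : _ <= \sum_(t : {ffun 'I_n -> X * Y * U * W}) (iid Q t *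
     ind ((alX (fmap tX t) != fmap tX t) || (decX (mX (alX (fmap tX t))) (fmap (fun => tt) t) != alX (fmap tX t)))) +
   \sum_(t : {ffun 'I_n -> X * Y * U * W}) (iid Q t *
     ind (eU (alU (fmap tX t)) (fmap tX t) (fmap tY t) ||
        (decU (mU (alU (fmap tX t))) (fmap tY t) != alU (fmap tX t))))) _; last first.
  apply: Rle_trans (Rplus_le_compat _ _ _ _ hX hU) _; rewrite zX Rplus_0_l.
  by apply: Rle_trans (Rplus_le_compat_l _ _ _ (Rplus_le_compat_r _ _ _ sU)) _; lra.
rewrite -sum_add; apply: sum_le => t _; rewrite -Rmult_plus_distr_l; apply: Rmult_le_compat_l => //.
apply: Rle_trans (ind_or _ _); apply: ind_le; apply: contraNT.
rewrite !negb_or !negbK => /andP [/andP [/eqP x1 /eqP x2] /andP [/andP [v1 /eqP v2] /eqP v3]].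
rewrite /cd /=; have -> : [ffun => tt] = fmap (fun => tt) t :> {ffun 'I_n -> unit} by apply/ffunP => i; rewrite !ffunE.
rewrite -/tX -/tY in x1 x2 v1 v2 v3 *.
rewrite x1 in x2 *; rewrite x2 v3 v2; apply/eqP/ffunP => i; rewrite !ffunE.
by move: v1 => /forallP /(_ i) /eqP; rewrite !ffunE.
Qed.

Lemma rate_region_of_single_letter (X Y F U W : finType) (p : X * Y -> R) (f : X -> Y -> F)
    (Q : X * Y * U * W -> R) (lab : W -> {set U * Y}) (R0 RX RY : R) :
  entropy p (fun s : X * Y => s.1) < RX -> single_letter p f Q lab R0 RY -> rate_region p f R0 RX RY.
Proof.
move=> hRX hs d d0; exists (R0 + d / 2), RX, (RY + d / 2); split.
  by apply: (achievable_of_single_letter hRX hs); lra.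
by split; [|split]; rewrite /Rabs; case: Rcase_abs; lra.
Qed.

(** * Converse *)

(** The graph condition in quantitative form: [g] recovers [f] from [(X,U,W)] up to error
    probability [eps]. A code provides this with positive [eps], and the error is linear in the law,
    as the reduction of alphabets requires. *)
Definition near_solution (X Y F U W : finType) (p : X * Y -> R) (f : X -> Y -> F)
    (Q : X * Y * U * W -> R) (g : X -> U -> W -> F) (r0 rY eps : R) : Prop :=
  [/\ is_pmf Q,
      (forall xy, marg Q (fun t => (cX t, cY t)) xy = p xy),
      markov Q (@cU X Y U W) (@cX X Y U W) (@cY X Y U W),
      markov Q (@cX X Y U W) (fun t => (cU t, cY t)) (@cW X Y U W) &
   [/\ condMI Q (@cX X Y U W) (@cU X Y U W) (@cY X Y U W) <= r0,
      condMI Q (@cY X Y U W) (@cW X Y U W) (fun t => (cX t, cU t)) <= rY &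
      \sum_t (Q t * ind (g (cX t) (cU t) (cW t) != f (cX t) (cY t))) <= eps]].

Lemma markov_marg (T Z : finType) (A B C : eqType) (P : T -> R) (g : T -> Z)
    (a : Z -> A) (b : Z -> B) (c : Z -> C) :
  markov P (fun t => a (g t)) (fun t => b (g t)) (fun t => c (g t)) -> markov (marg P g) a b c.
Proof.
move=> m x y z; have := m x y z.
by rewrite (marg_marg P g (fun s => (a s, b s, c s))) (marg_marg P g (fun s => (a s, b s)))
  (marg_marg P g (fun s => (b s, c s))) (marg_marg P g b).
Qed.

Lemma condMI_marg (T Z : finType) (A B C : eqType) (P : T -> R) (g : T -> Z)
    (a : Z -> A) (b : Z -> B) (c : Z -> C) :
  is_pmf P ->
  condMI (marg P g) a b c = condMI P (fun t => a (g t)) (fun t => b (g t)) (fun t => c (g t)).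
Proof.
move=> HP; have [P0 _] := HP; have [Q0 _] := marg_pmf g HP.
rewrite !condMIE // (entropy_marg P g (fun s => (a s, c s))) (entropy_marg P g (fun s => (b s, c s))).
by rewrite (entropy_marg P g (fun s => (a s, b s, c s))) (entropy_marg P g c).
Qed.

(** * Blocks at a uniform random time *)

(** Masking with [None] instead of truncating gives all prefixes one finite type, whatever the time.
    Position [k] is excluded from the prefix and included in the suffix, so that the two are
    complementary. *)
Definition prefix_of (n : nat) (A : Type) (k : nat) (x : {ffun 'I_n -> A}) : {ffun 'I_n -> option A} :=
  [ffun j : 'I_n => if (j < k)%nat then Some (x j) else None].
Definition suffix_of (n : nat) (A : Type) (k : nat) (x : {ffun 'I_n -> A}) : {ffun 'I_n -> option A} :=
  [ffun j : 'I_n => if (k <= j)%nat then Some (x j) else None].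

Lemma prefixP (n : nat) (A : Type) (k : nat) (x x' : {ffun 'I_n -> A}) :
  prefix_of k x = prefix_of k x' <-> forall j : 'I_n, (j < k)%nat -> x j = x' j.
Proof.
split=> [/ffunP h j jk|h]; first by have := h j; rewrite !ffunE jk => -[].
by apply/ffunP => j; rewrite !ffunE; case: ifP => // jk; rewrite h.
Qed.

Lemma suffixP (n : nat) (A : Type) (k : nat) (x x' : {ffun 'I_n -> A}) :
  suffix_of k x = suffix_of k x' <-> forall j : 'I_n, (k <= j)%nat -> x j = x' j.
Proof.
split=> [/ffunP h j jk|h]; first by have := h j; rewrite !ffunE jk => -[].
by apply/ffunP => j; rewrite !ffunE; case: ifP => // jk; rewrite h.
Qed.

Lemma prefixSP (n : nat) (A : Type) (i : 'I_n) (x x' : {ffun 'I_n -> A}) :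
  prefix_of i.+1 x = prefix_of i.+1 x' <-> prefix_of i x = prefix_of i x' /\ x i = x' i.
Proof.
split=> [/prefixP h|[/prefixP h e]].
  by split; [apply/prefixP => j ji; apply: h; exact: ltnW|exact: h].
apply/prefixP => j; rewrite ltnS leq_eqVlt => /orP [/eqP ji|/h //].
by have -> : j = i by exact: val_inj.
Qed.

Lemma suffixSP (n : nat) (A : Type) (i : 'I_n) (x x' : {ffun 'I_n -> A}) :
  suffix_of i x = suffix_of i x' <-> suffix_of i.+1 x = suffix_of i.+1 x' /\ x i = x' i.
Proof.
split=> [/suffixP h|[/suffixP h e]].
  by split; [apply/suffixP => j ji; apply: h; exact: ltnW|exact: h].
apply/suffixP => j; rewrite leq_eqVlt => /orP [/eqP ji|/h //].
by have <- : i = j by exact: val_inj.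
Qed.

Definition time_shared (n : nat) (T : finType) (P : T -> R) (w : 'I_n * {ffun 'I_n -> T}) : R :=
  / INR n * iid P w.2.

Lemma sum_time_shared (n : nat) (T : finType) (P : T -> R) (h : 'I_n -> {ffun 'I_n -> T} -> R) :
  \sum_w (time_shared P w * h w.1 w.2) = / INR n * \sum_(i < n) \sum_t (iid P t * h i t).
Proof.
rewrite -(pair_bigA _ (fun i t => time_shared P (i, t) * h i t)) /= -sum_mull.
apply: eq_bigr => i _; rewrite -sum_mull; apply: eq_bigr => t _; rewrite /time_shared /=; ring.
Qed.

Lemma time_shared_pmf (n : nat) (T : finType) (P : T -> R) :
  (0 < n)%nat -> is_pmf P -> is_pmf (@time_shared n T P).
Proof.
move=> n0 HP; have N0 : 0 < INR n by apply: lt_0_INR; apply/ltP.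
have [Pn0 Pn1] := @iid_pmf 'I_n T P HP; split=> [w|].
  by apply: Rmult_le_pos => //; left; exact: Rinv_0_lt_compat.
have := sum_time_shared P (fun (_ : 'I_n) (_ : {ffun 'I_n -> T}) => 1).
rewrite sum_mulr Rmult_1_r /rsum => ->.
rewrite (eq_bigr (fun _ : 'I_n => 1)) => [|i _]; last by rewrite /= sum_mulr; move: Pn1; rewrite /rsum => ->; lra.
by rewrite sum_constT card_ord Rmult_1_r Rinv_l //; lra.
Qed.

Lemma time_shared_marg (n : nat) (T Z : finType) (P : T -> R) (g : 'I_n -> {ffun 'I_n -> T} -> Z) i z :
  marg (@time_shared n T P) (fun w => (w.1, g w.1 w.2)) (i, z) = / INR n * marg (iid P) (g i) z.
Proof.
rewrite !margE.
transitivity (\sum_w (time_shared P w * (ind (w.1 == i) * ind (g w.1 w.2 == z)))).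
  by apply: eq_bigr => w _; rewrite xpair_eqE ind_and; ring.
rewrite (sum_time_shared P (fun j t => ind (j == i) * ind (g j t == z))); congr (_ * _).
rewrite (eq_bigr (fun j : 'I_n => ind (j == i) * \sum_t (iid P t * ind (g j t == z)))) => [|j _].
  by rewrite sum_delta; apply: eq_bigr => t _; ring.
by rewrite -sum_mull; apply: eq_bigr => t _; ring.
Qed.

(** Chain rule with the uniform time. The term [log2 (INR n)] cancels in all differences of
    entropies used below. *)
Lemma time_shared_entropy (n : nat) (T Z : finType) (P : T -> R) (g : 'I_n -> {ffun 'I_n -> T} -> Z) :
  (0 < n)%nat -> is_pmf P ->
  entropy (@time_shared n T P) (fun w => (w.1, g w.1 w.2)) =
  log2 (INR n) + / INR n * \sum_(i < n) entropy (@iid _ T P) (g i).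
Proof.
move=> n0 HP; have N0 : 0 < INR n by apply: lt_0_INR; apply/ltP.
have [Pn0 Pn1] := @iid_pmf 'I_n T P HP.
rewrite /entropy /rsum.
rewrite (eq_bigr (fun w : 'I_n * {ffun 'I_n -> T} => time_shared P w * log2 (/ INR n * marg (iid P) (g w.1) (g w.1 w.2)))); last first.
  by move=> w _; rewrite time_shared_marg.
rewrite (sum_time_shared P (fun i t => log2 (/ INR n * marg (iid P) (g i) (g i t)))).
have -> : log2 (INR n) = / INR n * \sum_(i < n) log2 (INR n) by rewrite sum_constT card_ord; field; lra.
rewrite -Rmult_plus_distr_l -sum_add Ropp_mult_distr_r -sum_opp; congr (_ * _).
apply: eq_bigr => i _.
have -> : log2 (INR n) = \sum_(t : {ffun 'I_n -> T}) (iid P t * log2 (INR n)) by rewrite sum_mulr; move: Pn1; rewrite /rsum => ->; lra.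
rewrite -!sum_opp -sum_add; apply: eq_bigr => t _.
case: (Rle_lt_or_eq_dec _ _ (Pn0 t)) => [ht|<-]; last by lra.
have mp : 0 < marg (iid P) (g i) (g i t) := Rlt_le_trans _ _ _ ht (@le_marg _ _ (iid P) (g i) t Pn0).
by rewrite log2_mult ?log2_inv //; [ring|exact: Rinv_0_lt_compat].
Qed.

Lemma time_shared_letter (n : nat) (T : finType) (P : T -> R) x :
  (0 < n)%nat -> is_pmf P -> marg (@time_shared n T P) (fun w => w.2 w.1) x = P x.
Proof.
move=> n0 HP; have N0 : 0 < INR n by apply: lt_0_INR; apply/ltP.
rewrite margE (eq_bigr (fun w => time_shared P w * ind (w.2 w.1 == x))); last by move=> w _; rewrite Rmult_comm.
rewrite (sum_time_shared P (fun (i : 'I_n) (t : {ffun 'I_n -> T}) => ind (t i == x))).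
rewrite (eq_bigr (fun _ : 'I_n => P x)) => [|i _]; first by rewrite sum_constT card_ord; field; lra.
rewrite (iid_exp1 i (fun y => ind (y == x)) HP) -[RHS](sum_delta x P).
by apply: eq_bigr => y _; ring.
Qed.

Lemma entropy_iid (n : nat) (T Z : finType) (P : T -> R) (g : T -> Z) :
  is_pmf P -> entropy (@iid 'I_n T P) (fmap g) = INR n * entropy P g.
Proof.
move=> HP; have [Pn0 _] := @iid_pmf 'I_n T P HP; rewrite /entropy -Ropp_mult_distr_r; congr (- _).
transitivity (\sum_(i < n) \sum_(t : {ffun 'I_n -> T}) (iid P t * log2 (marg P g (g (t i))))).
  rewrite exchange_big; apply: eq_bigr => t _; rewrite sum_mull.
  case: (Rle_lt_or_eq_dec _ _ (Pn0 t)) => [ht|<-]; last by lra.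
  by rewrite iid_marg; have [_ ->] := log2_iid_marg g HP ht.
rewrite (eq_bigr (fun _ : 'I_n => rsum (fun t => P t * log2 (marg P g (g t))))) => [|i _].
  by rewrite sum_constT card_ord.
exact: (iid_exp1 i (fun x => log2 (marg P g (g x))) HP).
Qed.

Lemma sum_telescope (n : nat) (A : nat -> R) : \sum_(i < n) (A i.+1 - A i) = A n - A 0%nat.
Proof.
elim: n => [|n ih]; first by rewrite big_ord0; lra.
by rewrite big_ord_recr /= ih; lra.
Qed.

(** The exchange behind the Markov chains that involve blocks. Two blocks with the same first
    components before [k] trade their second components there; each position keeps its two factors
    up to order, so the product of the masses is preserved. The first components are untouched,
    hence so is the message computed from them. *)
Definition mix_snd (n : nat) (X Y : Type) (k : nat) (t t' : {ffun 'I_n -> X * Y}) : {ffun 'I_n -> X * Y} :=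
  [ffun j : 'I_n => if (j < k)%nat then ((t j).1, (t' j).2) else t j].

Lemma mix_snd_fst (n : nat) (X Y : Type) k (t t' : {ffun 'I_n -> X * Y}) :
  fmap fst (mix_snd k t t') = fmap fst t.
Proof. by apply/ffunP => j; rewrite !ffunE; case: ifP. Qed.

Lemma mix_snd_snd (n : nat) (X Y : Type) k (t t' : {ffun 'I_n -> X * Y}) :
  (forall j : 'I_n, (k <= j)%nat -> (t j).2 = (t' j).2) -> fmap snd (mix_snd k t t') = fmap snd t'.
Proof. by move=> h; apply/ffunP => j; rewrite !ffunE; case: ltnP => // /h. Qed.

Lemma mix_sndK (n : nat) (X Y : Type) k (t t' : {ffun 'I_n -> X * Y}) :
  mix_snd k (mix_snd k t t') (mix_snd k t' t) = t.
Proof. by apply/ffunP => j; rewrite !ffunE; case: ifP => h //=; rewrite ?h /=; case: (t j). Qed.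

Lemma mix_snd_mass (n : nat) (X Y : finType) (p : X * Y -> R) k (t t' : {ffun 'I_n -> X * Y}) :
  (forall j : 'I_n, (j < k)%nat -> (t j).1 = (t' j).1) ->
  iid p t * iid p t' = iid p (mix_snd k t t') * iid p (mix_snd k t' t).
Proof.
move=> h; rewrite /iid -!big_split; apply: eq_bigr => j _; rewrite !ffunE; case: ifP => // /h e.
by rewrite /= {1}e -{2}e -!surjective_pairing Rmult_comm.
Qed.

Lemma near_solution_of_code (X Y F : finType) (p : X * Y -> R) (f : X -> Y -> F)
    (n m0 mX mY : nat) (c : code X Y F n m0 mX mY) :
  is_pmf p -> (0 < n)%nat ->
  exists (U W : finType) (Q : X * Y * U * W -> R) (g : X -> U -> W -> F),
    near_solution p f Q g (/ INR n * log2 (INR m0)) (/ INR n * log2 (INR mY)) (err_prob p f c).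
Proof.
move=> Hp n0; have N0 : 0 < INR n by apply: lt_0_INR; apply/ltP.
pose Om : finType := ('I_n * {ffun 'I_n -> X * Y})%type.
pose U : finType := ('I_n * 'I_m0 * {ffun 'I_n -> option X} * {ffun 'I_n -> option Y})%type.
pose P : Om -> R := @time_shared n _ p.
have HP : is_pmf P by exact: time_shared_pmf.
have [P0 P1] := HP.
pose xs (t : {ffun 'I_n -> X * Y}) := fmap fst t.
pose ys (t : {ffun 'I_n -> X * Y}) := fmap snd t.
pose msg (t : {ffun 'I_n -> X * Y}) := enc0 c (xs t).
pose rep (t : {ffun 'I_n -> X * Y}) := encY c (ys t) (msg t).
pose aX (w : Om) : X := (w.2 w.1).1.
pose aY (w : Om) : Y := (w.2 w.1).2.
(* Strict past of [X] and strict future of [Y]: adding the current [Y] turns the state at time [i]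
   into [V i], adding the current [X] turns it into [V i.+1]. *)
pose aU (w : Om) : U := (w.1, msg w.2, prefix_of w.1 (xs w.2), suffix_of w.1.+1 (ys w.2)).
pose aW (w : Om) : 'I_mY := rep w.2.
have xsE t i : xs t i = (t i).1 by rewrite ffunE.
have ysE t i : ys t i = (t i).2 by rewrite ffunE.
have mkUXY : markov P aU aX aY.
  (* Only the current letters of [Y] are traded, possibly between different times; [U] does not
     contain the current letter of [Y]. *)
  pose s (v w : Om) : Om := (v.1, [ffun j => if j == v.1 then ((v.2 j).1, (w.2 w.1).2) else v.2 j]).
  apply: (@markov_swap _ _ _ _ P aU aX aY s) => -[i t] [i' t']; rewrite /aX /= => e.
  have xs_s (j j' : 'I_n) (u u' : {ffun 'I_n -> X * Y}) : xs (s (j, u) (j', u')).2 = xs u.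
    by apply/ffunP => k; rewrite !ffunE /=; case: eqP.
  have mass (j j' : 'I_n) (u u' : {ffun 'I_n -> X * Y}) :
      iid p (s (j, u) (j', u')).2 = p ((u j).1, (u' j').2) * \prod_(k | k != j) p (u k).
    rewrite /iid (bigD1 j) //= ffunE eqxx; congr (_ * _).
    by apply: eq_bigr => k /negbTE kj; rewrite ffunE kj.
  split.
  - rewrite /P /time_shared /= !mass /iid (bigD1 i) //= [X in _ * (/ INR n * X) = _](bigD1 i') //=.
    by rewrite [t i]surjective_pairing [t' i']surjective_pairing /= e; ring.
  - by rewrite ffunE eqxx.
  - rewrite /aU /=; congr (_, _, _, _); rewrite ?/msg ?(xs_s i i') //.
    apply/suffixP => j ji; rewrite !ffunE; case: eqP => // ej.
    by move: ji; rewrite ej ltnn.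
  - by rewrite /aY /= ffunE eqxx.
  - rewrite /s /= !ffunE !eqxx /=; congr (_, _); apply/ffunP => j; rewrite !ffunE.
    by case: eqP => [->|//]; case: (t i).
have mkXUYW : markov P aX (fun w => (aU w, aY w)) aW.
  (* The past of [Y] is traded. Since [Y] from the current time on and the message are shared, the
     result has the [X]-block of one argument and the answer of the other. *)
  pose s (v w : Om) : Om := (v.1, mix_snd v.1 v.2 w.2).
  apply: (@markov_swap _ _ _ _ P aX (fun w => (aU w, aY w)) aW s) => -[i t] [i' t'].
  rewrite /aU /aY /= => -[<- em /prefixP ex /suffixP es ey] {i'}.
  have ex' (j : 'I_n) : (j < i)%nat -> (t j).1 = (t' j).1 by move=> /ex; rewrite !ffunE.
  have ey' (j : 'I_n) : (i <= j)%nat -> (t j).2 = (t' j).2.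
    rewrite leq_eqVlt => /orP [/eqP /val_inj <- //|/es]; by rewrite !ffunE.
  have e1 : xs (mix_snd i t t') = xs t by exact: mix_snd_fst.
  have e2 : ys (mix_snd i t t') = ys t' by exact: mix_snd_snd.
  have e3 : mix_snd i t t' i = t i by rewrite ffunE ltnn.
  split.
  - by rewrite /P /time_shared /= (_ : forall a b d e, a * b * (d * e) = a * d * (b * e)) ?(mix_snd_mass p ex'); [ring|move=> *; ring].
  - rewrite /= /msg e1 e2 e3; congr (_, _, _, _, _).
    by apply/suffixP => j ji; rewrite !ysE; rewrite ey' // ltnW.
  - by rewrite /aX /= e3.
  - by rewrite /aW /rep /= /msg e1 e2 -/(msg t) em.
  - by rewrite /s /= mix_sndK.
(* Allows the whole [X]-block, which the decoder of the code uses through its first message, to be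
   replaced by a guess from [(X,U,W)]. Here the trade includes the current position. *)
have mkdec : markov P (fun w => xs w.2) (fun w => (aX w, aU w, aW w)) aY.
  pose s (v w : Om) : Om := (v.1, mix_snd v.1.+1 v.2 w.2).
  apply: (@markov_swap _ _ _ _ P (fun w => xs w.2) (fun w => (aX w, aU w, aW w)) aY s) => -[i t] [i' t'].
  rewrite /aU /aX /aW /= => -[exi ei em ex es er]; subst i'; move: es => /suffixP es.
  have ex' (j : 'I_n) : (j < i.+1)%nat -> (t j).1 = (t' j).1.
    have /prefixP h : prefix_of i.+1 (xs t) = prefix_of i.+1 (xs t').
      by apply/prefixSP; rewrite !xsE.
    by move=> /h; rewrite !ffunE.
  have ey' (j : 'I_n) : (i < j)%nat -> (t j).2 = (t' j).2 by move=> /es; rewrite !ffunE.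
  have e1 : xs (mix_snd i.+1 t t') = xs t by exact: mix_snd_fst.
  have e2 : ys (mix_snd i.+1 t t') = ys t' by exact: mix_snd_snd.
  have e3 : mix_snd i.+1 t t' i = ((t i).1, (t' i).2) by rewrite ffunE ltnSn.
  split.
  - by rewrite /P /time_shared /= (_ : forall a b d e, a * b * (d * e) = a * d * (b * e)) ?(mix_snd_mass p ex'); [ring|move=> *; ring].
  - rewrite /= /rep /msg e1 e2 e3; congr (_, _, _).
      by congr (_, _, _, _); apply/suffixP => j ji; rewrite !ysE ey'.
    by rewrite -/(msg t) -/(rep t) er /rep em.
  - by rewrite /= e1.
  - by rewrite /aY /= e3.
  - by rewrite /s /= mix_sndK.
pose quad (w : Om) : X * Y * U * 'I_mY := (aX w, aY w, aU w, aW w).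
pose Q := marg P quad.
pose H (Z : eqType) (g : Om -> Z) := entropy P g.
pose V k (t : {ffun 'I_n -> X * Y}) := (msg t, prefix_of k (xs t), suffix_of k (ys t)).
(* The boundary values are [A 0 = H(M0,Y^n)], [A n = H(X^n)], [B 0 = A 0] since the answer is a
   function of [(M0,Y^n)], and [B n] is the joint entropy of the answer and [X^n]. *)
pose A k := entropy (@iid 'I_n _ p) (V k).
pose B k := entropy (@iid 'I_n _ p) (fun t => (V k t, rep t)).
have hUY : H _ (fun w => (aU w, aY w)) = log2 (INR n) + / INR n * \sum_(i < n) A i.
  rewrite -(time_shared_entropy (fun i => V i) n0 Hp); apply: entropy_ker => // -[i t] [i' t'] _ _.
  rewrite /aU /aY /V /= -!ysE; split.
    by move=> [<- -> -> h1 h2]; congr (_, (_, _)); apply/suffixSP.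
  by move=> [<- -> -> /suffixSP [-> ->]].
have hUX : H _ (fun w => (aU w, aX w)) = log2 (INR n) + / INR n * \sum_(i < n) A i.+1.
  rewrite -(time_shared_entropy (fun i : 'I_n => V i.+1) n0 Hp); apply: entropy_ker => // -[i t] [i' t'] _ _.
  rewrite /aU /aX /V /= -!xsE; split.
    by move=> [<- -> h1 -> h2]; congr (_, (_, _, _)); apply/prefixSP.
  by move=> [<- -> /prefixSP [-> ->] ->].
have hUYW : H _ (fun w => (aU w, aY w, aW w)) = log2 (INR n) + / INR n * \sum_(i < n) B i.
  rewrite -(time_shared_entropy (fun (i : 'I_n) t => (V i t, rep t)) n0 Hp); apply: entropy_ker => // -[i t] [i' t'] _ _.
  rewrite /aU /aY /aW /V /= -!ysE; split.
    by move=> [<- -> -> h1 h2 ->]; congr (_, (_, _, _)); apply/suffixSP.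
  by move=> [<- -> -> /suffixSP [-> ->] ->].
have hUXW : H _ (fun w => (aU w, aX w, aW w)) = log2 (INR n) + / INR n * \sum_(i < n) B i.+1.
  rewrite -(time_shared_entropy (fun (i : 'I_n) t => (V i.+1 t, rep t)) n0 Hp); apply: entropy_ker => // -[i t] [i' t'] _ _.
  rewrite /aU /aX /aW /V /= -!xsE; split.
    by move=> [<- -> h1 -> h2 ->]; congr (_, (_, _, _, _)); apply/prefixSP.
  by move=> [<- -> /prefixSP [-> ->] -> ->].
have letter : marg P (fun w : Om => w.2 w.1) = p.
  by apply: functional_extensionality => z; exact: time_shared_letter.
have hX : H _ aX = entropy p fst.
  by rewrite -letter (entropy_marg P (fun w : Om => w.2 w.1) fst).
have hY : H _ aY = entropy p snd.
  by rewrite -letter (entropy_marg P (fun w : Om => w.2 w.1) snd).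
have [Pn0 Pn1] := @iid_pmf 'I_n _ p Hp.
have sufn t t' : suffix_of n (ys t) = suffix_of n (ys t').
  by apply/suffixP => j; rewrite leqNgt ltn_ord.
have suf0 t t' : suffix_of 0 (ys t) = suffix_of 0 (ys t') <-> ys t = ys t'.
  split=> [/suffixP h|-> //]; apply/ffunP => j; exact: h.
have pre0 t t' : prefix_of 0 (xs t) = prefix_of 0 (xs t') by apply/prefixP.
have pren t t' : prefix_of n (xs t) = prefix_of n (xs t') <-> xs t = xs t'.
  split=> [/prefixP h|-> //]; apply/ffunP => j; exact: h.
have hA0 : A 0%nat = entropy (@iid 'I_n _ p) (fun t => (msg t, ys t)).
  apply: entropy_ker => // t s _ _; rewrite /V; split=> [[-> /suf0 ->] //|[-> h]].
  by congr (_, _, _); exact/suf0.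
have hAn : A n = entropy (@iid 'I_n _ p) xs.
  apply: entropy_ker => // t s _ _; rewrite /V; split=> [[_ /pren ->] //|h].
  by congr (_, _, _); [rewrite /msg h|exact/pren|exact: sufn].
have hB0 : B 0%nat = A 0%nat.
  apply: entropy_ker => // t s _ _; rewrite /V; split=> [[-> -> _] //|[h1 h2]].
  congr (_, _, _, _) => //; rewrite /rep h1; congr (encY c _ _); exact/suf0.
have hBn : B n = entropy (@iid 'I_n _ p) (fun t => (rep t, xs t)).
  apply: entropy_ker => // t s _ _; rewrite /V; split=> [[_ /pren -> _ ->] //|[h1 h2]].
  by congr (_, _, _, _) => //; [rewrite /msg h2|exact/pren].
have hx : entropy (@iid 'I_n _ p) xs = INR n * entropy p fst by exact: entropy_iid.
have hy : entropy (@iid 'I_n _ p) ys = INR n * entropy p snd by exact: entropy_iid.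
have b1 : entropy (@iid 'I_n _ p) (fun t => (msg t, ys t)) - entropy (@iid 'I_n _ p) ys <= log2 (INR m0).
  have := @cond_entropy_le_card _ _ _ (@iid 'I_n _ p) msg ys (conj Pn0 Pn1).
  by rewrite card_ord; apply.
have b2 : entropy (@iid 'I_n _ p) (fun t => (rep t, xs t)) - entropy (@iid 'I_n _ p) xs <= log2 (INR mY).
  have := @cond_entropy_le_card _ _ _ (@iid 'I_n _ p) rep xs (conj Pn0 Pn1).
  by rewrite card_ord; apply.
have teleA : \sum_(i < n) A i.+1 - \sum_(i < n) A i = A n - A 0%nat.
  by rewrite -sum_sub; exact: sum_telescope.
have teleB : \sum_(i < n) B i.+1 - \sum_(i < n) B i = B n - B 0%nat.
  by rewrite -sum_sub; exact: sum_telescope.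
have m1 : H _ (fun w => (aU w, aX w, aY w)) = H _ (fun w => (aU w, aX w)) + H _ (fun w => (aX w, aY w)) - H _ aX.
  exact: entropy_markov.
have m2 : H _ (fun w => (aX w, (aU w, aY w), aW w)) = H _ (fun w => (aX w, (aU w, aY w))) +
    H _ (fun w => (aU w, aY w, aW w)) - H _ (fun w => (aU w, aY w)).
  exact: (entropy_markov P0 mkXUYW).
have k1 : H _ (fun w => (aX w, aU w, aY w)) = H _ (fun w => (aU w, aX w, aY w)).
  by apply: entropy_ker => // t s _ _; move: (aX t) (aX s) (aY t) (aY s) (aU t) (aU s) (aW t) (aW s) => *; split=> -[-> -> ->].
have k2 : H _ (fun w => (aY w, (aX w, aU w))) = H _ (fun w => (aX w, (aU w, aY w))).
  by apply: entropy_ker => // t s _ _; move: (aX t) (aX s) (aY t) (aY s) (aU t) (aU s) (aW t) (aW s) => *; split=> -[-> -> ->].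
have k3 : H _ (fun w => (aY w, aW w, (aX w, aU w))) = H _ (fun w => (aX w, (aU w, aY w), aW w)).
  by apply: entropy_ker => // t s _ _; move: (aX t) (aX s) (aY t) (aY s) (aU t) (aU s) (aW t) (aW s) => *; split=> -[-> -> -> ->].
have k4 : H _ (fun w => (aW w, (aX w, aU w))) = H _ (fun w => (aU w, aX w, aW w)).
  by apply: entropy_ker => // t s _ _; move: (aX t) (aX s) (aY t) (aY s) (aU t) (aU s) (aW t) (aW s) => *; split=> -[-> -> ->].
have k5 : H _ (fun w => (aX w, aU w)) = H _ (fun w => (aU w, aX w)).
  by apply: entropy_ker => // t s _ _; move: (aX t) (aX s) (aY t) (aY s) (aU t) (aU s) (aW t) (aW s) => *; split=> -[-> ->].
have iN : 0 < / INR n by exact: Rinv_0_lt_compat.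
(* After telescoping, [n] times the mutual information is exactly [H(M0|Y^n)]. In the same way the
   second one gives the entropy of the answer given [X^n]. *)
have i1 : condMI P aX aU aY <= / INR n * log2 (INR m0).
  apply: Rle_trans (_ : H _ (fun w => (aX w, aY w)) + H _ (fun w => (aU w, aY w)) -
    H _ (fun w => (aX w, aU w, aY w)) - H _ aY <= _); first by rewrite condMIE //; exact: Rle_refl.
  rewrite k1 m1 hUY hUX hX hY.
  apply: Rle_trans (Rmult_le_compat_l _ _ _ (Rlt_le _ _ iN) b1); right.
  rewrite -hA0 hy; have -> : A 0%nat = INR n * entropy p fst + (\sum_(i < n) A i - \sum_(i < n) A i.+1).
    by rewrite -hx -hAn; lra.
  by field; lra.
have i2 : condMI P aY aW (fun w => (aX w, aU w)) <= / INR n * log2 (INR mY).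
  apply: Rle_trans (_ : H _ (fun w => (aY w, (aX w, aU w))) + H _ (fun w => (aW w, (aX w, aU w))) -
    H _ (fun w => (aY w, aW w, (aX w, aU w))) - H _ (fun w => (aX w, aU w)) <= _).
    by rewrite condMIE //; exact: Rle_refl.
  rewrite k2 k3 k4 k5 m2 hUY hUX hUYW hUXW.
  apply: Rle_trans (Rmult_le_compat_l _ _ _ (Rlt_le _ _ iN) b2); right.
  rewrite -hBn -hAn; have -> : B n - A n = (\sum_(i < n) B i.+1 - \sum_(i < n) B i) + (\sum_(i < n) A i - \sum_(i < n) A i.+1).
    by lra.
  by field; lra.
pose e (x : {ffun 'I_n -> X}) (b : X * U * 'I_mY) (y : Y) :=
  dec c (encX c x) b.2 b.1.2.1.1.1 != f b.1.1 y.
(* With unit weight and [kappa = 1] the mismatch of marginals is 0, so the guessed block is at least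
   as good as the true one. *)
have [al hal] := @derandomize _ _ _ _ P (fun w => xs w.2) (fun w => (aX w, aU w, aW w)) aY e
   (fun => 1) 1 HP mkdec (fun _ => Rle_0_1) Rle_0_1.
exists U, ('I_mY : finType), Q, (fun x u w => dec c (encX c (al (x, u, w))) w u.1.1.1).
split.
- exact: marg_pmf.
- move=> xy; rewrite (marg_marg P quad (fun t => (cX t, cY t))) -letter.
  by apply: eq_marg => w _; rewrite /quad /cX /cY /= /aX /aY -surjective_pairing.
- exact: (@markov_marg _ _ _ _ _ P quad).
- exact: (@markov_marg _ _ _ _ _ P quad _ (fun t => (cU t, cY t))).
split.
- by rewrite (condMI_marg quad) //; exact: i1.
- by rewrite (condMI_marg quad) //; exact: i2.
rewrite (exp_marg P quad (fun t => ind (dec c (encX c (al (cX t, cU t, cW t))) (cW t) (cU t).1.1.1 != f (cX t) (cY t)))).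
rewrite Rmult_1_l in hal; apply: Rle_trans hal _.
rewrite [X in _ + X]sum0 => [|y _]; last first.
  rewrite (eq_bigr (fun x => marg P (fun t => (xs t.2, (aX t, aU t, aW t))) (x, y))) => [|x _]; last by rewrite Rmult_1_l.
  by rewrite marg_sum_fst Rmult_1_l /Rminus Rplus_opp_r Rabs_R0.
rewrite Rplus_0_r.
have hpp xy : marg p (fun s => (s.1, s.2)) xy = p xy.
  rewrite margE -[RHS](sum_delta xy p); apply: eq_bigr => s _; by rewrite -surjective_pairing.
rewrite (err_prob_lift f c hpp).
pose h (i : 'I_n) (t : {ffun 'I_n -> X * Y}) := ind (dec c (encX c (xs t)) (rep t) i != f (t i).1 (t i).2).
apply: Rle_trans (_ : _ <= \sum_(w : Om) (P w * h w.1 w.2)) _.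
  by apply: sum_le => w _; rewrite Rmult_1_l; exact: Rle_refl.
rewrite (sum_time_shared p h).
set E := (X in _ <= X).
have -> : E = / INR n * \sum_(i < n) E by rewrite sum_constT card_ord; field; lra.
apply: Rmult_le_compat_l; first by lra.
(* A wrong letter makes the whole block wrong, so the error at each time is at most that of the
   code. *)
apply: sum_le => i _; apply: sum_le => t _; apply: Rmult_le_compat_l => //.
by apply: ind_le; apply: contraNN => /eqP ->; rewrite ffunE.
Qed.

(** * Cardinality bounds *)

(** Fewer equations than unknowns, by Gaussian elimination. The equations form a list so that the
    induction can remove one of them together with one unknown, its pivot. *)
Lemma kernel_vector (K J : finType) (s : seq J) (c : J -> K -> R) (S : {set K}) :
  (size s < #|S|)%nat ->
  exists v : K -> R, [/\ forall k, k \notin S -> v k = 0, exists k, v k <> 0 &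
     forall j, j \in s -> \sum_k (v k * c j k) = 0].
Proof.
elim: s c S => [|j0 s ih] c S /= hS.
  have /card_gt0P [k0 k0S] := hS.
  exists (fun k => ind (k == k0)); split=> // [k kS|].
    by case: eqP => // e; move: kS; rewrite e k0S.
  by exists k0; rewrite eqxx /ind; lra.
case: (classic (exists2 k0, k0 \in S & c j0 k0 <> 0)) => [[k0 k0S c0]|hn]; last first.
  have [v [v1 v2 v3]] := ih c S (ltnW hS).
  exists v; split=> // j; rewrite inE => /orP [/eqP ->|/v3 //].
  apply: sum0 => k _; case: (boolP (k \in S)) => [kS|/v1 ->]; last by lra.
  have -> : c j0 k = 0 by apply: NNPP => h; apply: hn; exists k.
  by lra.
pose c' j k := c j k - c j k0 / c j0 k0 * c j0 k.
have hS' : (size s < #|S :\ k0|)%nat by move: hS; rewrite (cardsD1 k0 S) k0S.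
have [v' [v1 [k1 v2] v3]] := ih c' (S :\ k0) hS'.
pose tau := - (\sum_k (v' k * c j0 k)) / c j0 k0.
pose v k := v' k + ind (k == k0) * tau.
have vs j : \sum_k (v k * c j k) = \sum_k (v' k * c j k) + tau * c j k0.
  rewrite -(sum_delta k0 (fun k => tau * c j k)) -sum_add.
  by apply: eq_bigr => k _; rewrite /v; ring.
exists v; split.
- move=> k kS; rewrite /v v1; last by rewrite !inE negb_and kS orbT.
  by case: eqP => [e|_]; [move: kS; rewrite e k0S|rewrite /ind; lra].
- exists k1; rewrite /v; case: eqP => [e|_]; last by rewrite /ind; lra.
  by case: v2; apply: v1; rewrite e !inE eqxx.
move=> j; rewrite inE vs => /orP [/eqP ->|/v3].
  by rewrite /tau; field.
rewrite (eq_bigr (fun k => v' k * c j k - c j k0 / c j0 k0 * (v' k * c j0 k))); last first.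
  by move=> k _; rewrite /c'; ring.
rewrite sum_sub sum_mull => h.
have -> : \sum_k (v' k * c j k) = c j k0 / c j0 k0 * \sum_k (v' k * c j0 k) by lra.
by rewrite /tau; field.
Qed.

(* Moving along a kernel direction until a weight vanishes, as for the vertices of
   a linear program: minimising [o] saves one point over Caratheodory's bound. *)
Lemma support_reduction (K J : finType) (c : J -> K -> R) (o : K -> R) (h : J -> R)
    (m : nat) (lam : K -> R) :
  (forall k, 0 <= lam k) -> (forall k, 0 < lam k -> 0 < \sum_j (h j * c j k)) ->
  (#|[set k | ~~ leb (lam k) 0]| <= m)%nat ->
  exists mu : K -> R, [/\ forall k, 0 <= mu k,
     forall j, \sum_k (mu k * c j k) = \sum_k (lam k * c j k),
     \sum_k (mu k * o k) <= \sum_k (lam k * o k) &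
     (#|[set k | ~~ leb (mu k) 0]| <= #|J|)%nat].
Proof.
elim: m lam => [|m ih] lam lam0 hpos hm.
  by exists lam; split=> //; [lra|apply: leq_trans hm _].
case: (leqP #|[set k | ~~ leb (lam k) 0]| #|J|) => hJ; first by exists lam; split=> //; lra.
set S := [set k | ~~ leb (lam k) 0] in hm hJ.
have inS k : k \in S -> 0 < lam k by rewrite inE => /lebP; lra.
have ninS k : k \notin S -> lam k = 0.
  by rewrite inE negbK => /lebP; have := lam0 k; lra.
have [v [v1 [kv v2] v3 vo]] : exists v : K -> R, [/\ forall k, k \notin S -> v k = 0,
    exists k, v k <> 0, forall j, \sum_k (v k * c j k) = 0 & \sum_k (v k * o k) <= 0].
  have [|v [v1 [kv v2] v3]] := @kernel_vector K J (enum J) c S; first by rewrite -cardE.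
  have v3' j : \sum_k (v k * c j k) = 0 by apply: v3; rewrite mem_enum.
  case: (Rle_lt_dec (\sum_k (v k * o k)) 0) => hs; first by exists v; split=> //; exists kv.
  (* The sign is chosen so that moving along [v] does not increase the objective. *)
  exists (fun k => - v k); split.
  - by move=> k /v1 ->; lra.
  - by exists kv; lra.
  - move=> j; rewrite (eq_bigr (fun k => - (v k * c j k))) => [|k _]; last by ring.
    by rewrite sum_opp v3'; lra.
  - rewrite (eq_bigr (fun k => - (v k * o k))) => [|k _]; last by ring.
    by rewrite sum_opp; lra.
(* A combination of the constraints that is positive on the support. As [v] is orthogonal to it, [v]
   has a negative entry, so the motion along [v] must reach the boundary of the orthant. *)
pose w k := \sum_j (h j * c j k).
have vw : \sum_k (v k * w k) = 0.
  transitivity (\sum_j (h j * \sum_k (v k * c j k))); last by apply: sum0 => j _; rewrite v3; lra.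
  transitivity (\sum_k \sum_j (h j * (v k * c j k))).
    by apply: eq_bigr => k _; rewrite /w -sum_mull; apply: eq_bigr => j _; ring.
  by rewrite exchange_big; apply: eq_bigr => j _; rewrite sum_mull.
have [k0 hk0] : exists k, v k < 0.
  apply: NNPP => hn.
  have v0 k : 0 <= v k by apply: Rnot_lt_le => hk; apply: hn; exists k.
  have vw0 k : 0 <= v k * w k.
    case: (boolP (k \in S)) => [/inS /hpos hk|/v1 ->]; last by lra.
    by apply: Rmult_le_pos => //; left.
  have := sum_eq0 vw0 vw kv; case: (boolP (kv \in S)) => [/inS /hpos hk|/v1 //].
  by rewrite -/(w kv) in hk => e; case: (Rmult_integral _ _ e) => //; lra.
have Pk0 : ~~ leb 0 (v k0) by apply/lebP; lra.
have [k1 /lebP hk1 hmin] := @exists_min K k0 (fun k => ~~ leb 0 (v k)) (fun k => lam k / - v k) Pk0.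
have {}hk1 : v k1 < 0 by lra.
(* The first time at which a weight vanishes. *)
pose th := lam k1 / - v k1.
have th0 : 0 <= th by apply: Rmult_le_pos => //; left; apply: Rinv_0_lt_compat; lra.
pose lam' k := lam k + th * v k.
have lam'0 k : 0 <= lam' k.
  rewrite /lam'; case: (Rle_lt_dec 0 (v k)) => hv.
    by apply: Rplus_le_le_0_compat => //; exact: Rmult_le_pos.
  have := hmin k (introN (lebP _ _) (Rlt_not_le _ _ hv)); rewrite -/th => hle.
  have : th * - v k <= lam k; last by lra.
  apply: Rle_trans (Rmult_le_compat_r (- v k) _ _ _ hle) _; first by lra.
  by right; field; lra.
have lam'k1 : lam' k1 = 0 by rewrite /lam' /th; field; lra.
have sub : [set k | ~~ leb (lam' k) 0] \subset S :\ k1.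
  apply/subsetP => k; rewrite !inE => hk; apply/andP; split.
    by apply: contraNN hk => /eqP ->; rewrite lam'k1; apply/lebP; lra.
  apply: contraNN hk => /lebP hk; have kS : k \notin S by rewrite inE negbK; apply/lebP.
  by rewrite /lam' (ninS k kS) (v1 k kS); apply/lebP; lra.
have k1S : k1 \in S by apply: contraT => /v1; lra.
have lin (g : K -> R) : \sum_k (lam' k * g k) = \sum_k (lam k * g k) + th * \sum_k (v k * g k).
  by rewrite -sum_mull -sum_add; apply: eq_bigr => k _; rewrite /lam'; ring.
have [|||mu [mu1 mu2 mu3 mu4]] := ih lam'.
- exact: lam'0.
- move=> k hk; apply: hpos; apply: NNPP => hn.
  have kS : k \notin S by rewrite inE negbK; apply/lebP; lra.
  by move: hk; rewrite /lam' (ninS k kS) (v1 k kS); lra.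
- apply: leq_trans (subset_leq_card sub) _.
  by move: hm; rewrite (cardsD1 k1 S) k1S.
exists mu; split=> //.
- by move=> j; rewrite mu2 lin v3; lra.
- by apply: Rle_trans mu3 _; rewrite lin; have := Rmult_le_compat_l _ _ _ th0 vo; lra.
Qed.

Lemma marg_le_comp (T : finType) (Z Z' : eqType) (P : T -> R) (g : T -> Z) (phi : Z -> Z') z :
  (forall t, 0 <= P t) -> marg P g z <= marg P (fun t => phi (g t)) (phi z).
Proof.
move=> P0; rewrite !margE; apply: sum_le => t _; apply: Rmult_le_compat_r => //.
by apply: ind_le => /eqP ->.
Qed.

Lemma marg_comp_eq0 (T : finType) (Z Z' : eqType) (P : T -> R) (g : T -> Z) (phi : Z -> Z') z :
  (forall t, 0 <= P t) -> marg P (fun t => phi (g t)) (phi z) = 0 -> marg P g z = 0.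
Proof.
by move=> P0 h; have := @marg_le_comp T Z Z' P g phi z P0; have := @marg_ge0 T Z P g z P0; lra.
Qed.

(** Conditional independence depends only on the partitions of the support. A value of zero
    probability makes both sides vanish; otherwise each coordinate is translated through its own
    representative atom, because the triple need not occur jointly. *)
Lemma markov_ker (T : finType) (A B C A' B' C' : eqType) (P : T -> R)
    (a : T -> A) (b : T -> B) (c : T -> C) (a' : T -> A') (b' : T -> B') (c' : T -> C') :
  (forall t, 0 <= P t) ->
  (forall t s, 0 < P t -> 0 < P s -> a t = a s <-> a' t = a' s) ->
  (forall t s, 0 < P t -> 0 < P s -> b t = b s <-> b' t = b' s) ->
  (forall t s, 0 < P t -> 0 < P s -> c t = c s <-> c' t = c' s) ->
  markov P a b c -> markov P a' b' c'.
Proof.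
move=> P0 ha hb hc m x y z.
have z3 (Z : eqType) (phi : A' * B' * C' -> Z) :
  marg P (fun t => phi (a' t, b' t, c' t)) (phi (x, y, z)) = 0 ->
  marg P (fun s => (a' s, b' s, c' s)) (x, y, z) = 0.
  exact: (@marg_comp_eq0 _ _ _ P (fun t => (a' t, b' t, c' t)) phi (x, y, z) P0).
have nn (Z : eqType) (g : T -> Z) u : 0 <= marg P g u by exact: marg_ge0.
case: (Rle_lt_or_eq_dec _ _ (nn _ a' x)) => [hx|ex]; last first.
  rewrite (z3 _ (fun w => w.1.1)) //= (@marg_comp_eq0 _ _ _ P (fun s => (a' s, b' s)) fst (x, y) P0) //; lra.
case: (Rle_lt_or_eq_dec _ _ (nn _ b' y)) => [hy|ey]; last first.
  rewrite (z3 _ (fun w => w.1.2)) //= (@marg_comp_eq0 _ _ _ P (fun s => (a' s, b' s)) snd (x, y) P0) //; lra.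
case: (Rle_lt_or_eq_dec _ _ (nn _ c' z)) => [hz|ez]; last first.
  rewrite (z3 _ snd) //= (@marg_comp_eq0 _ _ _ P (fun s => (b' s, c' s)) snd (y, z) P0) //; lra.
have [t1 e1 p1] := marg_gt0P hx P0; have [t2 e2 p2] := marg_gt0P hy P0.
have [t3 e3 p3] := marg_gt0P hz P0.
have pos t : 0 < P t \/ P t < 0 -> 0 < P t by case=> //; have := P0 t; lra.
have ea t : 0 < P t -> (a' t == x) = (a t == a t1).
  by move=> ht; rewrite -e1; apply/eqP/eqP => /(ha t t1 ht p1).
have eb t : 0 < P t -> (b' t == y) = (b t == b t2).
  by move=> ht; rewrite -e2; apply/eqP/eqP => /(hb t t2 ht p2).
have ec t : 0 < P t -> (c' t == z) = (c t == c t3).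
  by move=> ht; rewrite -e3; apply/eqP/eqP => /(hc t t3 ht p3).
have := m (a t1) (b t2) (c t3).
have -> : marg P (fun s => (a' s, b' s, c' s)) (x, y, z) = marg P (fun s => (a s, b s, c s)) (a t1, b t2, c t3).
  by apply: eq_marg => t /pos ht; rewrite !xpair_eqE ea // eb // ec.
have -> : marg P (fun s => (a' s, b' s)) (x, y) = marg P (fun s => (a s, b s)) (a t1, b t2).
  by apply: eq_marg => t /pos ht; rewrite !xpair_eqE ea // eb.
have -> : marg P (fun s => (b' s, c' s)) (y, z) = marg P (fun s => (b s, c s)) (b t2, c t3).
  by apply: eq_marg => t /pos ht; rewrite !xpair_eqE ec // eb.
by have -> : marg P b' y = marg P b (b t2) by apply: eq_marg => t /pos ht; rewrite eb.
Qed.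

(** Relabellings that are injective on the support change no entropy and no Markov chain. The
    estimator is transported by the partial inverses [kU] and [kW], which take default values off
    the support. *)
Lemma near_solution_relabel (X Y F U W U' W' : finType) (p : X * Y -> R) (f : X -> Y -> F)
    (Q : X * Y * U * W -> R) (g : X -> U -> W -> F) (r0 rY eps : R) (iU : U -> U') (iW : W -> W') :
  (forall t s, 0 < Q t -> 0 < Q s -> iU (cU t) = iU (cU s) -> cU t = cU s) ->
  (forall t s, 0 < Q t -> 0 < Q s -> iW (cW t) = iW (cW s) -> cW t = cW s) ->
  near_solution p f Q g r0 rY eps ->
  exists (Q' : X * Y * U' * W' -> R) (g' : X -> U' -> W' -> F), near_solution p f Q' g' r0 rY eps.
Proof.
move=> hU hW [HQ hp m1 m2 [i1 i2 ie]]; have [Q0 Q1] := HQ.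
have [[[[x0 y0] u0] w0] _] := pmf_inhab HQ.
pose r (t : X * Y * U * W) : X * Y * U' * W' := (cX t, cY t, iU (cU t), iW (cW t)).
have /functional_choice [kU hkU] : forall u', exists u, forall t, 0 < Q t -> iU (cU t) = u' -> u = cU t.
  move=> u'; case: (classic (exists2 t, 0 < Q t & iU (cU t) = u')) => [[t ht <-]|hn].
    by exists (cU t) => s hs /esym e; apply: hU.
  by exists u0 => t ht e; case: hn; exists t.
have /functional_choice [kW hkW] : forall w', exists w, forall t, 0 < Q t -> iW (cW t) = w' -> w = cW t.
  move=> w'; case: (classic (exists2 t, 0 < Q t & iW (cW t) = w')) => [[t ht <-]|hn].
    by exists (cW t) => s hs /esym e; apply: hW.
  by exists w0 => t ht e; case: hn; exists t.
exists (marg Q r), (fun x u w => g x (kU u) (kW w)); split.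
- exact: marg_pmf.
- by move=> xy; rewrite (marg_marg Q r (fun t => (cX t, cY t))) -hp.
- apply: (@markov_marg _ _ _ _ _ Q r); apply: markov_ker m1 => //.
  by move=> t s ht hs; split=> [e|]; [exact: (congr1 iU e)|exact: hU].
- apply: (@markov_marg _ _ _ _ _ Q r _ (fun t => (cU t, cY t))); apply: markov_ker m2 => //.
    move=> t s ht hs; split=> [e|[/(hU _ _ ht hs) e1 e2]]; last by congr (_, _).
    exact: (congr1 (fun w => (iU w.1, w.2)) e).
  by move=> t s ht hs; split=> [e|]; [exact: (congr1 iW e)|exact: hW].
split.
- apply: Rle_trans i1; right; rewrite (condMI_marg r) // !condMIE //.
  congr (_ + _ - _ - _); apply: entropy_ker => // t s ht hs; split.
  + by move=> [/(hU _ _ ht hs) e1 e2]; congr (_, _).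
  + by move=> e; exact: (congr1 (fun w => (iU w.1, w.2)) e).
  + by move=> [e1 /(hU _ _ ht hs) e2 e3]; congr (_, _, _).
  + by move=> e; exact: (congr1 (fun w => (w.1.1, iU w.1.2, w.2)) e).
- apply: Rle_trans i2; right; rewrite (condMI_marg r) // !condMIE //.
  congr (_ + _ - _ - _); apply: entropy_ker => // t s ht hs; split.
  + by move=> [e1 e2 /(hU _ _ ht hs) e3]; congr (_, (_, _)).
  + by move=> e; exact: (congr1 (fun w => (w.1, (w.2.1, iU w.2.2))) e).
  + by move=> [/(hW _ _ ht hs) e1 e2 /(hU _ _ ht hs) e3]; congr (_, (_, _)).
  + by move=> e; exact: (congr1 (fun w => (iW w.1, (w.2.1, iU w.2.2))) e).
  + by move=> [e0 /(hW _ _ ht hs) e1 e2 /(hU _ _ ht hs) e3]; congr (_, _, (_, _)).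
  + by move=> e; exact: (congr1 (fun w => (w.1.1, iW w.1.2, (w.2.1, iU w.2.2))) e).
  + by move=> [e2 /(hU _ _ ht hs) e3]; congr (_, _).
  + by move=> e; exact: (congr1 (fun w => (w.1, iU w.2)) e).
rewrite (exp_marg Q r (fun t => ind (g (cX t) (kU (cU t)) (kW (cW t)) != f (cX t) (cY t)))).
apply: Rle_trans ie; right; apply: eq_bigr => t _.
case: (Rle_lt_or_eq_dec _ _ (Q0 t)) => [ht|<-]; last by lra.
by rewrite (hkU _ t ht erefl) (hkW _ t ht erefl).
Qed.

Lemma injection_on (K : finType) (S : {set K}) (N : nat) :
  (#|S| <= N)%nat -> (0 < N)%nat -> exists i : K -> 'I_N, {in S &, injective i}.
Proof.
move=> hS N0; exists (fun k => insubd (Ordinal N0) (index k (enum S))) => k k' kS k'S.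
move/(congr1 val); rewrite !val_insubd.
have lt x : x \in S -> (index x (enum S) < N)%nat.
  by move=> xS; apply: leq_trans hS; rewrite cardE index_mem mem_enum.
rewrite !lt // => /(congr1 (nth k (enum S))).
by rewrite !nth_index ?mem_enum.
Qed.

(** * Changing the law of one variable *)

Lemma sum_fibers (T K : finType) (key : T -> K) (lam : K -> R) (F : T -> R) :
  \sum_k (lam k * \sum_t (ind (key t == k) * F t)) = \sum_t (lam (key t) * F t).
Proof.
transitivity (\sum_k \sum_t (ind (key t == k) * (lam k * F t))).
  by apply: eq_bigr => k _; rewrite -sum_mull; apply: eq_bigr => t _; ring.
rewrite exchange_big; apply: eq_bigr => t _.
exact: (sum_delta' (key t) (fun k => lam k * F t)).
Qed.

(** Multiplies the law of [key] by [lam] and keeps the conditional law given [key]. Expectations of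
    fixed functions become linear in [lam]. *)
Definition reweight (T K : finType) (key : T -> K) (lam : K -> R) (P : T -> R) (t : T) : R :=
  lam (key t) * P t.

Lemma reweight_ge0 (T K : finType) (key : T -> K) (lam : K -> R) (P : T -> R) t :
  (forall k, 0 <= lam k) -> (forall t, 0 <= P t) -> 0 <= reweight key lam P t.
Proof. by move=> l0 P0; exact: Rmult_le_pos. Qed.

Lemma marg_reweight (T K : finType) (Z : eqType) (key : T -> K) (lam : K -> R) (P : T -> R)
    (g : T -> Z) (kappa : Z -> K) z :
  (forall t, key t = kappa (g t)) -> marg (reweight key lam P) g z = lam (kappa z) * marg P g z.
Proof.
move=> h; rewrite !margE -sum_mull; apply: eq_bigr => t _; rewrite /reweight h /ind.
by case: eqP => [->|_]; ring.
Qed.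

Lemma marg_snd_eq0 (T : finType) (A B : eqType) (P : T -> R) (a : T -> A) (b : T -> B) x y :
  (forall t, 0 <= P t) -> marg P a x = 0 -> marg P (fun t => (a t, b t)) (x, y) = 0.
Proof. by move=> P0 h; apply: (@marg_comp_eq0 _ _ _ P (fun t => (a t, b t)) fst (x, y) P0). Qed.

(** In a chain [a - b - c] the law of [c] given [b] ignores [a], so preserving the marginal of [b]
    preserves that of [(b,c)]. It is therefore enough to impose the marginal of [X] when changing
    [U], and that of [(U,Y)] when changing [W]. *)
Lemma reweight_markov (T A B C : finType) (P : T -> R) (a : T -> A) (b : T -> B) (c : T -> C) (lam : A -> R) :
  (forall k, 0 <= lam k) -> (forall t, 0 <= P t) -> markov P a b c ->
  (forall y, marg (reweight a lam P) b y = marg P b y) ->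
  (forall yz, marg (reweight a lam P) (fun t => (b t, c t)) yz = marg P (fun t => (b t, c t)) yz) /\
  markov (reweight a lam P) a b c.
Proof.
move=> l0 P0 m hb.
have L0 t := reweight_ge0 a t l0 P0.
have hbc yz : marg (reweight a lam P) (fun t => (b t, c t)) yz = marg P (fun t => (b t, c t)) yz.
  case: yz => y z.
  case: (Rle_lt_or_eq_dec _ _ (@marg_ge0 _ _ P b y P0)) => [hy|ey]; last first.
    by rewrite !marg_snd_eq0 ?hb.
  suff e : marg (reweight a lam P) (fun t => (b t, c t)) (y, z) * marg P b y =
      marg P (fun t => (b t, c t)) (y, z) * marg P b y.
    by apply: Rmult_eq_reg_r e _; lra.
  rewrite -{2}hb -(marg_sum_fst (reweight a lam P) a (fun t => (b t, c t)) (y, z)).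
  rewrite -(marg_sum_fst (reweight a lam P) a b y) -sum_mulr -sum_mull; apply: eq_bigr => x _.
  rewrite (@marg_reweight _ _ _ a lam P (fun t => (a t, (b t, c t))) fst) //.
  rewrite (@marg_reweight _ _ _ a lam P (fun t => (a t, b t)) fst) //=.
  have -> : marg P (fun t => (a t, (b t, c t))) (x, (y, z)) = marg P (fun t => (a t, b t, c t)) (x, y, z).
    by apply: eq_marg => t _; rewrite !xpair_eqE andbA.
  rewrite Rmult_assoc (m x y z) -Rmult_assoc; exact: Rmult_comm.
split=> // x y z.
have e1 : marg (reweight a lam P) (fun t => (a t, b t, c t)) (x, y, z) =
   lam x * marg P (fun t => (a t, b t, c t)) (x, y, z).
  exact: (@marg_reweight _ _ _ a lam P (fun t => (a t, b t, c t)) (fun w => w.1.1)).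
have e2 : marg (reweight a lam P) (fun t => (a t, b t)) (x, y) = lam x * marg P (fun t => (a t, b t)) (x, y).
  exact: (@marg_reweight _ _ _ a lam P (fun t => (a t, b t)) fst).
apply: etrans (congr2 Rmult e1 (hb y)) _; apply: esym; apply: etrans (congr2 Rmult e2 (hbc (y, z))) _.
by rewrite !Rmult_assoc; congr (_ * _); apply: esym; exact: m.
Qed.

Lemma reweight_markov_mid (T K : finType) (A B C : eqType) (P : T -> R) (a : T -> A) (b : T -> B)
    (c : T -> C) (key : T -> K) (lam : K -> R) (kappa : B -> K) :
  (forall t, key t = kappa (b t)) -> markov P a b c -> markov (reweight key lam P) a b c.
Proof.
move=> h m x y z.
rewrite (@marg_reweight _ _ _ key lam P (fun s => (a s, b s, c s)) (fun w => kappa w.1.2)) //.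
rewrite (@marg_reweight _ _ _ key lam P (fun s => (a s, b s)) (fun w => kappa w.2)) //.
rewrite (@marg_reweight _ _ _ key lam P (fun s => (b s, c s)) (fun w => kappa w.1)) //.
rewrite (@marg_reweight _ _ _ key lam P b kappa) //=.
transitivity (lam (kappa y) * lam (kappa y) * (marg P (fun s => (a s, b s, c s)) (x, y, z) * marg P b y)).
  by ring.
by rewrite m; ring.
Qed.

Definition mi_ratio (T : finType) (A B C : eqType) (P : T -> R) (a : T -> A) (b : T -> B) (c : T -> C) (t : T) : R :=
  (marg P (fun s => (a s, b s, c s)) (a t, b t, c t) * marg P c (c t)) /
  (marg P (fun s => (a s, c s)) (a t, c t) * marg P (fun s => (b s, c s)) (b t, c t)).

(** Mutual information is not linear in the law, but it becomes linear in [lam] when the factors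
    [lam] cancel in the ratio under the logarithm; it can then serve as a linear constraint. *)
Lemma condMI_reweight (T K : finType) (A B C : eqType) (P : T -> R) (a : T -> A) (b : T -> B)
    (c : T -> C) (key : T -> K) (lam : K -> R) :
  (forall t, 0 <= P t) -> (forall k, 0 <= lam k) ->
  (forall t, 0 < P t -> 0 < lam (key t) ->
     mi_ratio (reweight key lam P) a b c t = mi_ratio P a b c t) ->
  condMI (reweight key lam P) a b c = \sum_t (lam (key t) * (P t * log2 (mi_ratio P a b c t))).
Proof.
move=> P0 l0 h; apply: eq_bigr => t _; rewrite -/(mi_ratio _ a b c t) {1}/reweight.
case: (Rle_lt_or_eq_dec _ _ (P0 t)) => [Pt|<-]; last by ring.
case: (Rle_lt_or_eq_dec _ _ (l0 (key t))) => [lt|<-]; last by ring.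
by rewrite h //; ring.
Qed.

Lemma reduce_U (X Y F U W : finType) (p : X * Y -> R) (f : X -> Y -> F)
    (Q : X * Y * U * W -> R) (g : X -> U -> W -> F) (r0 rY eps : R) :
  near_solution p f Q g r0 rY eps ->
  exists (Q' : X * Y * 'I_(#|X| + 2) * W -> R) (g' : X -> 'I_(#|X| + 2) -> W -> F),
    near_solution p f Q' g' r0 rY eps.
Proof.
move=> [HQ hp m1 m2 [i1 i2 ie]]; have [Q0 Q1] := HQ.
pose T : finType := (X * Y * U * W)%type.
pose tX : T -> X := fun t => cX t.
pose tY : T -> Y := fun t => cY t.
pose tU : T -> U := fun t => cU t.
pose tW : T -> W := fun t => cW t.
pose r1 := mi_ratio Q tX tU tY.
pose r2 := mi_ratio Q tY tW (fun t => (tX t, tU t)).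
pose F1 (j : option (option X)) (t : T) : R := match j with
  | Some (Some x) => ind (tX t == x) * Q t
  | Some None => Q t * log2 (r1 t)
  | None => Q t * log2 (r2 t) end.
pose Fo (t : T) := Q t * ind (g (cX t) (cU t) (cW t) != f (cX t) (cY t)).
pose fib (G : T -> R) u := \sum_t (ind (tU t == u) * G t).
(* The initial weights are 1 on the support only, so that every weighted point has positive mass. *)
pose lam0 u := ind (~~ leb (marg Q tU u) 0).
(* Selects the marginal constraints, whose sum over [x] is the mass of [u]: this is the positive
   combination needed by [support_reduction]. *)
pose hh (j : option (option X)) : R := if j is Some (Some x) then 1 else 0.
have lam0E (G : T -> R) : (forall t, Q t = 0 -> G t = 0) -> \sum_u (lam0 u * fib G u) = \sum_t G t.
  move=> hG; rewrite sum_fibers; apply: eq_bigr => t _.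
  case: (Rle_lt_or_eq_dec _ _ (Q0 t)) => [Qt|/esym /hG ->]; last by ring.
  rewrite /lam0 (_ : leb _ 0 = false) /ind /=; first by ring.
  by apply/lebP; have := @le_marg _ _ Q tU t Q0; lra.
have hsum u : \sum_j (hh j * fib (F1 j) u) = marg Q tU u.
  transitivity (\sum_x fib (F1 (Some (Some x))) u).
    rewrite (bigD1 None) //= (bigD1 (Some None)) //= (reindex_omap (fun x => Some (Some x)) (fun j => if j is Some (Some x) then Some x else None)) /=.
      rewrite (eq_bigr (fun x => fib (F1 (Some (Some x))) u)); last by move=> x _; ring.
      rewrite !Rmult_0_l !Rplus_0_l; apply: eq_bigl => x.
      by rewrite eqxx.
    by move=> [[x|]|].
  rewrite -(marg_sum_fst Q tX tU u); apply: eq_bigr => x _; rewrite margE; apply: eq_bigr => t _.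
  by rewrite xpair_eqE ind_and /F1; ring.
have [] := @support_reduction U (option (option X)) (fun j => fib (F1 j)) (fib Fo) hh #|U| lam0.
- by move=> u; exact: ind_ge0.
- move=> u; rewrite hsum /lam0; case: lebP => h; rewrite /ind /=; first by lra.
  by move=> _; lra.
- exact: max_card.
move=> lam [l0 lc lo ls].
pose Ql := reweight tU lam Q.
have L0 t : 0 <= Ql t by exact: reweight_ge0.
have hX x : marg Ql tX x = marg Q tX x.
  have := lc (Some (Some x)); rewrite lam0E => [|t /= ->]; last by ring.
  rewrite sum_fibers /F1 !margE => <-; apply: eq_bigr => t _; rewrite /Ql /reweight; ring.
have [hXY mm1] := @reweight_markov T U X Y Q tU tX tY lam l0 Q0 m1 hX.
have hY y : marg Ql tY y = marg Q tY y.
  rewrite -(marg_sum_fst Ql tX tY y) -(marg_sum_fst Q tX tY y); apply: eq_bigr => x _; exact: hXY.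
have HQl : is_pmf Ql.
  split=> //; rewrite -Q1 /rsum -(sum_marg Ql tX) -(sum_marg Q tX).
  by apply: eq_bigr => x _; exact: hX.
have near : near_solution p f Ql g r0 rY eps.
  split=> //.
  - by move=> xy; rewrite -hp; exact: hXY.
  - exact: (@reweight_markov_mid _ _ _ _ _ Q _ (fun t => (cU t, cY t)) _ tU lam fst).
  split.
  - apply: Rle_trans i1; right; rewrite (@condMI_reweight _ _ _ _ _ Q _ _ _ tU lam Q0 l0).
      have := lc (Some None); rewrite lam0E => [|t /= ->]; last by ring.
      by rewrite sum_fibers.
    (* [lam] occurs once above and once below the fraction bar, through [(X,U,Y)] and [(U,Y)]; the
       other two marginals are preserved. In the second mutual information all four marginals
       contain [U], and the factors cancel two against two. *)
    move=> t Qt lt; rewrite /mi_ratio -/Ql.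
    have -> : marg Ql (fun s => (cX s, cU s, cY s)) (cX t, cU t, cY t) =
        lam (cU t) * marg Q (fun s => (cX s, cU s, cY s)) (cX t, cU t, cY t).
      exact: (@marg_reweight _ _ _ tU lam Q (fun s => (cX s, cU s, cY s)) (fun w => w.1.2)).
    have -> : marg Ql (fun s => (cU s, cY s)) (cU t, cY t) =
        lam (cU t) * marg Q (fun s => (cU s, cY s)) (cU t, cY t).
      exact: (@marg_reweight _ _ _ tU lam Q (fun s => (cU s, cY s)) fst).
    have -> : marg Ql (@cY X Y U W) (cY t) = marg Q (@cY X Y U W) (cY t) by exact: hY.
    have -> : marg Ql (fun s => (cX s, cY s)) (cX t, cY t) = marg Q (fun s => (cX s, cY s)) (cX t, cY t).
      exact: hXY.
    have := @le_marg _ _ Q (fun s => (cX s, cY s)) t Q0.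
    have := @le_marg _ _ Q (fun s => (cU s, cY s)) t Q0 => h1 h2.
    have h3 := Rlt_le_trans _ _ _ Qt h1; have h4 := Rlt_le_trans _ _ _ Qt h2.
    rewrite /tU in lt; set l := lam _ in lt *; set a := marg Q _ _; set b := marg Q _ _.
    set c := marg Q _ _ in h4 *; set d := marg Q _ _ in h3 *.
    by field; repeat split; apply: Rgt_not_eq.
  - apply: Rle_trans i2; right; rewrite (@condMI_reweight _ _ _ _ _ Q _ _ _ tU lam Q0 l0).
      have := lc None; rewrite lam0E => [|t /= ->]; last by ring.
      by rewrite sum_fibers.
    move=> t Qt lt; rewrite /mi_ratio -/Ql.
    have -> : marg Ql (fun s => (cY s, cW s, (cX s, cU s))) (cY t, cW t, (cX t, cU t)) =
        lam (cU t) * marg Q (fun s => (cY s, cW s, (cX s, cU s))) (cY t, cW t, (cX t, cU t)).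
      exact: (@marg_reweight _ _ _ tU lam Q (fun s => (cY s, cW s, (cX s, cU s))) (fun w => w.2.2)).
    have -> : marg Ql (fun s => (cX s, cU s)) (cX t, cU t) = lam (cU t) * marg Q (fun s => (cX s, cU s)) (cX t, cU t).
      exact: (@marg_reweight _ _ _ tU lam Q (fun s => (cX s, cU s)) snd).
    have -> : marg Ql (fun s => (cY s, (cX s, cU s))) (cY t, (cX t, cU t)) =
        lam (cU t) * marg Q (fun s => (cY s, (cX s, cU s))) (cY t, (cX t, cU t)).
      exact: (@marg_reweight _ _ _ tU lam Q (fun s => (cY s, (cX s, cU s))) (fun w => w.2.2)).
    have -> : marg Ql (fun s => (cW s, (cX s, cU s))) (cW t, (cX t, cU t)) =
        lam (cU t) * marg Q (fun s => (cW s, (cX s, cU s))) (cW t, (cX t, cU t)).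
      exact: (@marg_reweight _ _ _ tU lam Q (fun s => (cW s, (cX s, cU s))) (fun w => w.2.2)).
    have := @le_marg _ _ Q (fun s => (cY s, (cX s, cU s))) t Q0.
    have := @le_marg _ _ Q (fun s => (cW s, (cX s, cU s))) t Q0 => h1 h2.
    have h3 := Rlt_le_trans _ _ _ Qt h1; have h4 := Rlt_le_trans _ _ _ Qt h2.
    rewrite /tU in lt; set l := lam _ in lt *; set a := marg Q _ _; set b := marg Q _ _.
    set c := marg Q _ _ in h4 *; set d := marg Q _ _ in h3 *.
    by field; repeat split; apply: Rgt_not_eq.
  - apply: Rle_trans ie; rewrite lam0E in lo => [|t Qt]; last by rewrite /Fo Qt; ring.
    apply: Rle_trans lo; right; rewrite sum_fibers; apply: eq_bigr => t _.
    by rewrite /Ql /reweight /Fo; ring.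
have [||iU hi] := @injection_on U [set k | ~~ leb (lam k) 0] (#|X| + 2).
- by apply: leq_trans ls _; rewrite !card_option addn2.
- by rewrite addn2.
have supp t : 0 < Ql t -> cU t \in [set k | ~~ leb (lam k) 0].
  rewrite inE /Ql /reweight /tU => h; apply/lebP => hl; have := Q0 t; have := l0 (cU t) => h1 h2.
  have e : lam (cU t) = 0 by lra.
  by rewrite e in h; lra.
apply: (@near_solution_relabel _ _ _ _ _ _ _ p f Ql g r0 rY eps iU (fun w => w)) => // t s /supp ht /supp hs; exact: hi.
Qed.

Lemma reduce_W (X Y F U W : finType) (p : X * Y -> R) (f : X -> Y -> F)
    (Q : X * Y * U * W -> R) (g : X -> U -> W -> F) (r0 rY eps : R) :
  near_solution p f Q g r0 rY eps ->
  exists (Q' : X * Y * U * 'I_(#|U| * #|Y| + 1) -> R) (g' : X -> U -> 'I_(#|U| * #|Y| + 1) -> F),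
    near_solution p f Q' g' r0 rY eps.
Proof.
move=> [HQ hp m1 m2 [i1 i2 ie]]; have [Q0 Q1] := HQ.
pose T : finType := (X * Y * U * W)%type.
pose tX : T -> X := fun t => cX t.
pose tY : T -> Y := fun t => cY t.
pose tU : T -> U := fun t => cU t.
pose tW : T -> W := fun t => cW t.
pose tUY (t : T) := (tU t, tY t).
pose r2 := mi_ratio Q tY tW (fun t => (tX t, tU t)).
pose F1 (j : option (U * Y)) (t : T) : R := match j with
  | Some uy => ind (tUY t == uy) * Q t
  | None => Q t * log2 (r2 t) end.
pose Fo (t : T) := Q t * ind (g (cX t) (cU t) (cW t) != f (cX t) (cY t)).
pose fib (G : T -> R) w := \sum_t (ind (tW t == w) * G t).
pose lam0 w := ind (~~ leb (marg Q tW w) 0).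
pose hh (j : option (U * Y)) : R := if j is Some uy then 1 else 0.
have lam0E (G : T -> R) : (forall t, Q t = 0 -> G t = 0) -> \sum_w (lam0 w * fib G w) = \sum_t G t.
  move=> hG; rewrite sum_fibers; apply: eq_bigr => t _.
  case: (Rle_lt_or_eq_dec _ _ (Q0 t)) => [Qt|/esym /hG ->]; last by ring.
  rewrite /lam0 (_ : leb _ 0 = false) /ind /=; first by ring.
  by apply/lebP; have := @le_marg _ _ Q tW t Q0; lra.
have hsum w : \sum_j (hh j * fib (F1 j) w) = marg Q tW w.
  transitivity (\sum_uy fib (F1 (Some uy)) w).
    rewrite (bigD1 None) //= (reindex_omap Some (fun j => j)) /=; last by case.
    rewrite (eq_bigr (fun x => fib (F1 (Some x)) w)); last by move=> x _; ring.
    rewrite !Rmult_0_l !Rplus_0_l; apply: eq_bigl => x.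
    by rewrite eqxx.
  rewrite -(marg_sum_fst Q tUY tW w); apply: eq_bigr => x _; rewrite margE; apply: eq_bigr => t _.
  by rewrite xpair_eqE ind_and /F1 -Rmult_assoc; congr (_ * _); exact: Rmult_comm.
have [] := @support_reduction W (option (U * Y)) (fun j => fib (F1 j)) (fib Fo) hh #|W| lam0.
- by move=> w; exact: ind_ge0.
- move=> w; rewrite hsum /lam0; case: lebP => h; rewrite /ind /=; first by lra.
  by move=> _; lra.
- exact: max_card.
move=> lam [l0 lc lo ls].
pose Ql := reweight tW lam Q.
have L0 t : 0 <= Ql t by exact: reweight_ge0.
have hUY uy : marg Ql tUY uy = marg Q tUY uy.
  have := lc (Some uy); rewrite lam0E => [|t /= ->]; last by ring.
  rewrite sum_fibers /F1 !margE => <-; apply: eq_bigr => t _; rewrite /Ql /reweight; ring.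
have [hUYX mm2] := @reweight_markov T W _ X Q tW tUY tX lam l0 Q0 (markov_sym m2) hUY.
(* All marginals without [W] are preserved, hence so is the first mutual information without being
   made a constraint. *)
have same (Z : eqType) (phi : U * Y * X -> Z) z :
    marg Ql (fun t => phi (tUY t, tX t)) z = marg Q (fun t => phi (tUY t, tX t)) z.
  rewrite -(marg_marg Ql (fun t => (tUY t, tX t)) phi) -(marg_marg Q (fun t => (tUY t, tX t)) phi) !margE.
  by apply: eq_bigr => w _; congr (_ * _); exact: hUYX.
have HQl : is_pmf Ql.
  split=> //; rewrite -Q1 /rsum -(sum_marg Ql tUY) -(sum_marg Q tUY).
  by apply: eq_bigr => x _; exact: hUY.
have sameH (Z : eqType) (phi : U * Y * X -> Z) :
    entropy Ql (fun t => phi (tUY t, tX t)) = entropy Q (fun t => phi (tUY t, tX t)).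
  rewrite -(entropy_marg Ql (fun t => (tUY t, tX t)) phi) -(entropy_marg Q (fun t => (tUY t, tX t)) phi).
  by congr (entropy _ phi); apply: functional_extensionality => z; exact: hUYX.
have near : near_solution p f Ql g r0 rY eps.
  split=> //.
  - by move=> xy; rewrite -hp; exact: (same _ (fun w => (w.2, w.1.2))).
  - move=> u x y.
    apply: etrans (congr2 Rmult (same _ (fun w => (w.1.1, w.2, w.1.2)) (u, x, y)) (same _ (fun w => w.2) x)) _.
    apply: esym.
    apply: etrans (congr2 Rmult (same _ (fun w => (w.1.1, w.2)) (u, x)) (same _ (fun w => (w.2, w.1.2)) (x, y))) _.
    by apply: esym; exact: (m1 u x y).
  - exact: markov_sym.
  split.
  - apply: Rle_trans i1; right; rewrite !condMIE //.
    congr (_ + _ - _ - _).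
    + exact: (sameH _ (fun w => (w.2, w.1.2))).
    + exact: (sameH _ (fun w => (w.1.1, w.1.2))).
    + exact: (sameH _ (fun w => (w.2, w.1.1, w.1.2))).
    + exact: (sameH _ (fun w => w.1.2)).
  - apply: Rle_trans i2; right; rewrite (@condMI_reweight _ _ _ _ _ Q _ _ _ tW lam Q0 l0).
      have := lc None; rewrite lam0E => [|t /= ->]; last by ring.
      by rewrite sum_fibers.
    move=> t Qt lt; rewrite /mi_ratio -/Ql.
    have -> : marg Ql (fun s => (cY s, cW s, (cX s, cU s))) (cY t, cW t, (cX t, cU t)) =
        lam (cW t) * marg Q (fun s => (cY s, cW s, (cX s, cU s))) (cY t, cW t, (cX t, cU t)).
      exact: (@marg_reweight _ _ _ tW lam Q (fun s => (cY s, cW s, (cX s, cU s))) (fun w => w.1.2)).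
    have -> : marg Ql (fun s => (cX s, cU s)) (cX t, cU t) = marg Q (fun s => (cX s, cU s)) (cX t, cU t).
      exact: (same _ (fun w => (w.2, w.1.1))).
    have -> : marg Ql (fun s => (cY s, (cX s, cU s))) (cY t, (cX t, cU t)) =
        marg Q (fun s => (cY s, (cX s, cU s))) (cY t, (cX t, cU t)).
      exact: (same _ (fun w => (w.1.2, (w.2, w.1.1)))).
    have -> : marg Ql (fun s => (cW s, (cX s, cU s))) (cW t, (cX t, cU t)) =
        lam (cW t) * marg Q (fun s => (cW s, (cX s, cU s))) (cW t, (cX t, cU t)).
      exact: (@marg_reweight _ _ _ tW lam Q (fun s => (cW s, (cX s, cU s))) fst).
    have := @le_marg _ _ Q (fun s => (cY s, (cX s, cU s))) t Q0.
    have := @le_marg _ _ Q (fun s => (cW s, (cX s, cU s))) t Q0 => h1 h2.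
    have h3 := Rlt_le_trans _ _ _ Qt h1; have h4 := Rlt_le_trans _ _ _ Qt h2.
    rewrite /tW in lt; set l := lam _ in lt *; set a := marg Q _ _; set b := marg Q _ _.
    set c := marg Q _ _ in h4 *; set d := marg Q _ _ in h3 *.
    by field; repeat split; apply: Rgt_not_eq.
  - apply: Rle_trans ie; rewrite lam0E in lo => [|t Qt]; last by rewrite /Fo Qt; ring.
    apply: Rle_trans lo; right; rewrite sum_fibers; apply: eq_bigr => t _.
    by rewrite /Ql /reweight /Fo; ring.
have [||iW hi] := @injection_on W [set k | ~~ leb (lam k) 0] (#|U| * #|Y| + 1).
- by apply: leq_trans ls _; rewrite card_option card_prod addn1.
- by rewrite addn1.
have supp t : 0 < Ql t -> cW t \in [set k | ~~ leb (lam k) 0].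
  rewrite inE /Ql /reweight /tW => h; apply/lebP => hl; have := Q0 t; have := l0 (cW t) => h1 h2.
  have e : lam (cW t) = 0 by lra.
  by rewrite e in h; lra.
apply: (@near_solution_relabel _ _ _ _ _ _ _ p f Ql g r0 rY eps (fun u => u) iW) => // t s /supp ht /supp hs; exact: hi.
Qed.

(** * Compactness and conclusion *)

Lemma inv_S_gt0 k : 0 < / INR k.+1.
Proof. by apply: Rinv_0_lt_compat; rewrite S_INR; have := pos_INR k; lra. Qed.

Lemma inv_S_le k k' : (k <= k')%nat -> / INR k'.+1 <= / INR k.+1.
Proof.
move=> /leP /le_INR h; apply: Rinv_le_contravar; rewrite !S_INR; last by lra.
by have := pos_INR k; lra.
Qed.

Lemma inv_S_small eps : 0 < eps -> exists N : nat, forall k : nat, (N <= k)%nat -> / INR k.+1 < eps.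
Proof.
move=> e0; have [N hN] := exists_INR_ge (/ eps); exists N => k /hN h.
rewrite -(Rinv_inv eps); apply: Rinv_lt_contravar; last by rewrite S_INR; lra.
by apply: Rmult_lt_0_compat; [exact: Rinv_0_lt_compat|rewrite S_INR; have := pos_INR k; lra].
Qed.

Lemma Un_cv_eq (u v : nat -> R) l : (forall n, u n = v n) -> Un_cv v l -> Un_cv u l.
Proof. by move=> e h eps e0; have [N hN] := h eps e0; exists N => n hn; rewrite e; exact: hN. Qed.

Lemma Un_cv_const (c : R) : Un_cv (fun => c) c.
Proof. by move=> eps e0; exists 0%nat => n _; rewrite R_dist_eq. Qed.

Lemma Un_cv_sum (I : finType) (u : nat -> I -> R) (l : I -> R) :
  (forall i, Un_cv (fun n => u n i) (l i)) -> Un_cv (fun n => \sum_i u n i) (\sum_i l i).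
Proof.
move=> h; elim: (index_enum I) => [|i s ih].
  by apply: Un_cv_eq (_ : Un_cv (fun => 0) _) => [n|]; rewrite ?big_nil //; exact: Un_cv_const.
apply: (@Un_cv_eq _ (fun n => u n i + \big[Rplus/0]_(j <- s) u n j)) => [n|]; first by rewrite big_cons.
by rewrite big_cons; apply: CV_plus.
Qed.

Lemma Un_cv_le_inv (u : nat -> R) l B : Un_cv u l -> (forall k, u k <= B + / INR k.+1) -> l <= B.
Proof.
move=> h hB; apply: Rnot_lt_le => hl.
have e0 : 0 < (l - B) / 2 by lra.
have [N1 hN1] := h _ e0; have [N2 hN2] := inv_S_small e0.
have h1 := hN1 (maxn N1 N2) (leP (leq_maxl N1 N2)).
have h2 := hN2 (maxn N1 N2) (leq_maxr N1 N2).
have := hB (maxn N1 N2); move: h1; rewrite /R_dist /Rabs; case: Rcase_abs; lra.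
Qed.

(** [ln y <= y - 1] at [y = 1 / sqrt x]. This yields continuity of [x * log2 x] at 0, where the
    logarithm itself gives none. *)
Lemma xlog2x_small x : 0 < x -> x <= 1 -> Rabs (x * log2 x) <= 2 / ln 2 * sqrt x.
Proof.
move=> x0 x1; have s0 := sqrt_lt_R0 x x0; have ss := sqrt_sqrt x (Rlt_le _ _ x0).
have l2 := ln2_gt0; have il2 := Rinv_0_lt_compat _ l2.
set s := sqrt x in s0 ss *.
have e1 : ln x = 2 * ln s by rewrite -ss ln_mult //; lra.
have h1 := ln_le_sub1 (Rinv_0_lt_compat _ s0); rewrite ln_Rinv // in h1.
have h2 : ln x <= 0 by rewrite -ln_1; case: x1 => [x1|->]; [left; exact: ln_increasing|right].
rewrite /log2 Rabs_left1; last first.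
  have : 0 <= x * (- ln x * / ln 2); last by rewrite /Rdiv; lra.
  by do !apply: Rmult_le_pos; lra.
have h3 : x * / s = s by rewrite -ss; field; lra.
have h4 : - ln s * x <= s.
  by rewrite -{2}h3 Rmult_comm; apply: Rmult_le_compat_l; lra.
have : 0 <= (s - - ln s * x) * / ln 2 by apply: Rmult_le_pos; lra.
by rewrite e1 /Rdiv; lra.
Qed.

Lemma Un_cv_xlog2x (u : nat -> R) l : (forall n, 0 <= u n) -> 0 <= l -> Un_cv u l ->
  Un_cv (fun n => u n * log2 (u n)) (l * log2 l).
Proof.
move=> u0 l0 h; case: (Rle_lt_or_eq_dec _ _ l0) => [lp|le].
  apply: CV_mult => //; apply: (@continuity_seq log2) => //.
  apply: derivable_continuous_pt; rewrite /log2; apply: derivable_pt_mult.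
    by exists (/ l); exact: derivable_pt_lim_ln.
  exact: derivable_pt_const.
subst l; rewrite Rmult_0_l => eps e0.
have l2 := ln2_gt0.
pose d := (eps * ln 2 / 2).
have d0 : 0 < d by rewrite /d; nra.
have m0 : 0 < Rmin 1 (d * d) by apply: Rmin_pos; nra.
have [N hN] := h _ m0; exists N => n /hN; rewrite /R_dist !Rminus_0_r Rabs_right; last exact: Rle_ge.
move=> hu; case: (Rle_lt_or_eq_dec _ _ (u0 n)) => [up|<-]; last by rewrite Rmult_0_l Rabs_R0.
have h1 := Rmin_l 1 (d * d); have h2 := Rmin_r 1 (d * d).
apply: Rle_lt_trans (xlog2x_small up _) _; first by lra.
have hs : sqrt (u n) < d.
  by rewrite -(sqrt_square d); [apply: sqrt_lt_1; nra|lra].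
have : 2 / ln 2 * sqrt (u n) < 2 / ln 2 * d by apply: Rmult_lt_compat_l => //; apply: Rdiv_lt_0_compat; lra.
by have -> : 2 / ln 2 * d = eps by rewrite /d; field; lra.
Qed.

Lemma Un_cv_marg (T : finType) (Z : eqType) (Q : nat -> T -> R) (L : T -> R) (g : T -> Z) z :
  (forall t, Un_cv (fun k => Q k t) (L t)) -> Un_cv (fun k => marg (Q k) g z) (marg L g z).
Proof.
move=> h; rewrite margE; apply: Un_cv_eq (_ : Un_cv (fun k => \sum_t (ind (g t == z) * Q k t)) _).
  by move=> k; rewrite margE.
apply: Un_cv_sum => t; apply: CV_mult => //; exact: Un_cv_const.
Qed.

(** Summing over values rather than outcomes exhibits the entropy as a finite sum of terms
    [x * log2 x], which are continuous in the law. *)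
Lemma entropyE (T Z : finType) (P : T -> R) (g : T -> Z) :
  entropy P g = - \sum_z (marg P g z * log2 (marg P g z)).
Proof. by rewrite (exp_marg P g (fun z => log2 (marg P g z))). Qed.

Lemma Un_cv_entropy (T Z : finType) (Q : nat -> T -> R) (L : T -> R) (g : T -> Z) :
  (forall k t, 0 <= Q k t) -> (forall t, 0 <= L t) ->
  (forall t, Un_cv (fun k => Q k t) (L t)) -> Un_cv (fun k => entropy (Q k) g) (entropy L g).
Proof.
move=> Q0 L0 h; rewrite entropyE.
apply: (@Un_cv_eq _ (fun k => - \sum_z (marg (Q k) g z * log2 (marg (Q k) g z)))).
  by move=> k; rewrite entropyE.
apply: CV_opp; apply: Un_cv_sum => z; apply: Un_cv_xlog2x; last exact: Un_cv_marg.
  by move=> k; exact: marg_ge0.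
exact: marg_ge0.
Qed.

Lemma Un_cv_condMI (T A B C : finType) (Q : nat -> T -> R) (L : T -> R)
    (a : T -> A) (b : T -> B) (c : T -> C) :
  (forall k t, 0 <= Q k t) -> (forall t, 0 <= L t) ->
  (forall t, Un_cv (fun k => Q k t) (L t)) -> Un_cv (fun k => condMI (Q k) a b c) (condMI L a b c).
Proof.
move=> Q0 L0 h; rewrite condMIE //.
apply: (@Un_cv_eq _ (fun k => entropy (Q k) (fun t => (a t, c t)) + entropy (Q k) (fun t => (b t, c t))
    - entropy (Q k) (fun t => (a t, b t, c t)) - entropy (Q k) c)).
  by move=> k; rewrite condMIE.
by apply: CV_minus; [apply: CV_minus; [apply: CV_plus|]|]; exact: Un_cv_entropy.
Qed.

(** Coordinates are treated one after the other, each extraction refining the previous one. The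
    bound [k <= phi k] makes limits and the slack [1/(k+1)] survive the extraction. *)
Lemma bounded_subseq (T : finType) (q : nat -> T -> R) :
  (forall k t, 0 <= q k t <= 1) ->
  exists (phi : nat -> nat) (l : T -> R), (forall k, (k <= phi k)%nat) /\
    forall t, Un_cv (fun k => q (phi k) t) (l t).
Proof.
move=> hq.
suff [phi [l [h1 h2]]] : exists (phi : nat -> nat) (l : T -> R), (forall k, (k <= phi k)%nat) /\
    forall t, t \in enum T -> Un_cv (fun k => q (phi k) t) (l t).
  by exists phi, l; split=> // t; apply: h2; rewrite mem_enum.
elim: (enum T) => [|t0 s [phi [l [h1 h2]]]]; first by exists (fun k => k), (fun => 0).
have [l0 hl0] := Bolzano_Weierstrass (fun k => q (phi k) t0) (fun x => 0 <= x <= 1)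
  (compact_P3 0 1) (fun k => hq (phi k) t0).
have /functional_choice [psi hpsi] : forall k : nat, exists m : nat,
    (k <= m)%nat /\ Rabs (q (phi m) t0 - l0) < / INR k.+1.
  move=> k; have [|m [hm1 hm2]] := hl0 (disc l0 (mkposreal _ (inv_S_gt0 k))) k.
    by exists (mkposreal _ (inv_S_gt0 k)).
  by exists m; split=> //; apply/leP.
exists (fun k => phi (psi k)), (fun t => if t == t0 then l0 else l t); split.
  by move=> k; apply: leq_trans (h1 _); have [] := hpsi k.
move=> t; rewrite inE; case: eqP => [-> _|_ /= ts].
  move=> eps e0; have [N hN] := inv_S_small e0; exists N => n /leP /hN h.
  by have [_] := hpsi n; rewrite /R_dist; lra.
move=> eps e0; have [N hN] := h2 t ts eps e0; exists N => n hn; apply: hN.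
by apply: Nat.le_trans hn _; apply/leP; have [] := hpsi n.
Qed.

Lemma near_solution_weaken (X Y F U W : finType) (p : X * Y -> R) (f : X -> Y -> F)
    (Q : X * Y * U * W -> R) g (r0 rY eps r0' rY' eps' : R) :
  r0 <= r0' -> rY <= rY' -> eps <= eps' -> near_solution p f Q g r0 rY eps ->
  near_solution p f Q g r0' rY' eps'.
Proof. by move=> h1 h2 h3 [? ? ? ? [? ? ?]]; split=> //; split; lra. Qed.

Lemma log2_msize_le n r : (0 < n)%nat -> (0 < msize n r)%nat -> / INR n * log2 (INR (msize n r)) <= r.
Proof.
move=> n0 m0; have N0 : 0 < INR n by apply: lt_0_INR; apply/ltP.
have M0 : 0 < INR (msize n r) by apply: lt_0_INR; apply/ltP.
apply: (Rmult_le_reg_l (INR n)) => //; rewrite -Rmult_assoc Rinv_r ?Rmult_1_l; last by lra.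
by rewrite -(log2_pow2 (INR n * r)); apply: log2_le => //; exact: msize_le.
Qed.

(** The alphabets in the conclusion do not depend on [d], which makes a limit possible. [U] is
    reduced before [W] because the bound for [W] involves the size of the alphabet of [U]. *)
Lemma near_solution_of_rate_region (X Y F : finType) (p : X * Y -> R) (f : X -> Y -> F) (R0 RX RY d : R) :
  is_pmf p -> rate_region p f R0 RX RY -> 0 < d ->
  exists (Q : X * Y * 'I_(#|X| + 2) * 'I_(#|'I_(#|X| + 2)| * #|Y| + 1) -> R) g,
    near_solution p f Q g (R0 + d) (RY + d) d.
Proof.
move=> Hp hr d0; have [a0 [aX [aY [ha [h0 [hX hY]]]]]] := hr d d0.
have [N hN] := ha d d0; have [c hc] := hN N.+1 (leqnSn N).
have [[x0 y0] _] := pmf_inhab Hp.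
(* The rates of the code could be negative, but the encoders have values, so the message sets are
   not empty. *)
have m0 : (0 < msize N.+1 a0)%nat by case: (enc0 c [ffun => x0]) => k; exact: leq_ltn_trans.
have mY : (0 < msize N.+1 aY)%nat.
  by case: (encY c [ffun => y0] (enc0 c [ffun => x0])) => k; exact: leq_ltn_trans.
have [U [W [Q [g hQ]]]] := near_solution_of_code f c Hp isT.
have h1 := @log2_msize_le N.+1 a0 isT m0; have h2 := @log2_msize_le N.+1 aY isT mY.
have {h0} h0 : a0 <= R0 + d by move: h0; rewrite /Rabs; case: Rcase_abs; lra.
have {hY} hY : aY <= RY + d by move: hY; rewrite /Rabs; case: Rcase_abs; lra.
have {}hQ := near_solution_weaken (Rle_trans _ _ _ h1 h0) (Rle_trans _ _ _ h2 hY) hc hQ.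
have [Q1 [g1 hQ1]] := reduce_U hQ.
exact: reduce_W hQ1.
Qed.

(** The label of [w] is the set of pairs [(u,y)] that occur together with [w]. Adjacent pairs share
    the side information [(x,u)], and the second Markov chain makes both of them occur with [x] and
    this same [w], against the hypothesis on the support. *)
Lemma single_letter_of_support (X Y F U W : finType) (p : X * Y -> R) (f : X -> Y -> F)
    (Q : X * Y * U * W -> R) (R0 RY : R) :
  is_pmf Q -> (forall xy, marg Q (fun t => (cX t, cY t)) xy = p xy) ->
  markov Q (@cU X Y U W) (@cX X Y U W) (@cY X Y U W) ->
  markov Q (@cX X Y U W) (fun t => (cU t, cY t)) (@cW X Y U W) ->
  (forall x y1 y2 u w, f x y1 <> f x y2 -> Q (x, y1, u, w) * Q (x, y2, u, w) <= 0) ->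
  condMI Q (@cX X Y U W) (@cU X Y U W) (@cY X Y U W) <= R0 ->
  condMI Q (@cY X Y U W) (@cW X Y U W) (fun t => (cX t, cU t)) <= RY ->
  exists lab : W -> {set U * Y}, single_letter p f Q lab R0 RY.
Proof.
move=> HQ hp m1 m2 hf i1 i2; have [Q0 Q1] := HQ.
pose muyw uy w := marg Q (fun t => (cU t, cY t, cW t)) (uy, w).
pose lab w := [set uy : U * Y | ~~ leb (muyw uy w) 0].
exists lab; split=> //; split=> //; split=> //; split=> //; split; last split=> //.
  move=> w [u1 y1] [u2 y2]; rewrite !inE => /lebP l1 /lebP l2 [s1 [s2 [k [hpos hne]]]].
  have nn := @marg_ge0 _ _ Q (fun t => (cU t, cY t, (cX t, cU t), (cX t, cY t))) _ Q0.
  have [q1 q2] : 0 < marg Q (fun t => (cU t, cY t, (cX t, cU t), (cX t, cY t))) (u1, y1, k, s1) /\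
     0 < marg Q (fun t => (cU t, cY t, (cX t, cU t), (cX t, cY t))) (u2, y2, k, s2).
    have n1 := nn (u1, y1, k, s1); have n2 := nn (u2, y2, k, s2).
    by split; apply: Rnot_le_lt => hle; move: hpos n1 n2;
       set A := marg _ _ _ in hle *; set B := marg _ _ _ in hle *; nra.
  have [[[[x1' y1'] u1'] w1'] e1 p1] := marg_gt0P q1 Q0.
  have [[[[x2' y2'] u2'] w2'] e2 p2] := marg_gt0P q2 Q0.
  rewrite /cU /cX /cY /= in e1 e2.
  case: e1 => ? ? ? ?; case: e2 => ? ? ek ?; subst; case: ek => ? ?; subst.
  (* Given [(u,y)], [X] and [W] are independent, so a possible [x] and a possible [w] are jointly
     possible. *)
  have full x y u w' : 0 < Q (x, y, u, w') -> 0 < muyw (u, y) w -> 0 < Q (x, y, u, w).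
    move=> h1 h2.
    have h3 := Rlt_le_trans _ _ _ h1 (@le_marg _ _ Q (fun t => (cX t, (cU t, cY t))) (x, y, u, w') Q0).
    have h5 := @marg_ge0 _ _ Q (fun t => (cU t, cY t)) (u, y) Q0.
    have h6 : 0 < marg Q (fun t => (cX t, (cU t, cY t), cW t)) (x, (u, y), w).
      have h7 := Rmult_lt_0_compat _ _ h3 h2.
      apply: Rnot_le_lt => hle.
      have := Rlt_le_trans _ _ _ h7 (Req_le _ _ (esym (m2 x (u, y) w))) => h8.
      by have := Rmult_le_compat_r _ _ _ h5 hle; rewrite Rmult_0_l => h9; move: (Rlt_le_trans _ _ _ h8 h9); lra.
    have [[[[x' y'] u'] w''] e p3] := marg_gt0P h6 Q0.
    by rewrite /cU /cX /cY /cW /= in e; case: e => ? ? ? ?; subst.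
  have f1 := full _ _ _ _ p1 (Rnot_le_lt _ _ l1); have f2 := full _ _ _ _ p2 (Rnot_le_lt _ _ l2).
  by case: (Rlt_not_le _ _ (Rmult_lt_0_compat _ _ f1 f2)); exact: hf.
rewrite -Q1; apply: eq_bigr => -[[[x y] u] w] _; rewrite /cU /cY /cW /=.
case: (Rle_lt_or_eq_dec _ _ (Q0 (x, y, u, w))) => [h|<-]; last by case: ifP.
rewrite inE; case: lebP => // hle.
have := Rlt_le_trans _ _ _ h (@le_marg _ _ Q (fun t => (cU t, cY t, cW t)) (x, y, u, w) Q0) => h2.
by move: (Rlt_le_trans _ _ _ h2 hle); lra.
Qed.

Lemma single_letter_of_rate_region (X Y F : finType) (p : X * Y -> R) (f : X -> Y -> F) (R0 RX RY : R) :
  is_pmf p -> rate_region p f R0 RX RY ->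
  exists (Q : X * Y * 'I_(#|X| + 2) * 'I_(#|'I_(#|X| + 2)| * #|Y| + 1) -> R) lab,
    single_letter p f Q lab R0 RY.
Proof.
move=> Hp hr.
have /functional_choice [Qk hQk] := fun k => near_solution_of_rate_region Hp hr (inv_S_gt0 k).
have pmfk k : is_pmf (Qk k) by have [g []] := hQk k.
have Q01 k t : 0 <= Qk k t <= 1.
  have [h0 h1] := pmfk k; split=> //; rewrite -h1; exact: sum_term_le.
have [phi [Q [hphi hQ]]] := bounded_subseq Q01.
pose V k := Qk (phi k).
have V0 k t : 0 <= V k t by have [] := Q01 (phi k) t.
have near k : exists g, near_solution p f (V k) g (R0 + / INR k.+1) (RY + / INR k.+1) (/ INR k.+1).
  have [g hg] := hQk (phi k); exists g; have := inv_S_le (hphi k) => h.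
  by apply: near_solution_weaken hg; lra.
have Q0 t : 0 <= Q t.
  have : - Q t <= 0; last by lra.
  apply: (Un_cv_le_inv (CV_opp _ _ (hQ t))) => k; rewrite /opp_seq.
  by have := V0 k t; have := inv_S_gt0 k; rewrite /V; lra.
have HQ : is_pmf Q.
  split=> //; apply: UL_sequence (Un_cv_sum hQ) _.
  apply: Un_cv_eq (Un_cv_const 1) => k; have [_] := pmfk (phi k); exact.
have cm (Z : eqType) (g : X * Y * 'I_(#|X| + 2) * 'I_(#|'I_(#|X| + 2)| * #|Y| + 1) -> Z) z :
   Un_cv (fun k => marg (V k) g z) (marg Q g z) by exact: Un_cv_marg.
have [lab hlab] : exists lab, single_letter p f Q lab R0 RY; last by exists Q, lab.
apply: single_letter_of_support => //.
- move=> xy; apply: UL_sequence (cm _ _ xy) _.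
  by apply: Un_cv_eq (Un_cv_const _) => k; have [g []] := near k.
- move=> u x y; apply: UL_sequence (CV_mult _ _ _ _ (cm _ _ _) (cm _ _ _)) _.
  apply: Un_cv_eq (CV_mult _ _ _ _ (cm _ _ _) (cm _ _ _)) => k.
  by have [g [_ _ h _ _]] := near k; exact: h.
- move=> x uy w; apply: UL_sequence (CV_mult _ _ _ _ (cm _ _ _) (cm _ _ _)) _.
  apply: Un_cv_eq (CV_mult _ _ _ _ (cm _ _ _) (cm _ _ _)) => k.
  by have [g [_ _ _ h _]] := near k; exact: h.
(* The estimator, which varies with [k], is wrong at one of the two points at least. That point has
   mass at most the error, the other at most 1, so the product tends to 0. *)
- move=> x y1 y2 u w hne.
  apply: (Un_cv_le_inv (CV_mult _ _ _ _ (hQ (x, y1, u, w)) (hQ (x, y2, u, w)))) => k.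
  have [g [[_ hs] _ _ _ [_ _ he]]] := near k; rewrite -/(V k) Rplus_0_l.
  have small y : g x u w != f x y -> V k (x, y, u, w) <= / INR k.+1.
    move=> hy; apply: Rle_trans he.
    have := @sum_term_le _ (x, y, u, w) (fun t => V k t * ind (g (cX t) (cU t) (cW t) != f (cX t) (cY t))).
    rewrite /cX /cY /cU /cW /= hy {1}/ind Rmult_1_r; apply => t.
    by apply: Rmult_le_pos => //; exact: ind_ge0.
  have [b1 b2] := Q01 (phi k) (x, y1, u, w); have [b3 b4] := Q01 (phi k) (x, y2, u, w).
  have ik := inv_S_gt0 k; rewrite -/(V k) in b1 b2 b3 b4.
  case: (eqVneq (g x u w) (f x y1)) => [e|/small h]; last by nra.
  have /small h : g x u w != f x y2 by rewrite e; apply/eqP.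
  by nra.
- apply: (Un_cv_le_inv (Un_cv_condMI _ _ _ V0 Q0 hQ)) => k.
  by have [g [_ _ _ _ [h _ _]]] := near k.
- apply: (Un_cv_le_inv (Un_cv_condMI _ _ _ V0 Q0 hQ)) => k.
  by have [g [_ _ _ _ [_ h _]]] := near k.
Qed.

Theorem theorem5 (X Y F : finType) (p : X * Y -> R) (f : X -> Y -> F)
  (Hp : is_pmf p) (R0 RX RY : R) (HRX : entropy p (fun s : X * Y => s.1) < RX) :
  (rate_region p f R0 RX RY <->
     exists (U W : finType) (Q : X * Y * U * W -> R) (lab : W -> {set U * Y}),
       single_letter p f Q lab R0 RY) /\
  (rate_region p f R0 RX RY <->
     exists (U W : finType) (Q : X * Y * U * W -> R) (lab : W -> {set U * Y}),
       (#|U| <= #|X| + 2)%nat /\ (#|W| <= (#|X| + 2) * #|Y| + 1)%nat /\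
       single_letter p f Q lab R0 RY).
Proof.
have direct (U W : finType) (Q : X * Y * U * W -> R) (lab : W -> {set U * Y}) :
  single_letter p f Q lab R0 RY -> rate_region p f R0 RX RY.
  exact: rate_region_of_single_letter.
split; split.
- by move=> /(single_letter_of_rate_region Hp) [Q [lab h]]; do 2!eexists; exists Q, lab.
- by move=> [U [W [Q [lab h]]]]; exact: direct h.
- move=> /(single_letter_of_rate_region Hp) [Q [lab h]]; do 2!eexists; exists Q, lab.
  by split; [|split=> //]; rewrite !card_ord.
- by move=> [U [W [Q [lab [_ [_ h]]]]]]; exact: direct h.
Qed.
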